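(* Let $k\ge1$, $K=3k+2$. For integers $0\le a\le k$ and $0\le b<k$, \begin{align*} \tilde\chi^K_{a,b}(q)&=\sum_{\substack{\lambda_1,\dots,\lambda_k\ge0\\ \mu_1,\dots,\mu_{k-1}\ge0}}\frac{q^{\lambda_k^2+\sum_{i=a+1}^k\lambda_i+\sum_{i=b+1}^{k-1}\mu_i}}{(q;q)_{\lambda_1}}\prod_{i=1}^{k-1}q^{\lambda_i^2-\lambda_i\mu_i+\mu_i^2}\binom{\lambda_i}{\lambda_{i+1}}_q\binom{\lambda_i-\lambda_{i+1}+\mu_{i+1}+\delta_{b,i}}{\mu_i}_q\\ &\quad-\chi(ab>0)\sum_{\substack{\lambda_1,\dots,\lambda_k\ge0\\ \mu_1,\dots,\mu_{k-1}\ge0}}\frac{q^{1+\lambda_k^2+\sum_{i=a}^k\lambda_i+\sum_{i=b}^{k-1}\mu_i}}{(q;q)_{\lambda_1}}\prod_{i=1}^{k-1}q^{\lambda_i^2-\lambda_i\mu_i+\mu_i^2}\binom{\lambda_i}{\lambda_{i+1}}_q\binom{\lambda_i-\lambda_{i+1}+\mu_{i+1}+\delta_{b-1,i}}{\mu_i}_q, \end{align*} and moreover \[\tilde\chi^K_{k,k}(q)=\sum_{\substack{\lambda_1,\dots,\lambda_k\ge0\\ \mu_1,\dots,\mu_{k-1}\ge0}}\frac{q^{\lambda_k^2}}{(q;q)_{\lambda_1}}\prod_{i=1}^{k-1}q^{\lambda_i^2-\lambda_i\mu_i+\mu_i^2}\binom{\lambda_i}{\lambda_{i+1}}_q\binom{\lambda_i-\lambda_{i+1}+\mu_{i+1}}{\mu_i}_q,\]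 where in all sums $\lambda_{k+1}:=0$ and $\mu_k:=2\lambda_k$.
   Context: $(a;q)_n=\prod_{j=0}^{n-1}(1-aq^j)$, $(a;q)_\infty=\prod_{j\ge0}(1-aq^j)$; $\binom{n}{m}_q=\frac{(q;q)_n}{(q;q)_m(q;q)_{n-m}}$ for $0\le m\le n$ and $0$ otherwise. $\delta_{i,j}$ is the Kronecker delta, $\chi(\cdot)$ the indicator function. $\theta(z;q)=(z;q)_\infty(q/z;q)_\infty$, $\theta(z_1,\dots,z_n;q)=\prod\theta(z_i;q)$. For integers $a,b\ge0$ with $a+b\le K-3$, $\tilde\chi^K_{a,b}(q):=\frac{(q^K;q^K)_\infty^2}{(q;q)_\infty^2}\theta(q^{a+1},q^{b+1},q^{a+b+2};q^K)$. *)

(* Defs.v *)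
From HB Require Import structures.
From mathcomp Require Import all_boot all_order all_algebra.
Set Implicit Arguments. Unset Strict Implicit. Unset Printing Implicit Defensive.
Import Order.TTheory GRing.Theory Num.Theory.
Local Open Scope ring_scope.

(** Formal power series: f n is the coefficient of q^n. *)
Definition fps := nat -> int.

Definition fps_monom (e : nat) : fps := fun n => (n == e)%:R.
Definition fps0 : fps := fun _ => 0.
Definition fps1 : fps := fps_monom 0.
Definition fps_add (f g : fps) : fps := fun n => f n + g n.
Definition fps_sub (f g : fps) : fps := fun n => f n - g n.
Definition fps_mul (f g : fps) : fps :=
  fun n => \sum_(i < n.+1) f i * g (n - i)%N.
Definition fps_prod (s : seq fps) : fps := foldr fps_mul fps1 s.

(** Multiplicative inverse of a series with constant term 1:
    g_0 = 1, g_(n+1) = - sum_(i=1)^(n+1) f_i g_(n+1-i). *)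
Fixpoint inv_seq (f : fps) (n : nat) : seq int :=
  match n with
  | 0 => [:: 1]
  | n'.+1 => let s := inv_seq f n' in
             rcons s (- \sum_(i < n'.+1) f i.+1 * nth 0 s (n' - i)%N)
  end.
Definition fps_inv (f : fps) : fps := fun n => nth 0 (inv_seq f n) n.

Definition qpoch (m : nat) : fps :=
  fps_prod [seq fps_sub fps1 (fps_monom j.+1) | j <- iota 0 m].

Definition qbin (n m : nat) : fps :=
  if (m <= n)%N then
    fps_mul (qpoch n) (fps_mul (fps_inv (qpoch m)) (fps_inv (qpoch (n - m))))
  else fps0.

(** (q^e; q^d)_oo = prod_(j>=0) (1 - q^(e + d j)), for e, d >= 1.
    Its coefficient of q^n only depends on the factors with j <= n
    (the others are 1 + O(q^(n+1))), so it is computed from that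
    finite product. *)
Definition pinf (e d : nat) : fps :=
  fun n => fps_prod [seq fps_sub fps1 (fps_monom (e + d * j)) | j <- iota 0 n.+1] n.

(** theta(q^s; q^K) = (q^s; q^K)_oo (q^K/q^s; q^K)_oo, for 1 <= s <= K-1. *)
Definition theta_pow (s K : nat) : fps := fps_mul (pinf s K) (pinf (K - s) K).

(** tilde chi^K_(a,b)(q) = (q^K;q^K)_oo^2/(q;q)_oo^2 *
      theta(q^(a+1), q^(b+1), q^(a+b+2); q^K)   (meaningful for a+b <= K-3). *)
Definition tchi (K a b : nat) : fps :=
  fps_mul (fps_mul (pinf K K) (pinf K K))
   (fps_mul (fps_inv (fps_mul (pinf 1 1) (pinf 1 1)))
     (fps_mul (theta_pow a.+1 K)
       (fps_mul (theta_pow b.+1 K) (theta_pow (a + b + 2) K)))).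

(** Index vectors: lambda_1..lambda_k and mu_1..mu_(k-1), with entries in
    [0, B], extended by lambda_i = 0 outside 1..k (so lambda_(k+1) = 0)
    and mu_k = 2 lambda_k, mu_i = 0 otherwise. *)
Definition lam_of (k B : nat) (t : {ffun 'I_k -> 'I_B.+1}) (i : nat) : nat :=
  if (0 < i <= k)%N then nth 0%N [seq nat_of_ord (t j) | j <- enum 'I_k] i.-1
  else 0%N.

Definition mu_of (k B : nat) (lam : nat -> nat) (s : {ffun 'I_k.-1 -> 'I_B.+1})
    (i : nat) : nat :=
  if (0 < i <= k.-1)%N then nth 0%N [seq nat_of_ord (s j) | j <- enum 'I_k.-1] i.-1
  else if i == k then (2 * lam k)%N else 0%N.

Definition box_sum (k B : nat) (F : (nat -> nat) -> (nat -> nat) -> fps) : fps :=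
  fun n => \sum_(t : {ffun 'I_k -> 'I_B.+1}) \sum_(s : {ffun 'I_k.-1 -> 'I_B.+1})
             F (lam_of t) (mu_of (lam_of t) s) n.

Definition fps_sums_to (k : nat) (F : (nat -> nat) -> (nat -> nat) -> fps) (S : fps) :
  Prop := forall n : nat, exists N : nat, forall B : nat, (N <= B)%N -> box_sum k B F n = S n.

(** Generic summand:
   q^(lin lam mu + lam_k^2) / (q;q)_(lam_1) *
   prod_(i=1)^(k-1) q^(lam_i^2 - lam_i mu_i + mu_i^2) [lam_i; lam_(i+1)]_q
        [lam_i - lam_(i+1) + mu_(i+1) + d i; mu_i]_q.
   (lam_i^2 - lam_i mu_i + mu_i^2 >= 0, so the nat expression below is exact;
    when lam_(i+1) > lam_i the factor [lam_i; lam_(i+1)]_q vanishes anyway.) *)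
Definition summand (k : nat) (lin : (nat -> nat) -> (nat -> nat) -> nat)
    (d : nat -> nat) (lam mu : nat -> nat) : fps :=
  fps_mul
    (fps_monom (lin lam mu + lam k ^ 2
                + \sum_(1 <= i < k) (lam i ^ 2 + mu i ^ 2 - lam i * mu i))%N)
    (fps_mul (fps_inv (qpoch (lam 1%N)))
      (fps_prod [seq fps_mul (qbin (lam i) (lam i.+1))
                             (qbin (lam i - lam i.+1 + mu i.+1 + d i)%N (mu i))
                | i <- iota 1 k.-1])).

(* Main.v *)
(** For k in Z^3 let K(A, B; k) = (q)_(A+B) / prod_i (q)_(A - k_i) (q)_(B + k_i).
    Convolving K with q^(r^2 - r s + s^2) / ((q)_(A-r) (q)_(B-s)) reproduces K up to a power of q,
    by creative telescoping from the q-Vandermonde sum: this is a Bailey lemma for the root system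
    A_2.  Its seed is the expansion of q^(2 L1 L2) / ((q)_L1 (q)_L2 (q)_(L1+L2+1)) as a sum of K over
    the vectors of sum 0, with signs given by the character mod 3 of k_1 - k_3.

    Iterating the lemma k times, with linear terms in r and s switched on after a and b steps, and
    subtracting the same with a - 1 and b - 1, leaves a signed sum over the lattice.  On the other
    side, q-Vandermonde removes one summation variable per level and leaves the sum over lambda
    and mu.  When L1 = L2 -> oo both sides converge coefficientwise, and the right-hand side of
    the theorem becomes R / (q)_oo^2 with R a signed theta series of A_2.

    Finally (q^K)_oo^3 theta theta theta is a sum over i, j, l by Jacobi's triple product; for fixed
    i + l and j + l the sum over l is (q^K)_oo times the corresponding term of R, by Euler's
    pentagonal number theorem or by cancellation. *)
Require Import Defs.
From HB Require Import structures.
From mathcomp Require Import all_boot all_order all_algebra.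
From mathcomp Require Import zify ring.
From mathcomp Require Import boolp classical_sets fsbigop.
Set Implicit Arguments. Unset Strict Implicit. Unset Printing Implicit Defensive.
Import Order.TTheory GRing.Theory Num.Theory.
Local Open Scope ring_scope.

(** * Sums with finite support *)

(** On the support of the character [half_norm = 3 * third_norm + 1], so each of the [n] Bailey
    steps adds 3 to the coefficient of [third_norm] and the seed supplies 2: this is where the
    modulus [3 * n + 2] comes from. The linear terms of a step are produced by shifting the size
    parameters and the lattice vector of the kernel, which calls for three kernels [K11], [K01],
    [K00]; a chain passes from one to the next where a linear term is switched off. The first
    passage is free, because the character cancels the difference of the two signed sums. The second
    costs a factor [1 - q ^ (s + l)], and its part [q ^ (s + l)] produces exactly the subtracted sum
    of the theorem; when [a * b = 0] this passage never occurs, whence the indicator. The boundary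
    value mu_k = 2 lambda_k records the parameter of the innermost q-Vandermonde sum. Negative
    powers of q pervade the finite identities, which are therefore proved over a field and then read
    in the fraction field of the power series; limits are congruences modulo q^(N+1). *)

Section FiniteSupportSums.

(** The underlying operator returns 0 on a family of infinite support. Hence additivity below asks
    for [finsupp], while reindexing along a bijection and scaling over a field do not. *)
Definition fsum (I : choiceType) (V : zmodType) (f : I -> V) : V :=
  \sum_(i \in [set: I]%classic) f i.

Definition finsupp (I : choiceType) (V : zmodType) (f : I -> V) : Prop :=
  exists r : seq I, forall i, f i != 0 -> i \in r.

Variables (I J : choiceType) (V : zmodType).
Implicit Types f g : I -> V.

Lemma fsumE (r : seq I) f : uniq r -> (forall i, f i != 0 -> i \in r) ->
  fsum f = \sum_(i <- r) f i.
Proof.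
move=> ur supp; rewrite /fsum (fsbigE r) //.
  by apply: eq_bigl => i; rewrite in_setT.
by move=> i _; apply: contraNeq => /supp.
Qed.

Lemma eq_fsum f g : f =1 g -> fsum f = fsum g.
Proof. by move=> /funext ->. Qed.

Lemma finsupp_uniq f : finsupp f ->
  exists2 r : seq I, uniq r & forall i, f i != 0 -> i \in r.
Proof.
by case=> r supp; exists (undup r); rewrite ?undup_uniq // => i; rewrite mem_undup; apply: supp.
Qed.

Lemma finsuppW f g : (forall i, f i = 0 -> g i = 0) -> finsupp f -> finsupp g.
Proof. by move=> fg [r supp]; exists r => i; move/(contra_neq (fg i)); apply: supp. Qed.

Lemma finsuppD f g : finsupp f -> finsupp g -> finsupp (fun i => f i + g i).
Proof.
move=> [r fr] [s gs]; exists (r ++ s) => i; rewrite mem_cat.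
case: (eqVneq (f i) 0) => [->|/fr -> //]; rewrite add0r => /gs ->; exact: orbT.
Qed.

Lemma finsuppN f : finsupp f -> finsupp (fun i => - f i).
Proof. by apply: finsuppW => i ->; rewrite oppr0. Qed.

Lemma fsumD f g : finsupp f -> finsupp g ->
  fsum (fun i => f i + g i) = fsum f + fsum g.
Proof.
move=> [r fr] [s gs]; pose t := undup (r ++ s).
have ut : uniq t by exact: undup_uniq.
have ft i : f i != 0 -> i \in t by move=> /fr; rewrite mem_undup mem_cat => ->.
have gt i : g i != 0 -> i \in t by move=> /gs; rewrite mem_undup mem_cat orbC => ->.
rewrite (fsumE ut ft) (fsumE ut gt) -big_split /= (@fsumE t) // => i.
by case: (eqVneq (f i) 0) => [->|/ft //]; rewrite add0r => /gt.
Qed.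

Lemma fsum0 : fsum (fun _ : I => 0 : V) = 0.
Proof. by rewrite (@fsumE [::]) ?big_nil // => i; rewrite eqxx. Qed.

Lemma fsumN f : finsupp f -> fsum (fun i => - f i) = - fsum f.
Proof.
move=> ff; apply/eqP; rewrite -addr_eq0 addrC -fsumD //; last exact: finsuppN.
by rewrite (@eq_fsum _ (fun=> 0)) ?fsum0 // => i; rewrite subrr.
Qed.

Lemma fsumB f g : finsupp f -> finsupp g ->
  fsum (fun i => f i - g i) = fsum f - fsum g.
Proof. by move=> ff fg; rewrite fsumD ?fsumN //; exact: finsuppN. Qed.

Lemma fsum_sum (T : Type) (s : seq T) (F : T -> I -> V) :
  (forall t, finsupp (F t)) ->
  finsupp (fun i => \sum_(t <- s) F t i) /\
  fsum (fun i => \sum_(t <- s) F t i) = \sum_(t <- s) fsum (F t).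
Proof.
move=> fF; elim: s => [|t s [fs IHs]].
  split; first by exists [::] => i; rewrite big_nil eqxx.
  by rewrite big_nil (@eq_fsum _ (fun=> 0)) ?fsum0 // => i; rewrite big_nil.
have e i : \sum_(u <- t :: s) F u i = F t i + \sum_(u <- s) F u i by rewrite big_cons.
split; first by move/funext: e => ->; exact: finsuppD.
by rewrite (eq_fsum e) fsumD // big_cons IHs.
Qed.

Lemma fsum_single (i0 : I) f : (forall i, i != i0 -> f i = 0) -> fsum f = f i0.
Proof.
move=> f0; rewrite (@fsumE [:: i0]) ?big_seq1 // => i; rewrite inE.
by apply: contra_neqT => /f0.
Qed.

Lemma reindex_fsum (h : J -> I) (h' : I -> J) f : cancel h h' -> cancel h' h ->
  fsum f = fsum (fun j => f (h j)).
Proof. by move=> hK h'K; apply: reindex_fsbigT; exists h'. Qed.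

Lemma finsupp_comp (h : J -> I) (h' : I -> J) f : cancel h h' ->
  finsupp f -> finsupp (fun j => f (h j)).
Proof.
move=> hK [r supp]; exists (map h' r) => j /supp hj.
by rewrite -(hK j) map_f.
Qed.

End FiniteSupportSums.
Arguments fsumE {I V} r f.
Arguments reindex_fsum {I J V} h h' f.
Arguments fsum_single {I V} i0 f.

Lemma pair_fsum (I J : choiceType) (V : zmodType) (F : I * J -> V) : finsupp F ->
  fsum F = fsum (fun i => fsum (fun j => F (i, j))).
Proof.
move=> [r supp]; pose r1 := undup (map fst r); pose r2 := undup (map snd r).
have memr i j : F (i, j) != 0 -> i \in r1 /\ j \in r2.
  by move=> /supp ij; rewrite !mem_undup; split; apply/mapP; exists (i, j).
have inner i : fsum (fun j => F (i, j)) = \sum_(j <- r2) F (i, j).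
  by apply: fsumE; [exact: undup_uniq | move=> j /memr []].
rewrite (eq_fsum inner) (fsumE r1) ?undup_uniq //; last first.
  move=> i; apply: contra_neqT => ni; apply: big1_seq => j _.
  by apply: contraNeq ni => /memr [].
rewrite (fsumE [seq (i, j) | i <- r1, j <- r2]).
- by rewrite big_allpairs_dep.
- by apply: allpairs_uniq; rewrite ?undup_uniq // => -[? ?] [? ?].
by case=> i j /memr [i1 j2]; exact: allpairs_f.
Qed.

Lemma finsupp_int (V : zmodType) (f : int -> V) (lo hi : int) :
  (forall s, f s != 0 -> lo <= s <= hi) -> finsupp f.
Proof.
move=> fb; exists [seq lo + Posz i | i <- iota 0 `|hi - lo|.+1] => s /fb sb.
apply/mapP; exists `|s - lo|%N; last lia.
by rewrite mem_iota; lia.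
Qed.

Lemma finsupp_int2 (V : zmodType) (f : int * int -> V) (lo hi : int) :
  (forall r s, f (r, s) != 0 -> (lo <= r <= hi) /\ (lo <= s <= hi)) -> finsupp f.
Proof.
move=> fb; pose l := [seq lo + Posz i | i <- iota 0 `|hi - lo|.+1].
have lP t : lo <= t <= hi -> t \in l.
  move=> tb; apply/mapP; exists `|t - lo|%N; last lia.
  by rewrite mem_iota; lia.
by exists [seq (r, s) | r <- l, s <- l] => -[r s] /fb [rb sb]; apply: allpairs_f; exact: lP.
Qed.

(** Common engine of the creative-telescoping proofs: [T] is the certificate and [h] a unit shift of
    one summation variable. *)
Lemma fsum_telescope (I : choiceType) (V : zmodType) (T : I -> V) (h h' : I -> I) :
  cancel h h' -> cancel h' h -> finsupp T -> fsum (fun i => T (h i) - T i) = 0.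
Proof.
move=> hK h'K fT; rewrite fsumB //; last exact: finsupp_comp hK fT.
by rewrite -(reindex_fsum h h') // subrr.
Qed.

(** Serves to parametrize a residue class of the lattice: [h'] has to invert [h] only where [f] does
    not vanish. *)
Lemma fsum_inj (I J : choiceType) (V : zmodType) (h : J -> I) (h' : I -> J) (f : I -> V) :
  cancel h h' -> (forall i, f i != 0 -> h (h' i) = i) -> finsupp f ->
  finsupp (fun j => f (h j)) /\ fsum f = fsum (fun j => f (h j)).
Proof.
move=> hK fh ff; split; first exact: finsupp_comp hK ff.
have [r ur supp] := finsupp_uniq ff.
have fj j : f (h j) != 0 -> j \in [seq h' i | i <- r & f i != 0].
  by move=> fj0; apply/mapP; exists (h j); rewrite ?hK // mem_filter fj0 supp.
rewrite (fsumE _ _ _ fj); last first.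
  rewrite map_inj_in_uniq ?filter_uniq // => i i'.
  rewrite !mem_filter => /andP[fi _] /andP[fi' _] e.
  by rewrite -(fh i fi) -(fh i' fi') e.
rewrite (fsumE r f ur supp) big_map big_filter [RHS]big_mkcond /=.
by apply: eq_bigr => i _; case: ifPn => [/fh ->|/negbNE/eqP].
Qed.

(* The vectors k in Z^3 with sum 0 and k2 - k1 = 1 mod 3, with k1 = j and k2 = j + 1 + 3 t. *)
Definition bk1 (p : int * int) : int := p.1.
Definition bk2 (p : int * int) : int := p.1 + 1 + 3 * p.2.
Definition bk3 (p : int * int) : int := - (2 * p.1 + 1 + 3 * p.2).

(** On vectors this is the rotation (k2, k3, k1). It preserves the class because the cyclic
    differences of a sum-zero vector agree mod 3. *)
Definition bcyc (p : int * int) : int * int := (p.1 + 1 + 3 * p.2, - p.1 - 1 - 2 * p.2).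
(** On vectors this is (k2 - 1, k1 + 1, k3). The plain exchange of k1 and k2 would leave the class
    k2 - k1 = 1 mod 3; the unit shift restores it. *)
Definition brefl (p : int * int) : int * int := (p.1 + 3 * p.2, - p.2).

Lemma bcyc3 p : bcyc (bcyc (bcyc p)) = p.
Proof. by case: p => j t; rewrite /bcyc /=; congr pair; lia. Qed.

Lemma breflK : involutive brefl.
Proof. by case=> j t; rewrite /brefl /=; congr pair; lia. Qed.

Lemma bk_cyc p : (bk1 (bcyc p) = bk2 p) * (bk2 (bcyc p) = bk3 p) * (bk3 (bcyc p) = bk1 p).
Proof. by case: p => j t; rewrite /bk1 /bk2 /bk3 /bcyc /=; do 2?split; lia. Qed.

Lemma bk_refl p : (bk1 (brefl p) = bk2 p - 1) * (bk2 (brefl p) = bk1 p + 1) * (bk3 (brefl p) = bk3 p).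
Proof. by case: p => j t; rewrite /bk1 /bk2 /bk3 /brefl /=; do 2?split; lia. Qed.

Lemma bk_sum p : bk1 p + bk2 p + bk3 p = 0.
Proof. by rewrite /bk1 /bk2 /bk3; lia. Qed.

(** * Peeling the first entry off boxed index vectors *)

Definition fcons (T : Type) n (x : T) (f : {ffun 'I_n -> T}) : {ffun 'I_n.+1 -> T} :=
  [ffun i => if unlift ord0 i is Some j then f j else x].

Lemma sum_fcons (T : finType) (V : nmodType) n (G : {ffun 'I_n.+1 -> T} -> V) :
  \sum_t G t = \sum_x \sum_(f : {ffun 'I_n -> T}) G (fcons x f).
Proof.
rewrite pair_bigA /=.
apply: (reindex (fun p : T * {ffun 'I_n -> T} => fcons p.1 p.2)).
exists (fun t : {ffun 'I_n.+1 -> T} => (t ord0, [ffun j => t (lift ord0 j)])) => [[x f] _|t _] /=.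
  congr pair; first by rewrite ffunE unlift_none.
  by apply/ffunP => j; rewrite !ffunE liftK.
by apply/ffunP => i; rewrite ffunE; case: unliftP => [j ->|->] //; rewrite ffunE.
Qed.

Lemma nth_ord_map k (g : 'I_k -> nat) i (ik : (i < k)%N) :
  nth 0%N [seq g j | j <- enum 'I_k] i = g (Ordinal ik).
Proof.
rewrite (nth_map (Ordinal ik)) ?size_enum_ord //; congr g.
by apply: val_inj; rewrite /= nth_enum_ord.
Qed.

Lemma lam_of_cons1 n B (x : 'I_B.+1) (f : {ffun 'I_n -> 'I_B.+1}) : lam_of (fcons x f) 1 = x.
Proof.
by rewrite /lam_of /= (nth_ord_map _ (ltn0Sn n)) ffunE; case: unliftP => [j|] // /(congr1 val).
Qed.

Lemma lam_of_consS n B (x : 'I_B.+1) (f : {ffun 'I_n -> 'I_B.+1}) i :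
  lam_of (fcons x f) i.+2 = lam_of f i.+1.
Proof.
rewrite /lam_of /= !ltnS; case: ltnP => // iN.
have iN' : (i.+1 < n.+1)%N by [].
rewrite (nth_ord_map _ iN') (nth_ord_map _ iN) ffunE.
case: unliftP => [j /(congr1 val) /= e|/(congr1 val) //].
by congr (nat_of_ord (f _)); apply: val_inj => /=; move: e; rewrite /bump /=; lia.
Qed.

Lemma mu_of_cons1 n B lam (y : 'I_B.+1) (s : {ffun 'I_n -> 'I_B.+1}) :
  @mu_of n.+2 B lam (fcons y s) 1 = y.
Proof. exact: lam_of_cons1. Qed.

(** The sequence lambda is shifted along, because the boundary value mu_k = 2 lambda_k refers to
    it. *)
Lemma mu_of_consS n B lam (y : 'I_B.+1) (s : {ffun 'I_n -> 'I_B.+1}) i :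
  @mu_of n.+2 B lam (fcons y s) i.+2 = @mu_of n.+1 B (fun i => lam i.+1) s i.+1.
Proof.
have := lam_of_consS y s i; rewrite /lam_of /mu_of /= !ltnS !eqSS.
by case: ltnP.
Qed.

Definition binz (m : int) : int := (m * (m - 1) %/ 2)%Z.

Lemma binzE m : 2 * binz m = m * (m - 1).
Proof.
rewrite /binz.
have e : m = 2 * (m %/ 2)%Z \/ m = 2 * (m %/ 2)%Z + 1.
  have : (m %% 2 = 0 \/ m %% 2 = 1)%Z.
    by case: (eqVneq (m %% 2)%Z 0) => ?; [left|right]; lia.
  by case=> ?; [left|right]; lia.
have [w ->] : exists w, m * (m - 1) = 2 * w.
  by case: e => ->; [exists ((m %/ 2)%Z * (2 * (m %/ 2)%Z - 1)) | exists ((2 * (m %/ 2)%Z + 1) * (m %/ 2)%Z)]; ring.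
by rewrite mulKz.
Qed.

Lemma binzS m : binz (m + 1) = binz m + m.
Proof. by have := binzE m; have := binzE (m + 1); lia. Qed.

(** * The finite identities over a field *)

Section GenericBase.
Variables (F : fieldType) (q : F).
Hypothesis q0 : q != 0.
Hypothesis qn1 : forall n, q ^+ n.+1 != 1.
Hypothesis nat_neq0 : forall n, n.+1%:R != 0 :> F.

Lemma fsumZ (I : choiceType) (c : F) (f : I -> F) : fsum (fun i => c * f i) = c * fsum f.
Proof. by rewrite /fsum -mulr_fsumr. Qed.

Lemma fsumZr (I : choiceType) (c : F) (f : I -> F) : fsum (fun i => f i * c) = fsum f * c.
Proof. by rewrite /fsum -mulr_fsuml. Qed.

Definition poch (n : nat) : F := \prod_(j < n) (1 - q ^+ j.+1).
(** With value 0 at negative arguments, [ipoch] satisfies its recursion at every integer, whereas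
    [zpoch] violates its own at 0 and only there. This is the source of the side conditions
    [A + B != 0] and of the separate cases [A + B = 0]. *)
Definition zpoch (n : int) : F := if n is Posz m then poch m else 0.
Definition ipoch (n : int) : F := if n is Posz m then (poch m)^-1 else 0.

Lemma poch_neq0 n : poch n != 0.
Proof. by apply/prodf_neq0 => j _; rewrite subr_eq0 eq_sym. Qed.

Lemma qz0 (n : int) : q ^ n != 0.
Proof. exact: expfz_neq0. Qed.

Lemma qzD (m n : int) : q ^ (m + n) = q ^ m * q ^ n.
Proof. exact: expfzDr. Qed.

Lemma qz_neq1 (n : int) : n != 0 -> q ^ n != 1.
Proof.
case: n => [[|n]|n] // _; first exact: qn1.
by rewrite NegzE -exprnN invr_eq1; exact: qn1.
Qed.

Lemma pochS n : poch n.+1 = poch n * (1 - q ^+ n.+1).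
Proof. by rewrite /poch big_ord_recr. Qed.

Lemma ipoch_pred (n : int) : ipoch (n - 1) = ipoch n * (1 - q ^ n).
Proof.
case: n => [[|n]|n]; rewrite /ipoch.
- by rewrite expr0z subrr mulr0.
- have -> : Posz n.+1 - 1 = Posz n by lia.
  rewrite pochS invfM -[q ^ _]/(q ^+ n.+1) mulfVK //.
  by rewrite subr_eq0 eq_sym.
- have -> : Negz n - 1 = Negz n.+1 by lia.
  by rewrite mul0r.
Qed.

Lemma zpoch_pred (n : int) : n != 0 -> zpoch n = zpoch (n - 1) * (1 - q ^ n).
Proof.
case: n => [[|n]|n] // _; rewrite /zpoch.
  have -> : Posz n.+1 - 1 = Posz n by lia.
  by rewrite pochS.
have -> : Negz n - 1 = Negz n.+1 by lia.
by rewrite mul0r.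
Qed.

Lemma ipoch_lt0 (n : int) : n < 0 -> ipoch n = 0.
Proof. by case: n. Qed.

Lemma ipoch_ge0 (n : int) : ipoch n != 0 -> 0 <= n.
Proof. by case: n => // n; rewrite /ipoch eqxx. Qed.

Lemma ipoch0 : ipoch 0 = 1.
Proof. by rewrite /ipoch /= /poch big_ord0 invr1. Qed.

Lemma zpochK (n : int) : 0 <= n -> zpoch n * ipoch n = 1.
Proof. by case: n => // n _; rewrite /zpoch /ipoch divff // poch_neq0. Qed.

(** * The q-Vandermonde sum *)

Definition vterm (M c s : int) : F :=
  q ^ (s * s + c * s) * ipoch (M - s) * ipoch s * ipoch (s + c).

Lemma vterm_supp M c s : vterm M c s != 0 -> [/\ 0 <= s, s <= M & - c <= s].
Proof.
rewrite /vterm !mulf_eq0 !negb_or => /andP[/andP[/andP[_ /ipoch_ge0 h1] /ipoch_ge0 h2] /ipoch_ge0 h3].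
by split=> //; lia.
Qed.

Lemma vandermonde_step M c :
  fsum (vterm (M - 1) c) = fsum (vterm M c) * ((1 - q ^ M) * (1 - q ^ (M + c))).
Proof.
(* The certificate is [vterm M c s] times [- q ^ (M - s) * (1 - q ^ s) * (1 - q ^ (s + c))], the
   last two factors being absorbed into the lowered [ipoch]. *)
pose T s := - q ^ (M - s) * q ^ (s * s + c * s) * ipoch (M - s) * ipoch (s - 1) * ipoch (s + c - 1).
have finv N : finsupp (vterm N c).
  by apply: (@finsupp_int _ _ 0 N) => s /vterm_supp [-> ->].
have finT : finsupp T.
  apply: (@finsupp_int _ _ 0 M) => s.
  rewrite /T !mulf_eq0 !negb_or => /andP[/andP[/andP[_ /ipoch_ge0 h1] /ipoch_ge0 h2] _]; lia.
have tele := fsum_telescope (addrK 1) (subrK 1) finT.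
apply/eqP; rewrite eq_sym -subr_eq0 -fsumZr -fsumB //; last first.
  by apply: finsuppW (finv M) => s ->; rewrite mul0r.
rewrite -tele; apply/eqP/eq_fsum => s.
rewrite /vterm /T.
have -> : M - 1 - s = (M - s) - 1 by lia.
have -> : M - (s + 1) = (M - s) - 1 by lia.
have -> : s + 1 - 1 = s by lia.
have -> : s + 1 + c - 1 = s + c by lia.
have -> : (s + 1) * (s + 1) + c * (s + 1) = (s * s + c * s) + s + s + 1 + c by lia.
rewrite !ipoch_pred !qzD !expr1z exprN1 -!invr_expz.
field.
by rewrite q0 qz0.
Qed.

Theorem vandermonde M c : fsum (vterm M c) = ipoch M * ipoch (M + c).
Proof.
(* The least M at which the right-hand side is nonzero. Above it both factors [1 - q ^ M] and
   [1 - q ^ (M + c)] of the recursion can be cancelled; at [m0] a single term survives, with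
   exponent 0. *)
pose m0 := Num.max 0 (- c).
case: (ltP M m0) => [M_lt | M_ge].
  have [->|->] : ipoch M = 0 \/ ipoch (M + c) = 0.
    by case: (ltP M 0) => ?; [left|right]; apply: ipoch_lt0; lia.
    rewrite mul0r; apply: etrans (@eq_fsum _ _ _ (fun=> 0) _) (fsum0 _ _) => s.
    by apply/eqP; apply: contraT => /vterm_supp []; lia.
  rewrite mulr0; apply: etrans (@eq_fsum _ _ _ (fun=> 0) _) (fsum0 _ _) => s.
  by apply/eqP; apply: contraT => /vterm_supp []; lia.
have [n ->] : exists n : nat, M = m0 + n by exists `|M - m0|%N; lia.
elim: n => [|n IHn] {M M_ge}.
  rewrite addr0 (fsum_single m0); last first.
    by move=> s; apply: contraNeq => /vterm_supp []; lia.
  rewrite /vterm subrr ipoch0 mulr1 -mulrA.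
  have -> : m0 * m0 + c * m0 = 0 by rewrite /m0; case: (leP 0 (- c)) => ? ; lia.
  by rewrite expr0z mul1r.
have := vandermonde_step (m0 + n.+1) c.
have -> : m0 + n.+1 - 1 = m0 + n by lia.
rewrite IHn.
have -> : ipoch (m0 + n) = ipoch (m0 + n.+1) * (1 - q ^ (m0 + n.+1)).
  by rewrite -ipoch_pred; congr ipoch; lia.
have -> : ipoch (m0 + n + c) = ipoch (m0 + n.+1 + c) * (1 - q ^ (m0 + n.+1 + c)).
  by rewrite -ipoch_pred; congr ipoch; lia.
rewrite mulrACA => /mulIf -> //.
by rewrite mulf_neq0 // subr_eq0 eq_sym qz_neq1 //; lia.
Qed.

(** * The Bailey lemma for A_2 *)

Definition kern (a1 a2 a3 A B : int) : F :=
  zpoch (A + B) * (ipoch (A - a1) * ipoch (A - a2) * ipoch (A - a3))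
    * (ipoch (B + a1) * ipoch (B + a2) * ipoch (B + a3)).

Lemma kern_supp a1 a2 a3 A B : kern a1 a2 a3 A B != 0 ->
  [/\ a1 <= A, a2 <= A & a3 <= A] /\ [/\ - a1 <= B, - a2 <= B & - a3 <= B].
Proof.
rewrite /kern !mulf_eq0 !negb_or.
case/andP=> /andP[_ /andP[/andP[/ipoch_ge0 h1 /ipoch_ge0 h2] /ipoch_ge0 h3]].
case/andP=> /andP[/ipoch_ge0 h4 /ipoch_ge0 h5] /ipoch_ge0 h6.
by split; split; lia.
Qed.

Lemma kern_predl a1 a2 a3 A B :
  kern a1 a2 a3 (A - 1) B * (1 - q ^ (A + B))
  = kern a1 a2 a3 A B * ((1 - q ^ (A - a1)) * (1 - q ^ (A - a2)) * (1 - q ^ (A - a3))).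
Proof.
(* Here the recursion of [zpoch] fails, but both sides vanish: the left one by its factor, the right
   one because a nonzero kernel forces [a1 = A]. *)
have [AB0|AB0] := eqVneq (A + B) 0.
  have [->|/kern_supp [[h1 h2 h3] [h4 h5 h6]]] := eqVneq (kern a1 a2 a3 A B) 0.
    by rewrite AB0 expr0z subrr mulr0 mul0r.
  have -> : A - a1 = 0 by lia.
  by rewrite AB0 expr0z subrr !mul0r !mulr0.
rewrite /kern (zpoch_pred AB0).
have -> : A - 1 + B = A + B - 1 by lia.
have -> : A - 1 - a1 = A - a1 - 1 by lia.
have -> : A - 1 - a2 = A - a2 - 1 by lia.
have -> : A - 1 - a3 = A - a3 - 1 by lia.
rewrite !ipoch_pred; ring.
Qed.

Lemma kern_swap a1 a2 a3 A B : kern a1 a2 a3 A B = kern (- a1) (- a2) (- a3) B A.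
Proof.
rewrite /kern !opprK (addrC A B).
by rewrite -!mulrA; congr (_ * _); rewrite mulrC mulrA mulrA -!mulrA [RHS]mulrCA; ring.
Qed.

Lemma kern_predr a1 a2 a3 A B :
  kern a1 a2 a3 A (B - 1) * (1 - q ^ (A + B))
  = kern a1 a2 a3 A B * ((1 - q ^ (B + a1)) * (1 - q ^ (B + a2)) * (1 - q ^ (B + a3))).
Proof.
by rewrite 2!(kern_swap a1) (addrC A B) kern_predl !opprK.
Qed.

(** The linear term in the exponent vanishes for vectors of sum 0; it is there for the kernel [K01],
    whose vectors have sum -1. *)
Definition bterm (a1 a2 a3 A B : int) (p : int * int) : F :=
  let: (r, s) := p in
  q ^ (r * r - r * s + s * s - (a1 + a2 + a3) * (r - s))
    * ipoch (A - r) * ipoch (B - s) * kern a1 a2 a3 r s.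

Lemma bterm_supp a1 a2 a3 A B r s : bterm a1 a2 a3 A B (r, s) != 0 ->
  [/\ r <= A, s <= B & kern a1 a2 a3 r s != 0].
Proof.
rewrite /bterm !mulf_eq0 !negb_or.
by case/andP=> /andP[/andP[_ /ipoch_ge0 h1] /ipoch_ge0 h2] ->; split=> //; lia.
Qed.

Lemma finsupp_bterm a1 a2 a3 A B : finsupp (bterm a1 a2 a3 A B).
Proof.
apply: (@finsupp_int2 _ _ (Num.min a1 (- a1)) (Num.max A B)) => r s /bterm_supp [h1 h2 /kern_supp [[h3 _ _] [h4 _ _]]].
lia.
Qed.

(* Creative telescoping: both shifts T1 and T2 carry a kernel with one argument lowered,
   so that the certificate has no denominator. *)
Lemma bailey_step a1 a2 a3 A B :
  fsum (bterm a1 a2 a3 (A - 1) B) * (1 - q ^ (A + B))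
  = fsum (bterm a1 a2 a3 A B)
      * ((1 - q ^ (A - a1)) * (1 - q ^ (A - a2)) * (1 - q ^ (A - a3))).
Proof.
pose E r s := q ^ (r * r - r * s + s * s - (a1 + a2 + a3) * (r - s)).
pose T1 (p : int * int) := let: (r, s) := p in
  - q ^ (A - r) * (1 - q ^ (A + s)) * E r s * ipoch (A - r) * ipoch (B - s) * kern a1 a2 a3 (r - 1) s.
pose T2 (p : int * int) := let: (r, s) := p in
  q ^ (A - s - (a1 + a2 + a3)) * (q ^ A - q ^ r) * E r s * ipoch (A - r) * ipoch (B - s)
    * kern a1 a2 a3 r (s - 1).
have fin1 : finsupp T1.
  apply: (@finsupp_int2 _ _ (Num.min a1 (- a1)) (Num.max A B)) => r s.
  rewrite /T1 mulf_eq0 negb_or => /andP[+ /kern_supp [[h3 _ _] [h4 _ _]]].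
  rewrite !mulf_eq0 !negb_or => /andP[/andP[_ /ipoch_ge0 ?] /ipoch_ge0 ?]; lia.
have fin2 : finsupp T2.
  apply: (@finsupp_int2 _ _ (Num.min a1 (- a1)) (Num.max A B)) => r s.
  rewrite /T2 mulf_eq0 negb_or => /andP[+ /kern_supp [[h3 _ _] [h4 _ _]]].
  rewrite !mulf_eq0 !negb_or => /andP[/andP[_ /ipoch_ge0 ?] /ipoch_ge0 ?]; lia.
pose h1 (p : int * int) := (p.1 + 1, p.2); pose h1' (p : int * int) := (p.1 - 1, p.2).
pose h2 (p : int * int) := (p.1, p.2 + 1); pose h2' (p : int * int) := (p.1, p.2 - 1).
have h1K : cancel h1 h1' by move=> [r s]; rewrite /h1 /h1' /= addrK.
have h1'K : cancel h1' h1 by move=> [r s]; rewrite /h1 /h1' /= subrK.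
have h2K : cancel h2 h2' by move=> [r s]; rewrite /h2 /h2' /= addrK.
have h2'K : cancel h2' h2 by move=> [r s]; rewrite /h2 /h2' /= subrK.
have tele1 := fsum_telescope h1K h1'K fin1.
have tele2 := fsum_telescope h2K h2'K fin2.
have fd1 : finsupp (fun p => T1 (h1 p) - T1 p).
  by apply: finsuppD; [exact: finsupp_comp h1K fin1 | exact: finsuppN].
have fd2 : finsupp (fun p => T2 (h2 p) - T2 p).
  by apply: finsuppD; [exact: finsupp_comp h2K fin2 | exact: finsuppN].
have finZ c C : finsupp (fun p => bterm a1 a2 a3 C B p * c).
  by apply: finsuppW (finsupp_bterm a1 a2 a3 C B) => p ->; rewrite mul0r.
apply/eqP; rewrite eq_sym -subr_eq0 -!fsumZr -fsumB //.
rewrite -[X in _ == X](addr0 0) -{1}tele1 -tele2 -fsumD //; apply/eqP/eq_fsum => -[r s].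
rewrite /h1 /h2 /bterm /T1 /T2 /=.
have -> : A - 1 - r = (A - r) - 1 by lia.
have -> : A - (r + 1) = (A - r) - 1 by lia.
have -> : B - (s + 1) = (B - s) - 1 by lia.
rewrite !addrK !ipoch_pred.
have eE : q ^ (r * r - r * s + s * s - (a1 + a2 + a3) * (r - s)) = E r s by [].
rewrite eE.
have -> : E (r + 1) s = E r s * (q ^ r * q ^ r * q / (q ^ s * (q ^ a1 * q ^ a2 * q ^ a3))).
  rewrite /E; have -> : (r + 1) * (r + 1) - (r + 1) * s + s * s - (a1 + a2 + a3) * (r + 1 - s)
    = (r * r - r * s + s * s - (a1 + a2 + a3) * (r - s)) + (r + r + 1 - (s + (a1 + a2 + a3))) by lia.
  by rewrite !qzD expr1z -!invr_expz !qzD.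
have -> : E r (s + 1) = E r s * (q ^ s * q ^ s * q * (q ^ a1 * q ^ a2 * q ^ a3) / q ^ r).
  rewrite /E; have -> : r * r - r * (s + 1) + (s + 1) * (s + 1) - (a1 + a2 + a3) * (r - (s + 1))
    = (r * r - r * s + s * s - (a1 + a2 + a3) * (r - s)) + (s + s + 1 + (a1 + a2 + a3) - r) by lia.
  by rewrite !qzD expr1z -!invr_expz.
have kl := kern_predl a1 a2 a3 r s; have kr := kern_predr a1 a2 a3 r s.
move: (E r s) (ipoch (A - r)) (ipoch (B - s)) => e i j.
have nz := (qz0 r, qz0 s, qz0 A, qz0 B, qz0 a1, qz0 a2, qz0 a3, q0).
(* The lowered kernels are the kernel times a fraction with denominator [1 - q ^ (r + s)], so the
   antidiagonal is treated apart. There the lowered kernels are 0 by the convention on [zpoch], and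
   the kernel itself survives only if all three a_i equal r. *)
have [rs0|rs0] := eqVneq (r + s) 0.
  have -> : kern a1 a2 a3 (r - 1) s = 0.
    by rewrite /kern (_ : r - 1 + s = - 1) ?mul0r //; lia.
  have -> : kern a1 a2 a3 r (s - 1) = 0.
    by rewrite /kern (_ : r + (s - 1) = - 1) ?mul0r //; lia.
  have [->|/kern_supp [[? ? ?] [? ? ?]]] := eqVneq (kern a1 a2 a3 r s) 0.
    by ring.
  have -> : a1 = r by lia.
  have -> : a2 = r by lia.
  have -> : a3 = r by lia.
  have -> : s = - r by lia.
  do 3!rewrite ?qzD ?expr1z ?exprN1 -?invr_expz.
  by field; rewrite ?nz ?oner_eq0.
have uv1 : 1 - q ^ r * q ^ s != 0 by rewrite -qzD subr_eq0 eq_sym qz_neq1.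
move: kl kr; rewrite !qzD => kl kr.
have {kl} -> : kern a1 a2 a3 (r - 1) s = kern a1 a2 a3 r s
   * ((1 - q ^ r * q ^ (- a1)) * (1 - q ^ r * q ^ (- a2)) * (1 - q ^ r * q ^ (- a3))) / (1 - q ^ r * q ^ s).
  by rewrite -kl mulfK.
have {kr} -> : kern a1 a2 a3 r (s - 1) = kern a1 a2 a3 r s
   * ((1 - q ^ s * q ^ a1) * (1 - q ^ s * q ^ a2) * (1 - q ^ s * q ^ a3)) / (1 - q ^ r * q ^ s).
  by rewrite -kr mulfK.
do 3!rewrite ?qzD ?expr1z ?exprN1 -?invr_expz.
field.
by rewrite ?nz uv1.
Qed.

(** The kernel requires r >= a3 and the factor [ipoch (A - r)] requires r <= a3, so only r = a3
    remains; the sum over s is then q-Vandermonde after the translation of s by a1. *)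
Lemma bailey_initial a1 a2 a3 B : a1 <= a3 ->
  fsum (bterm a1 a2 a3 a3 B)
  = q ^ (- (a1 * a2 + a1 * a3 + a2 * a3)) * kern a1 a2 a3 a3 B.
Proof.
move=> a13; rewrite pair_fsum; last exact: finsupp_bterm.
rewrite (fsum_single a3); last first.
  move=> r ra3; apply: etrans (@eq_fsum _ _ _ (fun=> 0) _) (fsum0 _ _) => s.
  apply: contraNeq ra3 => /bterm_supp [? _ /kern_supp [[? ? ?] _]]; lia.
(* If C + a3 is negative the first two factors do not cancel, but then C + a1 is negative too: this
   is what [a1 <= a3] is for. *)
have cancelz C : zpoch (a3 + C) * ipoch (C + a3) * ipoch (C + a1) = ipoch (C + a1).
  case: (leP 0 (C + a1)) => C1; last by rewrite (ipoch_lt0 C1) mulr0.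
  by rewrite addrC zpochK ?mul1r //; lia.
have kE C : kern a1 a2 a3 a3 C = ipoch (a3 - a1) * ipoch (a3 - a2) * (ipoch (C + a1) * ipoch (C + a2)).
  rewrite -[in RHS](cancelz C) /kern subrr ipoch0; ring.
pose c := q ^ (- (a1 * a2 + a1 * a3 + a2 * a3)) * ipoch (a3 - a1) * ipoch (a3 - a2).
rewrite (eq_fsum (g := fun s => c * vterm (B + a1) (a2 - a1) (s + a1))); last first.
  move=> s; rewrite /bterm /vterm kE subrr ipoch0 /c.
  have -> : B + a1 - (s + a1) = B - s by lia.
  have -> : s + a1 + (a2 - a1) = s + a2 by lia.
  have -> : a3 * a3 - a3 * s + s * s - (a1 + a2 + a3) * (a3 - s)
    = - (a1 * a2 + a1 * a3 + a2 * a3) + ((s + a1) * (s + a1) + (a2 - a1) * (s + a1)) by lia.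
  rewrite qzD; ring.
rewrite fsumZ -(reindex_fsum (fun s => s + a1) (fun s => s - a1)); last first.
- exact: subrK.
- exact: addrK.
rewrite vandermonde kE /c (_ : B + a1 + (a2 - a1) = B + a2); last lia.
ring.
Qed.

(** Both sides obey the recursion in A of [kern_predl]. With a3 as the maximum, both vanish for A <
    a3, and for A > a3 every factor [1 - q ^ (A - a_i)] can be cancelled. *)
Lemma bailey_max a1 a2 a3 A B : a1 <= a3 -> a2 <= a3 ->
  fsum (bterm a1 a2 a3 A B)
  = q ^ (- (a1 * a2 + a1 * a3 + a2 * a3)) * kern a1 a2 a3 A B.
Proof.
move=> a13 a23; case: (ltP A a3) => [A3|A3].
  have -> : kern a1 a2 a3 A B = 0.
    by apply/eqP; apply: contraT => /kern_supp [[? ? ?] _]; lia.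
  rewrite mulr0; apply: etrans (@eq_fsum _ _ _ (fun=> 0) _) (fsum0 _ _) => -[r s].
  by apply/eqP; apply: contraT => /bterm_supp [? _ /kern_supp [[? ? ?] _]]; lia.
have [n ->] : exists n : nat, A = a3 + n by exists `|A - a3|%N; lia.
elim: n => [|n IHn] {A A3}; first by rewrite addr0 bailey_initial.
have := bailey_step a1 a2 a3 (a3 + n.+1) B.
have := kern_predl a1 a2 a3 (a3 + n.+1) B.
have -> : a3 + n.+1 - 1 = a3 + n by lia.
rewrite IHn => kl; rewrite -[X in X = _ -> _]mulrA kl [X in X = _ -> _]mulrA => /esym /mulIf -> //.
by rewrite !mulf_neq0 // subr_eq0 eq_sym qz_neq1 //; lia.
Qed.

Lemma kern_perm12 a1 a2 a3 A B : kern a1 a2 a3 A B = kern a2 a1 a3 A B.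
Proof. rewrite /kern; ring. Qed.

Lemma kern_perm23 a1 a2 a3 A B : kern a1 a2 a3 A B = kern a1 a3 a2 A B.
Proof. rewrite /kern; ring. Qed.

Theorem bailey a1 a2 a3 A B :
  fsum (bterm a1 a2 a3 A B)
  = q ^ (- (a1 * a2 + a1 * a3 + a2 * a3)) * kern a1 a2 a3 A B.
Proof.
have [[h1 h2]|[[h1 h2]|[h1 h2]]] :
    (a1 <= a3 /\ a2 <= a3) \/ (a1 <= a2 /\ a3 <= a2) \/ (a2 <= a1 /\ a3 <= a1) by lia.
- exact: bailey_max.
- rewrite kern_perm23.
  have -> : a1 * a2 + a1 * a3 + a2 * a3 = a1 * a3 + a1 * a2 + a3 * a2 by ring.
  rewrite -bailey_max //; apply: eq_fsum => -[r s].
  by rewrite /bterm kern_perm23 (addrAC a1 a2).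
- rewrite kern_perm12 kern_perm23.
  have -> : a1 * a2 + a1 * a3 + a2 * a3 = a2 * a3 + a2 * a1 + a3 * a1 by ring.
  rewrite -bailey_max //; apply: eq_fsum => -[r s].
  by rewrite /bterm kern_perm12 kern_perm23 -(addrA a1) (addrC a1).
Qed.

(** * The seed: rotations and reflections of the lattice *)

(* The multiplier that turns the reflection invariance of [base_weight] into a linear relation
   between the sums weighted by V, V e_1 and V e_2; found by linear algebra. *)
Definition refl_cert (P N x y : F) : F :=
  x ^+ 2 * y + (q ^+ 2 * P / N - q) * x * y - P ^+ 3 * x / y - (q * P + P ^+ 3 / N) * x
  + q * P ^+ 3 / N - q ^+ 2 * P ^+ 4 / N + (q * P ^+ 3 + q * P ^+ 4) / y
  - q ^+ 2 * P ^+ 4 / (N * x) + q * P ^+ 4 / (x * y) + q ^+ 2 * P ^+ 7 / (N * x ^+ 2 * y)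
  + P ^+ 6 / (N * y ^+ 2) - q * P ^+ 6 / (N * x * y ^+ 2) - q * P ^+ 7 / (x ^+ 2 * y ^+ 2).

Definition vdm (x y z : F) : F := (x - y) * (x - z) * (y - z).

Lemma refl_cert_sum P N x y z : P != 0 -> N != 0 -> x != 0 -> y != 0 -> x * y * z = P ^+ 3 ->
  (1 - x) * (y - N) * refl_cert P N x y + (1 - y) * (z - N) * refl_cert P N y z
    + (1 - z) * (x - N) * refl_cert P N z x
  = vdm x y z * (N * (x + y + z) - (x * y + x * z + y * z) + (q - N - q * N - q ^+ 2 * P / N
       + q * P + q ^+ 2 * P - q * P * N + P ^+ 3 / N)).
Proof.
move=> P0 N0 x0 y0 xyz.
have -> : z = P ^+ 3 / (x * y) by rewrite -xyz mulrAC divff ?mul1r // mulf_neq0.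
by rewrite /refl_cert /vdm; field; rewrite P0 N0 x0 y0.
Qed.

Lemma refl_cert_refl P N x y z : P != 0 -> N != 0 -> x != 0 -> y != 0 -> x * y * z = P ^+ 3 ->
  (1 - x) * (y - N) * refl_cert P N (q * y) (x / q)
    + (1 - y) * (z - N) * (y / P) * refl_cert P N (q * z) (y / q)
    + (1 - z) * (x - N) * (P / x) * refl_cert P N (q * x) (z / q) = 0.
Proof.
move=> P0 N0 x0 y0 xyz.
have -> : z = P ^+ 3 / (x * y) by rewrite -xyz mulrAC divff ?mul1r // mulf_neq0.
by rewrite /refl_cert; field; rewrite P0 N0 x0 y0 q0.
Qed.

Lemma kern_reflect a1 a2 a3 A B :
  kern (a2 - 1) (a1 + 1) a3 A B * ((1 - q ^ (A - a2 + 1)) * (1 - q ^ (B + a1 + 1)))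
  = kern a1 a2 a3 A B * ((1 - q ^ (A - a1)) * (1 - q ^ (B + a2))).
Proof.
rewrite /kern.
have -> : A - (a2 - 1) = A - a2 + 1 by lia.
have -> : A - (a1 + 1) = A - a1 - 1 by lia.
have -> : B + (a2 - 1) = B + a2 - 1 by lia.
have -> : B + (a1 + 1) = B + a1 + 1 by lia.
rewrite !ipoch_pred -[ipoch (A - a2)](congr1 ipoch (addrK 1 (A - a2))) ipoch_pred.
rewrite -[in RHS](congr1 ipoch (addrK 1 (B + a1))) ipoch_pred; ring.
Qed.

Section FixedSize.
Variables A B : int.

(** The exponent of q is twice the [third_norm] of (k1, k3), written out in the coordinates of the
    class. *)
Definition base_weight (p : int * int) : F :=
  q ^ (2 * (p.1 * p.1 + p.1 + 3 * p.1 * p.2 + 2 * p.2 + 3 * p.2 * p.2))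
    * kern (bk1 p) (bk2 p) (bk3 p) A B.

Lemma base_weight_cyc p : base_weight (bcyc p) = base_weight p.
Proof.
rewrite /base_weight !bk_cyc; congr (_ ^ _ * _); last by rewrite /kern; ring.
by rewrite /bcyc /=; ring.
Qed.

Lemma finsupp_base (f : int * int -> F) : finsupp (fun p => base_weight p * f p).
Proof.
apply: (@finsupp_int2 _ _ (- (`|A| + `|B| + 1) *+ 2) ((`|A| + `|B| + 1) *+ 2)) => j t.
rewrite /base_weight mulf_eq0 negb_or mulf_eq0 negb_or.
case/andP=> /andP[_ /kern_supp [[]]]; rewrite /bk1 /bk2 /bk3 /= => h1 h2 h3 [h4 h5 h6] _; lia.
Qed.

Definition bx (k : (int * int) -> int) (p : int * int) : F := q ^ (A - k p).
Local Notation N := (q ^ (A + B)).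

(** Kept free of division: the factors that compare a weight with its reflection vanish at some
    lattice points, for instance where [bk1 p = A]. *)
Lemma base_weight_refl p :
  base_weight (brefl p) * ((1 - q * bx bk2 p) * (bx bk1 p / q - N))
  = base_weight p * ((1 - bx bk1 p) * (bx bk2 p - N)) * q ^ p.2.
Proof.
have := kern_reflect (bk1 p) (bk2 p) (bk3 p) A B.
rewrite /base_weight !bk_refl /bx => kr.
have -> : 1 - q * q ^ (A - bk2 p) = 1 - q ^ (A - bk2 p + 1).
  by rewrite [in RHS]qzD expr1z mulrC.
have -> : q ^ (A - bk1 p) / q - N = q ^ (A - bk1 p - 1) * (1 - q ^ (B + bk1 p + 1)).
  rewrite mulrBr mulr1 -qzD [q ^ (A - bk1 p - 1)]qzD exprN1; congr (_ - q ^ _); lia.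
have -> : q ^ (A - bk2 p) - N = q ^ (A - bk2 p) * (1 - q ^ (B + bk2 p)).
  by rewrite mulrBr mulr1 -qzD; congr (_ - q ^ _); lia.
set e1 := q ^ (2 * _); set e2 := q ^ (A - bk1 p - 1); set e3 := q ^ (2 * _); set e4 := q ^ (A - bk2 p).
have e : e1 * e2 = e3 * e4 * q ^ p.2.
  rewrite /e1 /e2 /e3 /e4 -!qzD; congr (q ^ _).
  by rewrite /brefl /bk1 /bk2 /=; ring.
transitivity (e1 * e2 * (kern (bk2 p - 1) (bk1 p + 1) (bk3 p) A B
    * ((1 - q ^ (A - bk2 p + 1)) * (1 - q ^ (B + bk1 p + 1))))); first by ring.
rewrite kr e; ring.
Qed.

Lemma bx_refl p : (bx bk1 (brefl p) = q * bx bk2 p) * (bx bk2 (brefl p) = bx bk1 p / q).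
Proof.
split; first by rewrite /bx bk_refl -[q in q * _]expr1z -qzD; congr (q ^ _); lia.
by rewrite /bx bk_refl -[q^-1]exprN1 -qzD; congr (q ^ _); lia.
Qed.

Definition bsum (f : int * int -> F) : F := fsum (fun p => base_weight p * f p).

Lemma bsum_cyc f : bsum f = bsum (fun p => f (bcyc p)).
Proof.
rewrite /bsum (reindex_fsum bcyc (fun p => bcyc (bcyc p))).
- by apply: eq_fsum => p; rewrite base_weight_cyc.
- by move=> p; exact: bcyc3.
- by move=> p; exact: bcyc3.
Qed.

Lemma bsumD f g : bsum (fun p => f p + g p) = bsum f + bsum g.
Proof.
by rewrite /bsum -fsumD; try exact: finsupp_base; apply: eq_fsum => p; rewrite mulrDr.
Qed.

Lemma bsumZ c f : bsum (fun p => c * f p) = c * bsum f.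
Proof. by rewrite /bsum -fsumZ; apply: eq_fsum => p; rewrite mulrCA. Qed.

Lemma bsum_refl (f : int * int -> F) :
  bsum (fun p => (1 - bx bk1 p) * (bx bk2 p - N) * f p)
  = bsum (fun p => (1 - bx bk1 p) * (bx bk2 p - N) * q ^ p.2 * f (brefl p)).
Proof.
rewrite /bsum (reindex_fsum brefl brefl); try exact: breflK.
by apply: eq_fsum => p; rewrite !bx_refl mulrA base_weight_refl; ring.
Qed.

Definition bV p := vdm (bx bk1 p) (bx bk2 p) (bx bk3 p).

Lemma bx_cyc p : (bx bk1 (bcyc p) = bx bk2 p) * (bx bk2 (bcyc p) = bx bk3 p) * (bx bk3 (bcyc p) = bx bk1 p).
Proof. by rewrite /bx !bk_cyc. Qed.

Lemma bx_prod p : bx bk1 p * bx bk2 p * bx bk3 p = (q ^ A) ^+ 3.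
Proof.
rewrite /bx -!qzD !exprS expr0 mulr1 -!qzD; congr (q ^ _).
by have := bk_sum p; lia.
Qed.

Lemma bx_neq0 k p : bx k p != 0.
Proof. exact: qz0. Qed.

(** The sums of f and of its reflection g agree. Averaged over the three rotations, f becomes the
    Vandermonde product times the displayed form by [refl_cert_sum], and g becomes 0 by
    [refl_cert_refl]. *)
Lemma bsum_relation :
  bsum (fun p => bV p * (N * (bx bk1 p + bx bk2 p + bx bk3 p)
      - (bx bk1 p * bx bk2 p + bx bk1 p * bx bk3 p + bx bk2 p * bx bk3 p)
      + (q - N - q * N - q ^+ 2 * q ^ A / N + q * q ^ A + q ^+ 2 * q ^ A - q * q ^ A * N
         + (q ^ A) ^+ 3 / N))) = 0.
Proof.
pose f p := (1 - bx bk1 p) * (bx bk2 p - N) * refl_cert (q ^ A) N (bx bk1 p) (bx bk2 p).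
pose g p := (1 - bx bk1 p) * (bx bk2 p - N) * q ^ p.2
              * refl_cert (q ^ A) N (q * bx bk2 p) (bx bk1 p / q).
have fg : bsum f = bsum g.
  rewrite /f (bsum_refl (fun p => refl_cert (q ^ A) N (bx bk1 p) (bx bk2 p))).
  by apply: eq_fsum => p; rewrite !bx_refl.
have cyc3 h : bsum (fun p => h p + h (bcyc p) + h (bcyc (bcyc p))) = bsum h + bsum h + bsum h.
  by rewrite !bsumD -(bsum_cyc (fun p => h (bcyc p))) -(bsum_cyc h).
transitivity (bsum (fun p => f p + f (bcyc p) + f (bcyc (bcyc p)))).
  apply: eq_fsum => p; congr (_ * _); rewrite /f /bV !bx_cyc -refl_cert_sum ?bx_neq0 ?qz0 //.
  exact: bx_prod.
rewrite cyc3 fg -cyc3 /bsum; apply: etrans (fsum0 _ _); apply: eq_fsum => p.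
rewrite /g !bx_cyc.
have -> : q ^ (bcyc p).2 = q ^ p.2 * (bx bk2 p / q ^ A).
  by rewrite /bx invr_expz -!qzD; congr (q ^ _); rewrite /bcyc /bk2 /=; lia.
have -> : q ^ (bcyc (bcyc p)).2 = q ^ p.2 * (q ^ A / bx bk1 p).
  by rewrite /bx invr_expz -!qzD; congr (q ^ _); rewrite /bcyc /bk1 /=; lia.
have := refl_cert_refl (qz0 A) (qz0 (A + B)) (bx_neq0 bk1 p) (bx_neq0 bk2 p) (bx_prod p).
move=> e; rewrite -[RHS](mulr0 (base_weight p * q ^ p.2)) -e; ring.
Qed.

End FixedSize.

Definition zV (p : int * int) : F := vdm (q ^ bk1 p) (q ^ bk2 p) (q ^ bk3 p).

Lemma zprod p : q ^ bk1 p * q ^ bk2 p * q ^ bk3 p = 1.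
Proof. by rewrite -!qzD bk_sum. Qed.

Lemma bV_zV A p : bV A p = - (q ^ A) ^+ 3 * zV p.
Proof.
have bxE k : bx A k p = q ^ A / q ^ k p by rewrite /bx qzD invr_expz.
rewrite /bV !bxE /zV /vdm.
have := zprod p; move: (qz0 (bk1 p)) (qz0 (bk2 p)) (qz0 (bk3 p)).
move: (q ^ A) (q ^ bk1 p) (q ^ bk2 p) (q ^ bk3 p) => X x y z x0 y0 z0 xyz.
have -> : z = (x * y)^-1.
  by apply: (mulfI (mulf_neq0 x0 y0)); rewrite xyz divff // mulf_neq0.
by field; rewrite x0 y0 oner_neq0.
Qed.

(** Lowering B multiplies the weight, up to simple factors, by the product of the
    [q ^ (A - k_i) - N], a combination of 1, e_1 and e_2. The elementary symmetric functions enter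
    only through N e_1 - e_2, which [bsum_relation] replaces by a constant. *)
Lemma bsum_zV_rec (A B : int) : A + B != 0 ->
  (q - q ^ B) * (q - q ^ (A + B)) * bsum A B zV = (q ^ A) ^+ 2 * bsum A (B - 1) zV.
Proof.
move=> AB0.
have N1 : 1 - q ^ (A + B) != 0 by rewrite subr_eq0 eq_sym qz_neq1.
pose N := q ^ (A + B).
pose pr p := (bx A bk1 p - N) * (bx A bk2 p - N) * (bx A bk3 p - N).
have lower : bsum A B (fun p => bV A p * pr p)
    = (q ^ A) ^+ 3 * (1 - N) * bsum A (B - 1) (bV A).
  rewrite -bsumZ; apply: eq_fsum => p.
  have fac k : bx A k p - N = bx A k p * (1 - q ^ (B + k p)).
    by rewrite /bx /N mulrBr mulr1 -qzD; congr (_ - q ^ _); lia.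
  have := kern_predr (bk1 p) (bk2 p) (bk3 p) A B.
  rewrite /pr !fac -(bx_prod A p) /base_weight -/N => kr.
  transitivity (q ^ (2 * (p.1 * p.1 + p.1 + 3 * p.1 * p.2 + 2 * p.2 + 3 * p.2 * p.2)) *
     (kern (bk1 p) (bk2 p) (bk3 p) A (B - 1) * (1 - N)) * bV A p
       * (bx A bk1 p * bx A bk2 p * bx A bk3 p)); last by ring.
  by rewrite kr; ring.
have expand : bsum A B (fun p => bV A p * pr p)
    = (q ^ A * (q - q ^ B) * (q - N) * (1 - N)) * bsum A B (bV A).
  rewrite -[RHS]addr0 -[X in _ = _ + X](mulr0 N) -(bsum_relation A B) -!bsumZ -bsumD.
  apply: eq_fsum => p; congr (_ * _).
  rewrite /pr.
  have -> : (bx A bk1 p - N) * (bx A bk2 p - N) * (bx A bk3 p - N)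
    = (q ^ A) ^+ 3 - N * (bx A bk1 p * bx A bk2 p + bx A bk1 p * bx A bk3 p + bx A bk2 p * bx A bk3 p)
      + N ^+ 2 * (bx A bk1 p + bx A bk2 p + bx A bk3 p) - N ^+ 3.
    by rewrite -(bx_prod A p); ring.
  rewrite /N qzD; field; by rewrite !qz0.
have bVz C : bsum A C (bV A) = - (q ^ A) ^+ 3 * bsum A C zV.
  by rewrite -bsumZ; apply: eq_fsum => p; rewrite bV_zV.
move: expand; rewrite lower !bVz -/N => e.
have X0 := qz0 A.
have c0 : - (q ^ A) ^+ 4 * (1 - N) != 0 by rewrite mulf_neq0 ?oppr_eq0 ?expf_neq0.
apply: (mulfI c0).
transitivity (- (q ^ A) ^+ 3 * (q ^ A * (q - q ^ B) * (q - N) * (1 - N) * bsum A B zV)); first by ring.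
transitivity (q ^ A * (q ^ A * (q - q ^ B) * (q - N) * (1 - N) * (- (q ^ A) ^+ 3 * bsum A B zV)) / q ^ A).
  by field.
by rewrite -e; field.
Qed.

(** At B = 1 all entries are at least -1, which leaves the three rotations of (-1, 0, 1). The
    induction cannot begin at B = 0: no vector of the class contributes there, and the factor
    [q - q ^ B] of the recursion vanishes at B = 1. *)
Lemma bsum_zV_initial (A : nat) :
  bsum A.+1 1 zV = 3%:R * q ^- 2 * (ipoch A * ipoch A.+1).
Proof.
rewrite /bsum (fsumE [:: (- 1, 0); (0, 0); (1, - 1)]); first last.
- move=> -[j t]; rewrite mulf_eq0 negb_or /base_weight mulf_eq0 negb_or.
  case/andP=> /andP[_ /kern_supp [_ []]]; rewrite /bk1 /bk2 /bk3 /= => h1 h2 h3 _.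
  by rewrite !inE !xpair_eqE; lia.
- by [].
have zc p : zV (bcyc p) = zV p by rewrite /zV !bk_cyc /vdm; ring.
have c1 : (0, 0) = bcyc (- 1, 0) by [].
have c2 : (1, - 1) = bcyc (0, 0) by [].
rewrite !big_cons big_nil c2 base_weight_cyc zc c1 base_weight_cyc zc.
have e1 : bk1 (- 1, 0) = - 1 by [].
have e2 : bk2 (- 1, 0) = 0 by [].
have e3 : bk3 (- 1, 0) = 1 by [].
have bw : base_weight A.+1 1 (- 1, 0)
    = zpoch A.+2 * (ipoch A.+2 * ipoch A.+1 * ipoch A) * (ipoch 0 * ipoch 1 * ipoch 2).
  rewrite /base_weight e1 e2 e3 /kern (_ : 2 * _ = 0) // expr0z mul1r.
  by congr (zpoch _ * (ipoch _ * ipoch _ * ipoch _)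
          * (ipoch _ * ipoch _ * ipoch _)); lia.
rewrite bw /zV e1 e2 e3 /vdm.
have zi : zpoch A.+2 * ipoch A.+2 = 1 by exact: zpochK.
have q1 : 1 - q != 0 by rewrite subr_eq0 eq_sym; have := qn1 0; rewrite expr1.
have q2 : 1 - q ^+ 2 != 0 by rewrite subr_eq0 eq_sym.
have -> : ipoch 1 = (1 - q)^-1 by rewrite /ipoch /= /poch big_ord1 expr1.
have -> : ipoch 2 = ((1 - q) * (1 - q ^+ 2))^-1.
  by rewrite /ipoch /= /poch !big_ord_recr big_ord0 /= mul1r expr1.
rewrite ipoch0 expr0z expr1z exprN1.
transitivity (3%:R * (zpoch A.+2 * ipoch A.+2) * q ^- 2 * (ipoch A * ipoch A.+1)); last by rewrite zi mulr1.
by field; rewrite q0 q1 q2.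
Qed.

Lemma bsum_zV (A B : nat) : bsum A.+1 B.+1 zV
  = 3%:R * q ^- 2 * (q ^+ (2 * A * B) * ipoch A * ipoch B * ipoch (A + B).+1).
Proof.
elim: B => [|B IHB].
  by rewrite bsum_zV_initial muln0 addn0 expr0 ipoch0; ring.
have AB0 : Posz A.+1 + Posz B.+2 != 0 by lia.
have := bsum_zV_rec AB0.
have -> : Posz B.+2 - 1 = B.+1 by lia.
rewrite IHB.
have -> : ipoch B = ipoch B.+1 * (1 - q ^ B.+1) by rewrite -ipoch_pred; congr (ipoch); lia.
have -> : ipoch (A + B).+1 = ipoch (A + B.+1).+1 * (1 - q ^ (A + B.+1).+1).
  by rewrite -ipoch_pred; congr (ipoch); lia.
have nz1 : 1 - q ^ B.+1 != 0 by rewrite subr_eq0 eq_sym qz_neq1.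
have nz2 : 1 - q ^ (A + B.+1).+1 != 0 by rewrite subr_eq0 eq_sym qz_neq1.
have -> : q - q ^ B.+2 = q * (1 - q ^ B.+1) by rewrite -!exprnP exprS mulrBr mulr1.
have -> : q - q ^ (Posz A.+1 + Posz B.+2) = q * (1 - q ^ (A + B.+1).+1).
  by rewrite mulrBr mulr1 -[X in X * q ^ _]expr1z -qzD; congr (_ - q ^ _); lia.
have nz : q * (1 - q ^ B.+1) * (q * (1 - q ^ (A + B.+1).+1)) != 0 by rewrite !mulf_neq0.
move=> e; apply: (mulfI nz); rewrite e.
have -> : q ^+ (2 * A * B.+1) = q ^+ (2 * A * B) * q ^+ (2 * A) by rewrite -exprD; congr (_ ^+ _); lia.
have -> : (q ^ A.+1) ^+ 2 = q ^+ 2 * q ^+ (2 * A).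
  by rewrite -exprnP -exprM -exprD; congr (_ ^+ _); lia.
by field.
Qed.

Definition chi3 (d : int) : F :=
  if (d %% 3)%Z == 1 then 1 else if (d %% 3)%Z == 2 then -1 else 0.

Lemma chi3N d : chi3 (- d) = - chi3 d.
Proof.
rewrite /chi3; have : (d %% 3 = 0 \/ d %% 3 = 1 \/ d %% 3 = 2)%Z by lia.
case=> [e|[e|e]].
- have -> : (- d %% 3)%Z = 0 by lia.
  by rewrite e /= oppr0.
- have -> : (- d %% 3)%Z = 2 by lia.
  by rewrite e.
- have -> : (- d %% 3)%Z = 1 by lia.
  by rewrite e /= opprK.
Qed.

Lemma chi3_mod d m : chi3 (d + 3 * m) = chi3 d.
Proof. by rewrite /chi3 (_ : ((d + 3 * m) %% 3 = d %% 3)%Z) //; lia. Qed.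

(* A pair (k, l) stands for the vector (k, - k - l, l) of sum 0, whose squared length is
   2 half_norm; the latter is 1 mod 3 when chi3 (k - l) <> 0. *)
Definition half_norm (p : int * int) : int := p.1 * p.1 + p.1 * p.2 + p.2 * p.2.
Definition third_norm (p : int * int) : int := ((half_norm p - 1) %/ 3)%Z.

Lemma chi3_third_norm p : chi3 (p.1 - p.2) != 0 -> half_norm p - 1 = 3 * third_norm p.
Proof.
case: p => k l /=; rewrite /chi3 => c.
have e : k = l + 1 + 3 * ((k - l - 1) %/ 3)%Z \/ k = l + 2 + 3 * ((k - l - 2) %/ 3)%Z.
  move: c; case: ifP => [/eqP ? _|_]; first by left; lia.
  by case: ifP => [/eqP ? _|_]; [right; lia | rewrite eqxx].
rewrite /third_norm; suff : exists m, half_norm (k, l) - 1 = 3 * m by case=> m ->; lia.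
case: e; [set t := (_ %/ _)%Z | set t := (_ %/ _)%Z] => ->; rewrite /half_norm /=.
  by exists (l * l + 3 * l * t + l + 3 * t * t + 2 * t); ring.
by exists (l * l + 3 * l * t + 2 * l + 3 * t * t + 4 * t + 1); ring.
Qed.

(* Shifted kernels adapted to the linear terms r + s, s and 0 of a [step]. *)
Definition K11 (A B : int) (p : int * int) : F := kern p.1 (- p.1 - p.2) p.2 A B.
Definition K01 (A B : int) (p : int * int) : F := kern p.1 (- p.1 - p.2) (p.2 - 1) A B.
Definition K00 (A B : int) (p : int * int) : F := kern (p.1 + 1) (- p.1 - p.2) (p.2 - 1) A B.

Lemma finsupp_kern (c : int * int -> F) u w A B :
  finsupp (fun p => c p * kern (p.1 + u) (- p.1 - p.2) (p.2 + w) A B).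
Proof.
apply: (@finsupp_int2 _ _ (- (`|A| + `|B| + `|u| + `|w|)) (`|A| + `|B| + `|u| + `|w|)) => k l.
by rewrite mulf_eq0 negb_or => /andP[_ /kern_supp [[/= h1 h2 h3] [h4 h5 h6]]]; lia.
Qed.

Lemma finsupp_K11 c A B : finsupp (fun p => c p * K11 A B p).
Proof.
by have := finsupp_kern c 0 0 A B; congr finsupp; apply/funext => p; rewrite !addr0.
Qed.

Lemma finsupp_K01 c A B : finsupp (fun p => c p * K01 A B p).
Proof.
by have := finsupp_kern c 0 (- 1) A B; congr finsupp; apply/funext => p; rewrite !addr0.
Qed.

Lemma finsupp_K00 c A B : finsupp (fun p => c p * K00 A B p).
Proof. exact: finsupp_kern c 1 (- 1) A B. Qed.

Lemma chi3_bk p : chi3 (bk1 p - bk3 p) = 1.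
Proof. by rewrite /chi3 /bk1 /bk3 ifT //; lia. Qed.

(** Exchanging k and l exchanges the residues 1 and 2 of k - l, so one parametrization serves both
    classes. *)
Lemma fsum_chi3 (f : int * int -> F) : finsupp f ->
  fsum (fun p => chi3 (p.1 - p.2) * f p)
  = fsum (fun p => f (bk1 p, bk3 p) - f (bk3 p, bk1 p)).
Proof.
move=> ff.
pose d1 (p : int * int) : F := if ((p.1 - p.2) %% 3)%Z == 1 then 1 else 0.
pose f1 p := d1 p * f p; pose f2 p := d1 (p.2, p.1) * f p.
have f1s : finsupp f1 by apply: finsuppW ff => p; rewrite /f1 => ->; rewrite mulr0.
have f2s : finsupp f2 by apply: finsuppW ff => p; rewrite /f2 => ->; rewrite mulr0.
have -> : fsum (fun p => chi3 (p.1 - p.2) * f p) = fsum f1 - fsum f2.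
  rewrite -fsumB //; apply: eq_fsum => -[k l]; rewrite /f1 /f2 -mulrBl /d1 /chi3 /=.
  case: (((k - l) %% 3)%Z =P 1) => e1; case: (((k - l) %% 3)%Z =P 2) => e2;
    case: (((l - k) %% 3)%Z =P 1) => e3; rewrite ?subr0 ?sub0r ?subrr //; lia.
pose h p := (bk1 p, bk3 p); pose h' (p : int * int) := (p.1, ((p.1 - p.2 - 1) %/ 3)%Z - p.1).
have hK : cancel h h' by move=> [j t]; rewrite /h /h' /bk1 /bk3 /=; congr pair; lia.
have d1h p : d1 (h p) = 1 by rewrite /d1 /h /bk1 /bk3 /= ifT //; lia.
have [|] := @fsum_inj _ _ _ h h' f1 hK _ f1s.
  move=> [k l]; rewrite /f1 mulf_eq0 negb_or /d1 => /andP[+ _]; case: ifP; rewrite ?eqxx //= => /eqP e _.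
  by rewrite /h /h' /bk1 /bk3 /=; congr pair; lia.
move=> fin1 ->.
pose sw (p : int * int) := (p.2, p.1); have swK : involutive sw by case.
rewrite (reindex_fsum sw sw f2 swK swK).
have fin2s : finsupp (fun p => f2 (sw p)) by exact: finsupp_comp swK f2s.
have [|] := @fsum_inj _ _ _ h h' (fun p => f2 (sw p)) hK _ fin2s.
  move=> [k l]; rewrite /f2 /= mulf_eq0 negb_or /d1 /= => /andP[+ _]; case: ifP; rewrite ?eqxx //= => /eqP e _.
  by rewrite /h /h' /bk1 /bk3 /=; congr pair; lia.
move=> fin2 ->; rewrite -fsumB //; apply: eq_fsum => p.
by rewrite /f1 d1h mul1r /f2 -[(_.2, _.1)]/(h p) d1h mul1r.
Qed.

Definition base_coef (p : int * int) : F := q ^ (2 + p.1 - p.2 + 2 * third_norm p).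

(** The two residue classes combine to the weight d = q^(k1 - k3) - q^(k3 - k1). As the product of
    the q^(k_i) is 1, the rotations of d add up to the Vandermonde product, so [bsum_zV] gives three
    times the claim. *)
Theorem base_pair (L1 L2 : nat) :
  fsum (fun p => chi3 (p.1 - p.2) * base_coef p * K11 L1.+1 L2.+1 p)
  = q ^+ (2 * L1 * L2) * ipoch L1 * ipoch L2 * ipoch (L1 + L2).+1.
Proof.
have -> : fsum (fun p => chi3 (p.1 - p.2) * base_coef p * K11 L1.+1 L2.+1 p)
  = fsum (fun p => chi3 (p.1 - p.2) * (base_coef p * K11 L1.+1 L2.+1 p)).
  by apply: eq_fsum => p; rewrite mulrA.
rewrite fsum_chi3; last exact: finsupp_K11.
pose d p : F := q ^ bk1 p / q ^ bk3 p - q ^ bk3 p / q ^ bk1 p.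
have -> : fsum (fun p => base_coef (bk1 p, bk3 p) * K11 L1.+1 L2.+1 (bk1 p, bk3 p)
     - base_coef (bk3 p, bk1 p) * K11 L1.+1 L2.+1 (bk3 p, bk1 p)) = q ^+ 2 * bsum L1.+1 L2.+1 d.
  rewrite /bsum -fsumZ; apply: eq_fsum => p.
  have g1 : third_norm (bk1 p, bk3 p) = p.1 * p.1 + p.1 + 3 * p.1 * p.2 + 2 * p.2 + 3 * p.2 * p.2.
    have := @chi3_third_norm (bk1 p, bk3 p); rewrite /= chi3_bk => /(_ (oner_neq0 _)).
    by rewrite /half_norm /bk1 /bk3 /= => e; apply: (@mulfI int 3) => //; rewrite -e; ring.
  have g2 : third_norm (bk3 p, bk1 p) = third_norm (bk1 p, bk3 p).
    by rewrite /third_norm /half_norm /=; congr ((_ - 1) %/ 3)%Z; ring.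
  have k1 : K11 L1.+1 L2.+1 (bk1 p, bk3 p) = kern (bk1 p) (bk2 p) (bk3 p) L1.+1 L2.+1.
    by rewrite /K11 /=; congr (kern); have := bk_sum p; lia.
  have k2 : K11 L1.+1 L2.+1 (bk3 p, bk1 p) = kern (bk1 p) (bk2 p) (bk3 p) L1.+1 L2.+1.
    rewrite /K11 /= (_ : - bk3 p - bk1 p = bk2 p); last by have := bk_sum p; lia.
    by rewrite /kern; ring.
  rewrite k1 k2 /base_coef g2 g1 /base_weight /d !invr_expz -!qzD /=.
  rewrite (_ : 2 + bk1 p - bk3 p + _ = 2 + 2 * (p.1 * p.1 + p.1 + 3 * p.1 * p.2 + 2 * p.2 + 3 * p.2 * p.2) + (bk1 p - bk3 p)); last by ring.
  rewrite (_ : 2 + bk3 p - bk1 p + _ = 2 + 2 * (p.1 * p.1 + p.1 + 3 * p.1 * p.2 + 2 * p.2 + 3 * p.2 * p.2) + (bk3 p - bk1 p)); last by ring.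
  rewrite 2![q ^ (2 + _ + _)]qzD ![q ^ (2 + _)]qzD -exprnP; ring.
have cyc : bsum L1.+1 L2.+1 zV = 3%:R * bsum L1.+1 L2.+1 d.
  transitivity (bsum L1.+1 L2.+1 (fun p => d p + d (bcyc p) + d (bcyc (bcyc p)))).
    apply: eq_fsum => p; congr (_ * _); rewrite /zV /vdm /d !bk_cyc.
    have := zprod p; move: (qz0 (bk1 p)) (qz0 (bk2 p)) (qz0 (bk3 p)).
    move: (q ^ bk1 p) (q ^ bk2 p) (q ^ bk3 p) => x y z x0 y0 z0 xyz.
    have -> : z = (x * y)^-1.
      by apply: (mulfI (mulf_neq0 x0 y0)); rewrite xyz divff // mulf_neq0.
    by field; rewrite x0 y0 oner_neq0.
  have c1 := bsum_cyc L1.+1 L2.+1 d; have c2 := bsum_cyc L1.+1 L2.+1 (fun p => d (bcyc p)).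
  rewrite (bsumD _ _ (fun p => d p + d (bcyc p)) (fun p => d (bcyc (bcyc p)))).
  by rewrite (bsumD _ _ d (fun p => d (bcyc p))) -c2 -c1; ring.
have : 3%:R * (q ^+ 2 * bsum L1.+1 L2.+1 d) = 3%:R * (q ^+ (2 * L1 * L2) * ipoch L1 * ipoch L2 * ipoch (L1 + L2).+1).
  rewrite mulrCA -cyc bsum_zV; field; exact: q0.
exact: (mulfI (nat_neq0 2)).
Qed.

(** * Iterating the Bailey lemma *)

Lemma fsum_nat2 (V : zmodType) (lo1 lo2 : int) (n1 n2 : nat) (f : int * int -> V) :
  (forall r s, f (r, s) != 0 -> (lo1 <= r <= lo1 + n1) /\ (lo2 <= s <= lo2 + n2)) ->
  fsum f = \sum_(i < n1.+1) \sum_(j < n2.+1) f (lo1 + i%:Z, lo2 + j%:Z).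
Proof.
move=> supp; pose l lo n := [seq lo + Posz i | i <- iota 0 n.+1].
have lP lo n t : lo <= t <= lo + Posz n -> t \in l lo n.
  move=> tb; apply/mapP; exists `|t - lo|%N; last lia.
  by rewrite mem_iota; lia.
have lu lo n : uniq (l lo n) by rewrite map_inj_uniq ?iota_uniq // => i j; lia.
have lsum lo n (g : int -> V) : \sum_(t <- l lo n) g t = \sum_(i < n.+1) g (lo + i%:Z).
  by rewrite big_map -[n.+1]subn0 -/(index_iota 0 _) big_mkord subn0.
rewrite (fsumE [seq (r, s) | r <- l lo1 n1, s <- l lo2 n2]).
- by rewrite big_allpairs_dep lsum; apply: eq_bigr => i _; rewrite lsum.
- by apply: allpairs_uniq => // -[? ?] [? ?].
by case=> r s /supp [h1 h2]; apply: allpairs_f; exact: lP.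
Qed.

Definition step (u v : nat) (f : nat -> nat -> F) (L1 L2 : nat) : F :=
  \sum_(r < L1.+1) \sum_(s < L2.+1)
    q ^+ (r ^ 2 + s ^ 2 - r * s + u * r + v * s)
      * ipoch (L1%:Z - r%:Z) * ipoch (L2%:Z - s%:Z) * f r s.

Lemma quad_nat (r s u v : nat) :
  Posz (r ^ 2 + s ^ 2 - r * s + u * r + v * s)
  = r%:Z * r%:Z - r%:Z * s%:Z + s%:Z * s%:Z + u%:Z * r%:Z + v%:Z * s%:Z.
Proof.
have : (r * s <= r ^ 2 + s ^ 2)%N by nia.
by rewrite -!mulnn => le; rewrite !PoszD -subzn // PoszD !PoszM; ring.
Qed.

(** Substituting r + x and s + y in the Bailey sum creates the linear terms u and v. The
    disjunctions say that the largest a_i is at least x and the smallest at most -y, so that the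
    support of the kernel confines the shifted variables to natural numbers. *)
Lemma step_kern (a1 a2 a3 x y : int) (u v L1 L2 : nat) :
  u%:Z = 2 * x - y - (a1 + a2 + a3) -> v%:Z = 2 * y - x + (a1 + a2 + a3) ->
  [\/ x <= a1, x <= a2 | x <= a3] -> [\/ a1 <= - y, a2 <= - y | a3 <= - y] ->
  step u v (fun r s => kern a1 a2 a3 (r%:Z + x) (s%:Z + y)) L1 L2
  = q ^ (- (a1 * a2 + a1 * a3 + a2 * a3) - (x * x - x * y + y * y) + (a1 + a2 + a3) * (x - y))
    * kern a1 a2 a3 (L1%:Z + x) (L2%:Z + y).
Proof.
move=> uE vE xa ya; pose c := - (x * x - x * y + y * y) + (a1 + a2 + a3) * (x - y).
rewrite -addrA -/c addrC qzD -mulrA -bailey.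
rewrite (@fsum_nat2 _ x y L1 L2); last first.
  move=> r s /bterm_supp [? ? /kern_supp [[? ? ?] [? ? ?]]].
  by split; [case: xa | case: ya]; lia.
rewrite mulr_sumr; apply: eq_bigr => r _; rewrite mulr_sumr; apply: eq_bigr => s _.
rewrite /bterm !(mulrA (q ^ c)) -qzD exprnP quad_nat.
have -> : L1%:Z + x - (x + r%:Z) = L1%:Z - r%:Z by lia.
have -> : L2%:Z + y - (y + s%:Z) = L2%:Z - s%:Z by lia.
rewrite (addrC x) (addrC y); congr (q ^ _ * _ * _ * _).
by rewrite uE vE /c; ring.
Qed.

Lemma eq_step u v f g L1 L2 : (forall r s, f r s = g r s) -> step u v f L1 L2 = step u v g L1 L2.
Proof. by move=> fg; apply: eq_bigr => r _; apply: eq_bigr => s _; rewrite fg. Qed.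

Lemma stepZ u v c f L1 L2 : step u v (fun r s => c * f r s) L1 L2 = c * step u v f L1 L2.
Proof.
rewrite mulr_sumr; apply: eq_bigr => r _; rewrite mulr_sumr; apply: eq_bigr => s _.
by rewrite mulrCA.
Qed.

Lemma stepB u v f g L1 L2 :
  step u v (fun r s => f r s - g r s) L1 L2 = step u v f L1 L2 - step u v g L1 L2.
Proof.
rewrite -sumrB; apply: eq_bigr => r _; rewrite -sumrB; apply: eq_bigr => s _.
by rewrite mulrBr.
Qed.

Lemma step_fsum u v (f : nat -> nat -> int * int -> F) L1 L2 :
  (forall r s, finsupp (f r s)) ->
  step u v (fun r s => fsum (f r s)) L1 L2 = fsum (fun p => step u v (fun r s => f r s p) L1 L2).
Proof.
move=> ff.
pose w (r s : nat) : F := q ^+ (r ^ 2 + s ^ 2 - r * s + u * r + v * s)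
      * ipoch (L1%:Z - r%:Z) * ipoch (L2%:Z - s%:Z).
have fw (r s : nat) : finsupp (fun p => w r s * f r s p).
  by apply: finsuppW (ff r s) => p ->; rewrite mulr0.
have inner (r : nat) : finsupp (fun p => \sum_(s < L2.+1) w r s * f r s p) /\
    fsum (fun p => \sum_(s < L2.+1) w r s * f r s p) = \sum_(s < L2.+1) w r s * fsum (f r s).
  have [fin ->] := @fsum_sum _ _ _ (index_enum 'I_L2.+1) (fun s p => w r s * f r s p) (fun s => fw r s).
  by split; [exact: fin | apply: eq_bigr => s _; rewrite fsumZ].
have [_ ->] := @fsum_sum _ _ _ (index_enum 'I_L1.+1)
    (fun r p => \sum_(s < L2.+1) w r s * f r s p) (fun r => (inner r).1).
by apply: eq_bigr => r _; rewrite (inner r).2.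
Qed.

(** A nonzero integer vector of sum 0 has an entry >= 1 and one <= -1. The zero vector lies on the
    diagonal k = l, where the character vanishes. *)
Lemma zero_sum_extremes11 (k l : int) : k != l ->
  [\/ k <= - 1, - k - l <= - 1 | l <= - 1] /\ [\/ 1 <= k, 1 <= - k - l | 1 <= l].
Proof.
move=> kl; split.
  by case: (leP k (- 1)) => ?; [constructor 1|case: (leP l (- 1)) => ?; [constructor 3|constructor 2]]; lia.
by case: (leP 1 k) => ?; [constructor 1|case: (leP 1 l) => ?; [constructor 3|constructor 2]]; lia.
Qed.

Lemma zero_sum_extremes01 (k l : int) :
  [\/ k <= - 1, - k - l <= - 1 | l - 1 <= - 1] /\ [\/ 0 <= k, 0 <= - k - l | 0 <= l - 1].
Proof.
split.
  by case: (leP k (- 1)) => ?; [constructor 1|case: (leP l 0) => ?; [constructor 3|constructor 2]]; lia.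
by case: (leP 0 k) => ?; [constructor 1|case: (leP 1 l) => ?; [constructor 3|constructor 2]]; lia.
Qed.

Lemma zero_sum_extremes00 (k l : int) :
  [\/ k + 1 <= 0, - k - l <= 0 | l - 1 <= 0] /\ [\/ 0 <= k + 1, 0 <= - k - l | 0 <= l - 1].
Proof.
split.
  by case: (leP k (- 1)) => ?; [constructor 1|case: (leP l 1) => ?; [constructor 3|constructor 2]]; lia.
by case: (leP (- 1) k) => ?; [constructor 1|case: (leP 1 l) => ?; [constructor 3|constructor 2]]; lia.
Qed.

Definition G11 (c : int * int -> F) (L1 L2 : nat) : F :=
  fsum (fun p => chi3 (p.1 - p.2) * c p * K11 (L1%:Z + 1) (L2%:Z + 1) p).
Definition G01 (c : int * int -> F) (L1 L2 : nat) : F :=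
  fsum (fun p => chi3 (p.1 - p.2) * c p * K01 (L1%:Z + 0) (L2%:Z + 1) p).
Definition G00 (c : int * int -> F) (L1 L2 : nat) : F :=
  fsum (fun p => chi3 (p.1 - p.2) * c p * K00 (L1%:Z + 0) (L2%:Z + 0) p).

Lemma chi3_zero p : p.1 = p.2 -> chi3 (p.1 - p.2) = 0.
Proof. by move=> ->; rewrite subrr. Qed.

Lemma G11_step c L1 L2 :
  step 1 1 (G11 c) L1 L2 = G11 (fun p => q ^ (half_norm p - 1) * c p) L1 L2.
Proof.
rewrite /G11 step_fsum; last by move=> r s; exact: finsupp_K11.
apply: eq_fsum => p; rewrite stepZ.
have [->|c0] := eqVneq (chi3 (p.1 - p.2)) 0; first by rewrite !mul0r.
have np : (p.1 : int) != p.2 by apply: contraNneq c0 => e; rewrite chi3_zero.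
rewrite step_kern; first last.
- exact: (zero_sum_extremes11 np).1.
- exact: (zero_sum_extremes11 np).2.
- by lia.
- by lia.
rewrite /K11 mulrA -!mulrA; congr (_ * _); rewrite mulrCA; congr (_ * (_ * _)).
by congr (q ^ _); rewrite /half_norm; ring.
Qed.

Lemma G01_step c L1 L2 :
  step 0 1 (G01 c) L1 L2 = G01 (fun p => q ^ (half_norm p - p.2) * c p) L1 L2.
Proof.
rewrite /G01 step_fsum; last by move=> r s; exact: finsupp_K01.
apply: eq_fsum => p; rewrite stepZ.
rewrite step_kern; first last.
- exact: (zero_sum_extremes01 p.1 p.2).1.
- exact: (zero_sum_extremes01 p.1 p.2).2.
- by lia.
- by lia.
rewrite /K01 mulrA -!mulrA; congr (_ * _); rewrite mulrCA; congr (_ * (_ * _)).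
by congr (q ^ _); rewrite /half_norm; ring.
Qed.

Lemma G00_step c L1 L2 :
  step 0 0 (G00 c) L1 L2 = G00 (fun p => q ^ (half_norm p - p.2 + p.1 + 1) * c p) L1 L2.
Proof.
rewrite /G00 step_fsum; last by move=> r s; exact: finsupp_K00.
apply: eq_fsum => p; rewrite stepZ.
rewrite step_kern; first last.
- exact: (zero_sum_extremes00 p.1 p.2).1.
- exact: (zero_sum_extremes00 p.1 p.2).2.
- by lia.
- by lia.
rewrite /K00 mulrA -!mulrA; congr (_ * _); rewrite mulrCA; congr (_ * (_ * _)).
by congr (q ^ _); rewrite /half_norm; ring.
Qed.

Definition tau12 (p : int * int) : int * int := (- p.1 - p.2, p.2).
Definition tau23 (p : int * int) : int * int := (p.1, - p.1 - p.2).
Definition tau13 (p : int * int) : int * int := (p.2, p.1).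

Lemma tau12K : involutive tau12.
Proof. by case=> k l; rewrite /tau12 /=; congr pair; lia. Qed.
Lemma tau23K : involutive tau23.
Proof. by case=> k l; rewrite /tau23 /=; congr pair; lia. Qed.
Lemma tau13K : involutive tau13.
Proof. by case. Qed.

Lemma chi3_tau12 p : chi3 ((tau12 p).1 - (tau12 p).2) = - chi3 (p.1 - p.2).
Proof. by rewrite -chi3N -(chi3_mod (- (p.1 - p.2)) (- p.2)); congr chi3; rewrite /tau12 /=; ring. Qed.
Lemma chi3_tau23 p : chi3 ((tau23 p).1 - (tau23 p).2) = - chi3 (p.1 - p.2).
Proof. by rewrite -chi3N -(chi3_mod (- (p.1 - p.2)) p.1); congr chi3; rewrite /tau23 /=; ring. Qed.
Lemma chi3_tau13 p : chi3 ((tau13 p).1 - (tau13 p).2) = - chi3 (p.1 - p.2).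
Proof. by rewrite -chi3N; congr chi3; rewrite /tau13 /=; ring. Qed.

Lemma half_norm_tau12 p : half_norm (tau12 p) = half_norm p. Proof. rewrite /half_norm /tau12 /=; ring. Qed.
Lemma half_norm_tau23 p : half_norm (tau23 p) = half_norm p. Proof. rewrite /half_norm /tau23 /=; ring. Qed.
Lemma half_norm_tau13 p : half_norm (tau13 p) = half_norm p. Proof. rewrite /half_norm /tau13 /=; ring. Qed.

Lemma fsum_antisym (tau : int * int -> int * int) (f : int * int -> F) :
  involutive tau -> (forall p, chi3 ((tau p).1 - (tau p).2) = - chi3 (p.1 - p.2)) ->
  (forall p, f (tau p) = f p) -> finsupp f ->
  fsum (fun p => chi3 (p.1 - p.2) * f p) = 0.
Proof.
move=> tauK chiN fE fs; set S := fsum _.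
have SN : S = - S.
  rewrite {1}/S (reindex_fsum tau tau _ tauK tauK) -fsumN; last first.
    by apply: finsuppW fs => p ->; rewrite mulr0.
  by apply: eq_fsum => p; rewrite chiN fE mulNr.
apply: (mulfI (nat_neq0 1)); rewrite mulr0 mulr_natl mulr2n {1}SN; exact: addNr.
Qed.

Lemma kern_switch (a1 a2 a3 A B : int) : A + B != 0 ->
  kern a1 a2 (a3 - 1) (A - 1) B * (1 - q ^ (A + B))
  = kern a1 a2 a3 A B * ((1 - q ^ (A - a1)) * (1 - q ^ (A - a2)) * (1 - q ^ (B + a3))).
Proof.
move=> AB0; rewrite /kern (zpoch_pred AB0).
have -> : A - 1 + B = A + B - 1 by lia.
have -> : A - 1 - a1 = A - a1 - 1 by lia.
have -> : A - 1 - a2 = A - a2 - 1 by lia.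
have -> : A - 1 - (a3 - 1) = A - a3 by lia.
have -> : B + (a3 - 1) = B + a3 - 1 by lia.
rewrite !ipoch_pred; ring.
Qed.

(** After multiplication by [1 - q ^ (A + B)] the difference of the kernels is the symmetric [K11]
    times a Laurent polynomial. It splits into three pieces [f12], [f13], [f23], each fixed by one
    transposition and hence killed by the odd character. *)
Lemma switch_11_01 (psi : int * int -> F) L1 L2 :
  (forall p, psi (tau12 p) = psi p) -> (forall p, psi (tau23 p) = psi p) ->
  (forall p, psi (tau13 p) = psi p) ->
  G11 (fun p => psi p * q ^ (p.1 - p.2)) L1 L2 = G01 (fun p => psi p * q ^ (p.1 - p.2)) L1 L2.
Proof.
move=> psi12 psi23 psi13.
pose A : int := L1%:Z + 1; pose B : int := L2%:Z + 1.
pose X := q ^ A; pose Y := q ^ B.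
have AB0 : A + B != 0 by rewrite /A /B; lia.
have XY1 : 1 - X * Y != 0 by rewrite /X /Y -qzD subr_eq0 eq_sym qz_neq1.
have K12 p : K11 A B (tau12 p) = K11 A B p.
  rewrite /K11 /tau12 /= (_ : - (- p.1 - p.2) - p.2 = p.1); last by ring.
  by rewrite kern_perm12.
have K23 p : K11 A B (tau23 p) = K11 A B p.
  rewrite /K11 /tau23 /= (_ : - p.1 - (- p.1 - p.2) = p.2); last by ring.
  by rewrite kern_perm23.
have K13 p : K11 A B (tau13 p) = K11 A B p.
  rewrite /K11 /tau13 /= (_ : - p.2 - p.1 = - p.1 - p.2); last by ring.
  by rewrite kern_perm12 kern_perm23 kern_perm12.
pose f12 p := psi p * (X * q ^ (- p.2)) * K11 A B p.
pose f13 p := psi p * (X ^+ 2 * Y * q ^ (p.1 + p.2)) * K11 A B p.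
pose f23 p := psi p * (X * q ^ (p.1 + p.1) - X ^+ 2 * q ^ p.1 + Y * q ^ p.1 - X * Y
   - X * Y * (q ^ (p.1 - p.2) + q ^ (p.1 + p.1 + p.2))) * K11 A B p.
have z12 : fsum (fun p => chi3 (p.1 - p.2) * f12 p) = 0.
  apply: (fsum_antisym tau12K chi3_tau12); last exact: finsupp_K11.
  by move=> p; rewrite /f12 psi12 K12.
have z13 : fsum (fun p => chi3 (p.1 - p.2) * f13 p) = 0.
  apply: (fsum_antisym tau13K chi3_tau13); last exact: finsupp_K11.
  by move=> p; rewrite /f13 psi13 K13 /tau13 /= (addrC p.1).
have z23 : fsum (fun p => chi3 (p.1 - p.2) * f23 p) = 0.
  apply: (fsum_antisym tau23K chi3_tau23); last exact: finsupp_K11.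
  move=> p; rewrite /f23 psi23 K23 /tau23 /=.
  rewrite (_ : p.1 - (- p.1 - p.2) = p.1 + p.1 + p.2); last by ring.
  rewrite (_ : p.1 + p.1 + (- p.1 - p.2) = p.1 - p.2); last by ring.
  by rewrite (addrC (q ^ (p.1 + p.1 + p.2))).
have fin f c : finsupp (fun p => f p * c p * K11 A B p) -> finsupp (fun p => chi3 (p.1 - p.2) * (f p * c p * K11 A B p)).
  by apply: finsuppW => p ->; rewrite mulr0.
have fs12 : finsupp (fun p => chi3 (p.1 - p.2) * f12 p) by apply: fin; exact: finsupp_K11.
have fs13 : finsupp (fun p => chi3 (p.1 - p.2) * f13 p) by apply: fin; exact: finsupp_K11.
have fs23 : finsupp (fun p => chi3 (p.1 - p.2) * f23 p) by apply: fin; exact: finsupp_K11.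
apply: (mulfI XY1); apply/eqP; rewrite -subr_eq0 -!fsumZ -fsumB; first last.
- by apply: finsuppW (finsupp_K01 (fun p => chi3 (p.1 - p.2) * (psi p * q ^ (p.1 - p.2))) (L1%:Z + 0) B) => p ->; rewrite mulr0.
- by apply: finsuppW (finsupp_K11 (fun p => chi3 (p.1 - p.2) * (psi p * q ^ (p.1 - p.2))) A B) => p ->; rewrite mulr0.
apply/eqP; transitivity (fsum (fun p => chi3 (p.1 - p.2) * f12 p + chi3 (p.1 - p.2) * f13 p + chi3 (p.1 - p.2) * f23 p)).
  apply: eq_fsum => p; rewrite -/A -/B.
  have := kern_switch p.1 (- p.1 - p.2) p.2 AB0.
  rewrite (_ : A - 1 = L1%:Z + 0); last by rewrite /A; ring.
  rewrite -/(K01 _ _ p) -/(K11 _ _ p) qzD => ks.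
  transitivity (chi3 (p.1 - p.2) * psi p * q ^ (p.1 - p.2) * ((1 - X * Y) * K11 A B p - K01 (L1%:Z + 0) B p * (1 - X * Y))).
    by ring.
  rewrite ks /f12 /f13 /f23.
  have -> : q ^ (A - (- p.1 - p.2)) = X * q ^ p.1 * q ^ p.2 by rewrite -!qzD; congr (q ^ _); ring.
  have -> : q ^ (p.1 - p.2) = q ^ p.1 / q ^ p.2 by rewrite qzD invr_expz.
  have -> : q ^ (A - p.1) = X / q ^ p.1 by rewrite qzD invr_expz.
  have -> : q ^ (- p.2) = (q ^ p.2)^-1 by rewrite invr_expz.
  rewrite [q ^ (B + p.2)]qzD [q ^ (p.1 + p.1 + p.2)]qzD [q ^ (p.1 + p.1)]qzD [q ^ (p.1 + p.2)]qzD -/Y.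
  by field; rewrite !qz0.
by rewrite !fsumD ?z12 ?z13 ?z23 ?addr0 //; exact: finsuppD.
Qed.

(** The factor [1 - q ^ (s + l)] lowers the one [ipoch] of [K01] that is too high for [K00]. Both
    sides are then multiples of R, which is fixed by [tau12], and their difference is R times a
    multiplier fixed by [tau12]. *)
Lemma switch_01_00 (c : int * int -> F) (r s : nat) :
  (forall p, c (tau12 p) = c p) ->
  fsum (fun p => chi3 (p.1 - p.2) * (q ^ p.1 * c p) * (1 - q ^ (s%:Z + p.2)) * K01 (r%:Z + 0) (s%:Z + 1) p)
  = G00 (fun p => q ^ p.1 * c p) r s.
Proof.
move=> c12; rewrite /G00 !addr0.
pose X := q ^ r; pose Y := q ^ (s%:Z + 1).
have N0 : r%:Z + s%:Z + 1 != 0 by lia.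
have XY1 : 1 - X * Y != 0 by rewrite /X /Y -qzD subr_eq0 eq_sym qz_neq1 // addrA.
pose R (p : int * int) := zpoch (r%:Z + s%:Z + 1)
  * (ipoch (r%:Z - p.1) * ipoch (r%:Z - (- p.1 - p.2)) * ipoch (r%:Z - (p.2 - 1)))
  * (ipoch (s%:Z + 1 + p.1) * ipoch (s%:Z + 1 + (- p.1 - p.2)) * ipoch (s%:Z + p.2 - 1)).
have R01 p : (1 - q ^ (s%:Z + p.2)) * K01 r (s%:Z + 1) p = R p.
  rewrite /K01 /kern /R ipoch_pred addrA.
  by rewrite (_ : s%:Z + 1 + (p.2 - 1) = s%:Z + p.2); ring.
have R00 p : K00 r s p * (1 - X * Y) = R p * ((1 - q ^ (r%:Z - p.1)) * (1 - q ^ (s%:Z + 1 + (- p.1 - p.2)))).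
  rewrite /K00 /kern /R (zpoch_pred N0) /X /Y -qzD.
  rewrite (_ : r%:Z + (s%:Z + 1) = r%:Z + s%:Z + 1); last by ring.
  rewrite (_ : r%:Z + s%:Z + 1 - 1 = r%:Z + s%:Z); last by ring.
  rewrite (_ : r%:Z - (p.1 + 1) = r%:Z - p.1 - 1); last by ring.
  rewrite (_ : s%:Z + (p.1 + 1) = s%:Z + 1 + p.1); last by ring.
  rewrite (_ : s%:Z + (- p.1 - p.2) = s%:Z + 1 + (- p.1 - p.2) - 1); last by ring.
  by rewrite (_ : s%:Z + (p.2 - 1) = s%:Z + p.2 - 1) ?ipoch_pred; ring.
have R12 p : R (tau12 p) = R p.
  rewrite /R /tau12 /= (_ : - (- p.1 - p.2) - p.2 = p.1); last by ring.
  by ring.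
have finR (d : int * int -> F) : finsupp (fun p => d p * R p).
  by apply: finsuppW (finsupp_K01 d r (s%:Z + 1)) => p /eqP; rewrite mulf_eq0 -R01 => /orP[|] /eqP ->; ring.
pose f p := c p * (X - X * Y * (q ^ p.1 + q ^ (- p.1 - p.2)) + Y * q ^ (- p.2)) * R p.
have zf : fsum (fun p => chi3 (p.1 - p.2) * f p) = 0.
  apply: (fsum_antisym tau12K chi3_tau12); last exact: finR.
  move=> p; rewrite /f c12 R12 /tau12 /= (_ : - (- p.1 - p.2) - p.2 = p.1); last by ring.
  by rewrite (addrC (q ^ p.1)).
apply: (mulfI XY1); apply/eqP; rewrite -subr_eq0 -!fsumZ -fsumB; first last.
- by apply: finsuppW (finsupp_K00 (fun p => chi3 (p.1 - p.2) * (q ^ p.1 * c p)) r s) => p ->; rewrite mulr0.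
- by apply: finsuppW (finsupp_K01 (fun p => chi3 (p.1 - p.2) * (q ^ p.1 * c p) * (1 - q ^ (s%:Z + p.2))) r (s%:Z + 1)) => p ->; rewrite mulr0.
rewrite -zf; apply/eqP/eq_fsum => p.
transitivity (chi3 (p.1 - p.2) * (q ^ p.1 * c p)
   * ((1 - X * Y) * ((1 - q ^ (s%:Z + p.2)) * K01 r (s%:Z + 1) p) - K00 r s p * (1 - X * Y))); first by ring.
rewrite R01 R00 /f.
have -> : q ^ (s%:Z + 1 + (- p.1 - p.2)) = Y * q ^ (- p.1 - p.2) by rewrite -qzD.
have -> : q ^ (r%:Z - p.1) = X / q ^ p.1 by rewrite qzD invr_expz.
have -> : q ^ (- p.1 - p.2) = q ^ (- p.2) / q ^ p.1 by rewrite invr_expz -qzD; congr (q ^ _); ring.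
by field; rewrite !qz0.
Qed.

Definition beta (L1 L2 : nat) : F := q ^+ (2 * L1 * L2) * ipoch L1 * ipoch L2 * ipoch (L1 + L2).+1.

Lemma beta_G11 : beta = G11 base_coef.
Proof.
have succ (n : nat) : n%:Z + 1 = n.+1 by lia.
apply/funext => L1; apply/funext => L2; rewrite /G11 !succ.
by rewrite base_pair.
Qed.

Lemma G01_congr c c' : (forall p, chi3 (p.1 - p.2) != 0 -> c p = c' p) -> G01 c = G01 c'.
Proof.
move=> cc; apply/funext => L1; apply/funext => L2; apply: eq_fsum => p.
by have [->|/cc ->] := eqVneq (chi3 (p.1 - p.2)) 0; rewrite ?mul0r.
Qed.

Lemma G00_congr c c' : (forall p, chi3 (p.1 - p.2) != 0 -> c p = c' p) -> G00 c = G00 c'.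
Proof.
move=> cc; apply/funext => L1; apply/funext => L2; apply: eq_fsum => p.
by have [->|/cc ->] := eqVneq (chi3 (p.1 - p.2)) 0; rewrite ?mul0r.
Qed.

Lemma iter_G11 m c : iter m (step 1 1) (G11 c) = G11 (fun p => q ^ (m%:Z * (half_norm p - 1)) * c p).
Proof.
elim: m => [|m IHm] /=; first by congr G11; apply/funext => p; rewrite mul0r expr0z mul1r.
rewrite IHm; apply/funext => L1; apply/funext => L2; rewrite G11_step.
by apply: eq_fsum => p; rewrite mulrA -qzD; congr (_ * (q ^ _ * _) * _); lia.
Qed.

Lemma iter_G01 m c : iter m (step 0 1) (G01 c) = G01 (fun p => q ^ (m%:Z * (half_norm p - p.2)) * c p).
Proof.
elim: m => [|m IHm] /=; first by congr G01; apply/funext => p; rewrite mul0r expr0z mul1r.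
rewrite IHm; apply/funext => L1; apply/funext => L2; rewrite G01_step.
by apply: eq_fsum => p; rewrite mulrA -qzD; congr (_ * (q ^ _ * _) * _); lia.
Qed.

Lemma iter_G00 m c :
  iter m (step 0 0) (G00 c) = G00 (fun p => q ^ (m%:Z * (half_norm p - p.2 + p.1 + 1)) * c p).
Proof.
elim: m => [|m IHm] /=; first by congr G00; apply/funext => p; rewrite mul0r expr0z mul1r.
rewrite IHm; apply/funext => L1; apply/funext => L2; rewrite G00_step.
by apply: eq_fsum => p; rewrite mulrA -qzD; congr (_ * (q ^ _ * _) * _); lia.
Qed.

Lemma iter_step_lin m u v f g c : iter m (step u v) (fun r s => f r s - c * g r s)
  = (fun r s => iter m (step u v) f r s - c * iter m (step u v) g r s).
Proof.
elim: m => [|m IHm] //=; rewrite IHm; apply/funext => r; apply/funext => s.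
by rewrite stepB stepZ.
Qed.

Lemma iter_11_01 m : iter m (step 1 1) beta = G01 (fun p => q ^ (m%:Z * (half_norm p - 1)) * base_coef p).
Proof.
rewrite beta_G11 iter_G11; apply/funext => L1; apply/funext => L2.
pose psi p := q ^ (m%:Z * (half_norm p - 1) + 2 + 2 * third_norm p).
have e p : q ^ (m%:Z * (half_norm p - 1)) * base_coef p = psi p * q ^ (p.1 - p.2).
  by rewrite /base_coef /psi -!qzD; congr (q ^ _); ring.
rewrite (_ : (fun p => _) = fun p => psi p * q ^ (p.1 - p.2)); last exact/funext.
by apply: switch_11_01 => p; rewrite /psi /third_norm ?half_norm_tau12 ?half_norm_tau23 ?half_norm_tau13.
Qed.

Definition lattice_exp (n a b : nat) (p : int * int) : int :=
  2 + a%:Z + b%:Z + (b%:Z + 1) * p.1 - (a%:Z + 1) * p.2 + (3 * n%:Z + 2) * third_norm p.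

Theorem lattice_edge (n a : nat) : (a <= n)%N ->
  iter a (step 0 1) (iter (n - a) (step 1 1) beta) = G01 (fun p => q ^ lattice_exp n a 0 p).
Proof.
move=> an; rewrite iter_11_01 iter_G01; apply: G01_congr => p /chi3_third_norm h.
rewrite /base_coef -!qzD; congr (q ^ _).
have -> : half_norm p = 3 * third_norm p + 1 by rewrite -h subrK.
rewrite /lattice_exp -subzn //; ring.
Qed.

(** The subtraction supplies the factor [1 - q ^ (s + l)] that [switch_01_00] demands: the [q ^ s]
    turns a (0, 0) step into a (0, 1) step, and the [q ^ l] trades one (0, 1) step for one (1, 1)
    step. *)
Theorem lattice_interior (n a b : nat) : (0 < b)%N -> (b <= a)%N -> (a <= n)%N ->
  (fun L1 L2 => iter b (step 0 0) (iter (a - b) (step 0 1) (iter (n - a) (step 1 1) beta)) L1 L2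
    - q * iter b.-1 (step 0 0) (iter (a - b) (step 0 1) (iter (n - a).+1 (step 1 1) beta)) L1 L2)
  = G00 (fun p => q ^ lattice_exp n a b p).
Proof.
case: b => // b _ ba an; rewrite [b.+1.-1]/= iterSr -iter_step_lin.
pose d p := q ^ (((n - a)%N%:Z) * (half_norm p - 1) + ((a - b.+1)%N%:Z) * (half_norm p - p.2) + 2 - p.2 + 2 * third_norm p).
pose c p := q ^ p.1 * d p.
have e1 : iter (a - b.+1) (step 0 1) (iter (n - a) (step 1 1) beta) = G01 c.
  rewrite iter_11_01 iter_G01; apply: G01_congr => p _.
  by rewrite /base_coef /c /d -!qzD; congr (q ^ _); ring.
(* A (1, 1) step contributes q^(half_norm - 1) and a (0, 1) step q^(half_norm - l); including the
   prefactor q, the quotient is q^l. *)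
have e2 : (fun r s => q * iter (a - b.+1) (step 0 1) (iter (n - a).+1 (step 1 1) beta) r s)
    = step 0 1 (G01 (fun p => q ^ p.2 * c p)).
  apply/funext => r; apply/funext => s; rewrite iter_11_01 iter_G01 G01_step /G01 -fsumZ.
  apply: eq_fsum => p; rewrite mulrA; congr (_ * _).
  rewrite mulrCA; congr (_ * _).
  rewrite /base_coef /c /d -[X in X * _ = _]expr1z -!qzD; congr (q ^ _).
  by rewrite intS; ring.
have e3 : (fun r s => step 0 0 (G01 c) r s
      - q * iter (a - b.+1) (step 0 1) (iter (n - a).+1 (step 1 1) beta) r s)
    = step 0 0 (G00 c).
  apply/funext => r; apply/funext => s.
  have -> : q * iter (a - b.+1) (step 0 1) (iter (n - a).+1 (step 1 1) beta) r s
      = step 0 1 (G01 (fun p => q ^ p.2 * c p)) r s by rewrite -e2.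
  have -> : step 0 1 (G01 (fun p => q ^ p.2 * c p)) r s
      = step 0 0 (fun r s => q ^ s%:Z * G01 (fun p => q ^ p.2 * c p) r s) r s.
    apply: eq_bigr => i _; apply: eq_bigr => j _.
    rewrite -exprnP mulrA; congr (_ * _).
    by rewrite [in RHS]mulrC !mulrA -exprD; congr (q ^+ _ * _ * _); lia.
  rewrite -stepB; apply: eq_step => i j.
  rewrite -(@switch_01_00 d); last first.
    by move=> p; rewrite /d /third_norm half_norm_tau12 /tau12.
  rewrite /G01 -fsumZ -fsumB; first last.
  - by apply: finsuppW (finsupp_K01 (fun p => chi3 (p.1 - p.2) * (q ^ p.2 * c p)) (i%:Z + 0) (j%:Z + 1)) => p ->; rewrite mulr0.
  - exact: finsupp_K01.
  by apply: eq_fsum => p; rewrite qzD /c; ring.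
rewrite e1 e3 -iterSr iter_G00; apply: G00_congr => p /chi3_third_norm h.
rewrite /c /d -!qzD; congr (q ^ _).
have -> : half_norm p = 3 * third_norm p + 1 by rewrite -h subrK.
rewrite /lattice_exp -!subzn //; ring.
Qed.

(** * Eliminating the second summation variable *)

Lemma fsum_nat (V : zmodType) (n : nat) (f : int -> V) :
  (forall s, f s != 0 -> 0 <= s <= n%:Z) -> fsum f = \sum_(i < n.+1) f i%:Z.
Proof.
move=> supp; rewrite (fsumE [seq Posz i | i <- iota 0 n.+1]).
- by rewrite big_map -[n.+1]subn0 -/(index_iota 0 _) big_mkord subn0.
- by rewrite map_inj_uniq ?iota_uniq // => i j; lia.
move=> s /supp sn; apply/mapP; exists `|s|%N; last lia.
by rewrite mem_iota; lia.
Qed.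

Definition qbinF (N m : nat) : F := poch N * ipoch m * ipoch (N%:Z - m%:Z).

Lemma qbinF_small N m : (N < m)%N -> qbinF N m = 0.
Proof. by move=> Nm; rewrite /qbinF [ipoch (_ - _)]ipoch_lt0 ?mulr0 //; lia. Qed.

Lemma qbinF0 N : qbinF N 0 = 1.
Proof. by rewrite /qbinF subr0 ipoch0 mulr1 (zpochK (n := N)). Qed.

Lemma qbinF_pascal N m :
  qbinF N.+1 m.+1 = qbinF N m.+1 + q ^ (N%:Z - m%:Z) * qbinF N m.
Proof.
rewrite /qbinF pochS.
have -> : N.+1%:Z - m.+1%:Z = N%:Z - m%:Z by lia.
have -> : N%:Z - m.+1%:Z = N%:Z - m%:Z - 1 by lia.
have -> : ipoch m = ipoch m.+1 * (1 - q ^ m.+1) by rewrite -ipoch_pred; congr (ipoch); lia.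
have -> : q ^+ N.+1 = q ^ (N%:Z - m%:Z) * q ^ m.+1 by rewrite -qzD exprnP; congr (q ^ _); lia.
rewrite ipoch_pred; ring.
Qed.

Definition ukern (c : int) (M : nat) : F := ipoch M * ipoch (M%:Z + c).

Lemma vandermonde_nat (c : int) (M : nat) :
  \sum_(s < M.+1) q ^ (s%:Z * s%:Z + c * s%:Z) * ipoch (M%:Z - s%:Z) * ukern c s = ukern c M.
Proof.
rewrite /ukern -vandermonde (fsum_nat (n := M)); last first.
  by move=> s /vterm_supp [? ? _]; apply/andP.
by apply: eq_bigr => s _; rewrite /vterm !mulrA.
Qed.

(* Both sides satisfy the recursion f(l, c) = f(l, c - 1) + q^c f(l - 1, c). *)
Lemma ukern_expand (D : nat) (l c : int) (M : nat) : l + c = D%:Z ->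
  \sum_(s < M.+1) q ^ (s%:Z * s%:Z - l * s%:Z) * ipoch (M%:Z - s%:Z) * ukern c s
  = \sum_(m < D.+1) q ^ (m%:Z * m%:Z - l * m%:Z) * qbinF D m * ukern (m%:Z - l) M.
Proof.
elim: D l c => [|D IHD] l c lc.
  rewrite big_ord1 qbinF0 mulr1 /= (_ : 0 * 0 - l * 0 = 0 :> int); last by ring.
  rewrite expr0z mul1r (_ : 0%:Z - l = c); last by lia.
  rewrite -vandermonde_nat; apply: eq_bigr => s _.
  by rewrite (_ : l = - c) ?mulNr ?opprK //; lia.
have lc1 : l + (c - 1) = D%:Z by lia.
have lc2 : (l - 1) + c = D%:Z by lia.
transitivity (\sum_(s < M.+1) q ^ (s%:Z * s%:Z - l * s%:Z) * ipoch (M%:Z - s%:Z) * ukern (c - 1) s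
   + q ^ c * \sum_(s < M.+1) q ^ (s%:Z * s%:Z - (l - 1) * s%:Z) * ipoch (M%:Z - s%:Z) * ukern c s).
  rewrite mulr_sumr -big_split; apply: eq_bigr => s _ /=.
  rewrite /ukern addrA ipoch_pred [q ^ (s%:Z + c)]qzD.
  have -> : s%:Z * s%:Z - (l - 1) * s%:Z = (s%:Z * s%:Z - l * s%:Z) + s%:Z by ring.
  by rewrite [q ^ (_ + s%:Z)]qzD; ring.
rewrite (IHD _ _ lc1) (IHD _ _ lc2).
rewrite [RHS]big_ord_recl qbinF0 [X in X + _ = _]big_ord_recl qbinF0 -addrA; congr (_ + _).
have -> : \sum_(i < D) q ^ ((lift ord0 i)%:Z * (lift ord0 i)%:Z - l * (lift ord0 i)%:Z)
    * qbinF D (lift ord0 i) * ukern ((lift ord0 i)%:Z - l) M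
  = \sum_(i < D.+1) q ^ (i.+1%:Z * i.+1%:Z - l * i.+1%:Z) * qbinF D i.+1 * ukern (i.+1%:Z - l) M.
  by rewrite [RHS]big_ord_recr /= qbinF_small // mulr0 mul0r addr0.
rewrite mulr_sumr -big_split; apply: eq_bigr => m _ /=.
rewrite /bump add1n qbinF_pascal.
have -> : m%:Z - (l - 1) = m.+1%:Z - l by lia.
have e : q ^ c * q ^ (m%:Z * m%:Z - (l - 1) * m%:Z)
    = q ^ (m.+1%:Z * m.+1%:Z - l * m.+1%:Z) * q ^ (D%:Z - m%:Z).
  by rewrite -!qzD; congr (q ^ _); rewrite (_ : c = D%:Z + 1 - l) ?intS; [ring | lia].
transitivity (q ^ (m.+1%:Z * m.+1%:Z - l * m.+1%:Z) * qbinF D m.+1 * ukern (m.+1%:Z - l) M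
   + (q ^ (m.+1%:Z * m.+1%:Z - l * m.+1%:Z) * q ^ (D%:Z - m%:Z)) * (qbinF D m * ukern (m.+1%:Z - l) M)).
  by rewrite -e; ring.
ring.
Qed.

(** The parameter e must match the linear coefficient of s in the innermost step for that sum to be
    q-Vandermonde. The seed is e = 1; e = 0 serves the identity for a = b = k. *)
Definition betae (e L1 L2 : nat) : F := q ^+ (2 * L1 * L2) * ipoch L1 * ipoch L2 * ipoch (L1 + L2 + e)%N.

Lemma betae1 : betae 1 = beta.
Proof. by apply/funext => L1; apply/funext => L2; rewrite /betae addn1. Qed.

(** The index is shifted at every level, so for positive n the [eb 0] at the bottom is the exponent
    [eb n] of the innermost step. *)
Fixpoint chain (n : nat) (ea eb : nat -> nat) : nat -> nat -> F :=
  match n with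
  | 0 => betae (eb 0)
  | n'.+1 => step (ea 1) (eb 1) (chain n' (fun i => ea i.+1) (fun i => eb i.+1))
  end.

(* The sum over the remaining lambda_i, mu_i, as a function of (lambda_1, mu_1) = (r, m). *)
Fixpoint weight (B n : nat) (ea eb : nat -> nat) (r m : nat) : F :=
  match n with
  | 0 => 0
  | 1 => if m == (2 * r)%N then q ^+ (r ^ 2 + ea 1 * r) * ipoch r else 0
  | n'.+1 => q ^+ (r ^ 2 + m ^ 2 - r * m + ea 1 * r + eb 1 * m) *
      \sum_(r' < B.+1) \sum_(m' < B.+1) ipoch (r%:Z - r'%:Z)
         * qbinF (r - r' + m' + (eb 2 - eb 1)) m
         * weight B n' (fun i => ea i.+1) (fun i => eb i.+1) r' m'
  end.

Lemma weightS B n ea eb r m : weight B n.+2 ea eb r m =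
  q ^+ (r ^ 2 + m ^ 2 - r * m + ea 1 * r + eb 1 * m) *
      \sum_(r' < B.+1) \sum_(m' < B.+1) ipoch (r%:Z - r'%:Z)
         * qbinF (r - r' + m' + (eb 2 - eb 1)) m
         * weight B n.+1 (fun i => ea i.+1) (fun i => eb i.+1) r' m'.
Proof. by []. Qed.

(** Each level raises the excess of m over 2 r by at most the increment of [eb], hence by at most 1.
    The bound shows that cutting the sums at a large B loses nothing. *)
Lemma weight_supp B n ea eb r m : (forall i, eb i <= 1)%N ->
  weight B n ea eb r m != 0 -> (m <= 2 * r + n)%N.
Proof.
elim: n ea eb r m => [|[|n] IHn] ea eb r m eb1; first by rewrite eqxx.
  by rewrite /=; case: ifP => [/eqP mE _|_]; [lia | rewrite eqxx].
apply: contraNT; rewrite -ltnNge weightS => big.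
rewrite big1 ?mulr0 // => r' _; rewrite big1 // => m' _.
have [r'r|rr'] := ltnP r r'; first by rewrite ipoch_lt0 ?mul0r //; lia.
have [->|w0] := eqVneq (weight B n.+1 (fun i => ea i.+1) (fun i => eb i.+1) r' m') 0.
  by rewrite mulr0.
have h := IHn _ _ _ _ (fun i => eb1 i.+1) w0.
by rewrite qbinF_small ?mulr0 ?mul0r //; have := eb1 2; lia.
Qed.

(** The factor [q ^+ (2 * L1 * L2)] turns - r s into + r s, which makes the sum over s a
    q-Vandermonde sum of parameter r + e. Read as m - r + e, the shape kept by all further steps, it
    gives m = 2 r: the origin of mu_k = 2 lambda_k. *)
Lemma step_betae (ea e L1 L2 : nat) :
  step ea e (betae e) L1 L2
  = \sum_(r < L1.+1) ipoch (L1%:Z - r%:Z) * (q ^+ (r ^ 2 + ea * r) * ipoch r) * ukern (r%:Z + e%:Z) L2.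
Proof.
apply: eq_bigr => r _.
rewrite -vandermonde_nat mulr_sumr; apply: eq_bigr => s _.
rewrite /betae /ukern addrA PoszD PoszD.
have -> : s%:Z + r%:Z = r%:Z + s%:Z by lia.
have e1 : q ^+ (r ^ 2 + s ^ 2 - r * s + ea * r + e * s) * q ^+ (2 * r * s)
    = q ^+ (r ^ 2 + ea * r) * q ^ (s%:Z * s%:Z + (r%:Z + e%:Z) * s%:Z).
  rewrite [in RHS]exprnP -qzD -exprD exprnP; congr (q ^ _).
  by rewrite PoszD quad_nat -!mulnn !PoszD !PoszM; ring.
transitivity ((q ^+ (r ^ 2 + s ^ 2 - r * s + ea * r + e * s) * q ^+ (2 * r * s))
   * (ipoch (L1%:Z - r%:Z) * ipoch (L2%:Z - s%:Z) * ipoch r * ipoch s * ipoch (r%:Z + s%:Z + e%:Z))).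
  by ring.
rewrite e1; ring.
Qed.

(* [ukern_expand] trades the sum over the old mu for a sum over the new one. *)
Lemma step_ukern (ea e e' B L1 L2 : nat) (w : nat -> nat -> F) : (e' <= e)%N ->
  (forall r m, (r <= L1)%N -> w r m != 0 -> (L1 + m + (e - e') <= B)%N) ->
  (L1 <= B)%N ->
  step ea e' (fun L1 L2 => \sum_(r < L1.+1) \sum_(m < B.+1)
      ipoch (L1%:Z - r%:Z) * w r m * ukern (m%:Z - r%:Z + e%:Z) L2) L1 L2
  = \sum_(r < L1.+1) \sum_(m < B.+1) ipoch (L1%:Z - r%:Z)
     * (q ^+ (r ^ 2 + m ^ 2 - r * m + ea * r + e' * m) *
        \sum_(r' < B.+1) \sum_(m' < B.+1) ipoch (r%:Z - r'%:Z) * qbinF (r - r' + m' + (e - e')) m * w r' m')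
     * ukern (m%:Z - r%:Z + e'%:Z) L2.
Proof.
move=> ee' wB L1B; apply: eq_bigr => r _.
have rL1 : (r <= L1)%N by rewrite -ltnS.
pose t (r' m' : nat) := ipoch (r%:Z - r'%:Z) * w r' m'.
pose g (s r' m' : nat) := q ^+ (r ^ 2 + s ^ 2 - r * s + ea * r + e' * s) * ipoch (L1%:Z - r%:Z) * ipoch (L2%:Z - s%:Z)
    * (t r' m' * ukern (m'%:Z - r'%:Z + e%:Z) s).
transitivity (\sum_(r' < r.+1) \sum_(m' < B.+1) \sum_(s < L2.+1) g s r' m').
  rewrite [RHS](eq_bigr (fun r' : 'I_r.+1 => \sum_(s < L2.+1) \sum_(m' < B.+1) g s r' m')); last first.
    by move=> r' _; exact: exchange_big.
  rewrite exchange_big; apply: eq_bigr => s _; rewrite mulr_sumr; apply: eq_bigr => r' _.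
  by rewrite mulr_sumr; apply: eq_bigr => m' _; rewrite /g /t.
pose h (m r' m' : nat) := ipoch (L1%:Z - r%:Z)
     * (q ^+ (r ^ 2 + m ^ 2 - r * m + ea * r + e' * m) * (ipoch (r%:Z - r'%:Z) * qbinF (r - r' + m' + (e - e')) m * w r' m'))
     * ukern (m%:Z - r%:Z + e'%:Z) L2.
transitivity (\sum_(r' < r.+1) \sum_(m' < B.+1) \sum_(m < B.+1) h m r' m'); last first.
  rewrite [LHS](eq_bigr (fun r' : 'I_r.+1 => \sum_(m < B.+1) \sum_(m' < B.+1) h m r' m')); last first.
    by move=> r' _; exact: exchange_big.
  rewrite exchange_big; apply: eq_bigr => m _.
  rewrite mulr_sumr mulr_sumr mulr_suml.
  rewrite (big_ord_widen B.+1 (fun r' : nat => \sum_(m' < B.+1) h m r' m')) ?ltnS; last by lia.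
  rewrite big_mkcond; apply: eq_bigr => r' _.
  rewrite mulr_sumr mulr_sumr mulr_suml.
  case: ifP => rr'; first by apply: eq_bigr => m' _.
  symmetry; apply: big1 => m' _; rewrite /h [ipoch (r%:Z - _)]ipoch_lt0; last by lia.
  by rewrite !mul0r !mulr0 mul0r.
apply: eq_bigr => r' _; apply: eq_bigr => m' _.
have rr' : (r' <= r)%N by rewrite -ltnS.
have [w0|w0] := eqVneq (w r' m') 0.
  rewrite !big1 // => i _; first by rewrite /h w0 !mulr0 ?mul0r.
  by rewrite /g /t w0 mulr0 mul0r mulr0.
have mB := wB r' m' (leq_trans rr' rL1) w0.
pose D := (r - r' + m' + (e - e'))%N.
have DE : (r%:Z - e'%:Z) + (m'%:Z - r'%:Z + e%:Z) = D by rewrite /D; lia.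
have := ukern_expand L2 DE => ex.
pose c := q ^+ (r ^ 2 + ea * r) * ipoch (L1%:Z - r%:Z) * t r' m'.
have qe (s : nat) : q ^+ (r ^ 2 + s ^ 2 - r * s + ea * r + e' * s)
    = q ^+ (r ^ 2 + ea * r) * q ^ (s%:Z * s%:Z - (r%:Z - e'%:Z) * s%:Z).
  rewrite [in RHS]exprnP -qzD exprnP; congr (q ^ _).
  by rewrite quad_nat -!mulnn !PoszD !PoszM; ring.
transitivity (c * \sum_(s < L2.+1) q ^ (s%:Z * s%:Z - (r%:Z - e'%:Z) * s%:Z) * ipoch (L2%:Z - s%:Z)
   * ukern (m'%:Z - r'%:Z + e%:Z) s).
  by rewrite mulr_sumr; apply: eq_bigr => s _; rewrite /g /c qe; ring.
rewrite ex.
rewrite (big_ord_widen B.+1 (fun m : nat => q ^ (m%:Z * m%:Z - (r%:Z - e'%:Z) * m%:Z) * qbinF D m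
   * ukern (m%:Z - (r%:Z - e'%:Z)) L2)) ?ltnS; last by rewrite /D; lia.
rewrite big_mkcond mulr_sumr; apply: eq_bigr => m _.
rewrite /h -/D qe.
have -> : m%:Z - (r%:Z - e'%:Z) = m%:Z - r%:Z + e'%:Z by lia.
case: ifP => mD; first by rewrite /c /t; ring.
rewrite qbinF_small; last by lia.
by rewrite /c /t; ring.
Qed.

Lemma eq_step_le u v f g L1 L2 : (forall r s, (r <= L1)%N -> f r s = g r s) ->
  step u v f L1 L2 = step u v g L1 L2.
Proof. by move=> fg; apply: eq_bigr => r _; apply: eq_bigr => s _; rewrite fg // -ltnS. Qed.

(** In this form L2 enters through a single [ukern], so [step_ukern] applies again at each level.
    Monotonicity of [eb] makes the truncated differences exact; they become the Kronecker deltas of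
    the theorem. *)
Theorem chain_weight (n : nat) (ea eb : nat -> nat) (B L1 L2 : nat) :
  (forall i, eb i <= 1)%N -> (forall i, eb i <= eb i.+1)%N -> (3 * L1 + n.+2 <= B)%N ->
  chain n.+1 ea eb L1 L2
  = \sum_(r < L1.+1) \sum_(m < B.+1)
      ipoch (L1%:Z - r%:Z) * weight B n.+1 ea eb r m * ukern (m%:Z - r%:Z + (eb 1)%:Z) L2.
Proof.
elim: n ea eb L1 L2 => [|n IHn] ea eb L1 L2 eb1 ebS LB.
  rewrite /= step_betae; apply: eq_bigr => r _.
  have rB : (2 * r < B.+1)%N by have := ltn_ord r; lia.
  rewrite (bigD1 (Ordinal rB)) //= eqxx big1 ?addr0; last first.
    by move=> m; rewrite -val_eqE /= => /negbTE ->; rewrite mulr0 mul0r.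
  by congr (_ * _ * ukern _ _); lia.
transitivity (step (ea 1) (eb 1) (fun L1 L2 => \sum_(r < L1.+1) \sum_(m < B.+1)
      ipoch (L1%:Z - r%:Z) * weight B n.+1 (fun i => ea i.+1) (fun i => eb i.+1) r m
         * ukern (m%:Z - r%:Z + (eb 2)%:Z) L2) L1 L2).
  apply: eq_step_le => r s rL; apply: IHn => [i|i|]; [exact: eb1|exact: ebS|lia].
rewrite step_ukern //; last first.
- by lia.
- move=> r m rL /weight_supp-/(_ (fun i => eb1 i.+1)) mr.
  by have := eb1 2; lia.
Qed.

Lemma chain_split (m n u v : nat) (ea eb : nat -> nat) :
  (forall i, (i < m)%N -> ea i.+1 = u /\ eb i.+1 = v) ->
  chain (m + n) ea eb = iter m (step u v) (chain n (fun i => ea (m + i)%N) (fun i => eb (m + i)%N)).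
Proof.
elim: m ea eb => [|m IHm] ea eb uv //.
rewrite addSn /= (uv 0%N isT).1 (uv 0%N isT).2; congr (step u v).
by rewrite IHm // => i im; apply: (uv i.+1).
Qed.

Lemma step_swap u v f L1 L2 : step u v f L1 L2 = step v u (fun r s => f s r) L2 L1.
Proof.
rewrite /step exchange_big; apply: eq_bigr => r _; apply: eq_bigr => s _.
rewrite (addnC (expn s 2)) (mulnC s) addnAC; ring.
Qed.

(** The bottom of a chain records [eb] alone, whence the condition at n. At L1 = L2 the exchange
    reduces a < b to b <= a. *)
Lemma chain_swap n ea eb L1 L2 : ea n = eb n -> chain n ea eb L1 L2 = chain n eb ea L2 L1.
Proof.
elim: n ea eb L1 L2 => [|n IHn] ea eb L1 L2 e.
  by rewrite /= /betae e (addnC L1) -!mulnA (mulnC L1); ring.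
rewrite /= step_swap; apply: eq_bigr => r _; apply: eq_bigr => s _; congr (_ * _).
exact: IHn.
Qed.

Definition ind (a i : nat) : nat := (a < i)%N.

Lemma chain_ind (n a b : nat) : (b <= a)%N -> (a <= n)%N -> (b < n)%N ->
  chain n (ind a) (ind b)
  = iter b (step 0 0) (iter (a - b) (step 0 1) (iter (n - a) (step 1 1) beta)).
Proof.
move=> ba an bn; rewrite -{1}(subnKC (leq_trans ba an)) (@chain_split _ _ 0 0); last first.
  by move=> i ib; rewrite /ind !ltnS; split; apply/eqP; rewrite eqb0; lia.
congr (iter _ _ _).
have -> : (n - b = (a - b) + (n - a))%N by lia.
rewrite (@chain_split _ _ 0 1); last first.
  move=> i ib; rewrite /ind; split; first by apply/eqP; rewrite eqb0; lia.
  by apply/eqP; rewrite eqb1; lia.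
congr (iter _ _ _).
rewrite -{1}[(n - a)%N]addn0 (@chain_split _ _ 1 1); last first.
  by move=> i ib; rewrite /ind; split; apply/eqP; rewrite eqb1; lia.
congr (iter _ _ _); rewrite /= -betae1; congr betae.
by rewrite /ind; apply/eqP; rewrite eqb1; lia.
Qed.

Lemma chain_interior (n a b L : nat) : (0 < a)%N -> (0 < b)%N -> (a <= n)%N -> (b < n)%N ->
  chain n (ind a) (ind b) L L - q * chain n (ind a.-1) (ind b.-1) L L
  = G00 (fun p => q ^ lattice_exp n (maxn a b) (minn a b) p) L L.
Proof.
move=> a0 b0 an bn.
have key a' b' : (b' <= a')%N -> (0 < b')%N -> (a' <= n)%N -> (b' < n)%N ->
    chain n (ind a') (ind b') L L - q * chain n (ind a'.-1) (ind b'.-1) L L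
    = G00 (fun p => q ^ lattice_exp n a' b' p) L L.
  move=> ba' b0' an' bn'; rewrite !chain_ind //; try lia.
  have -> : (a'.-1 - b'.-1 = a' - b')%N by lia.
  have -> : (n - a'.-1 = (n - a').+1)%N by lia.
  by rewrite -lattice_interior.
have [ba|ab] := leqP b a; first by rewrite key.
have indn c : (c < n)%N -> ind c n = 1%N by rewrite /ind => ->.
rewrite (chain_swap (ea := ind a)) ?indn ?(chain_swap (ea := ind a.-1)) ?indn ?key //; lia.
Qed.

Lemma chain_edge (n a b L : nat) : (a * b = 0)%N -> (a <= n)%N -> (b < n)%N ->
  chain n (ind a) (ind b) L L = G01 (fun p => q ^ lattice_exp n (maxn a b) (minn a b) p) L L.
Proof.
move=> ab0 an bn.
have key a' : (a' <= n)%N -> chain n (ind a') (ind 0) L L = G01 (fun p => q ^ lattice_exp n a' 0 p) L L.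
  by move=> an'; rewrite chain_ind //= ?subn0 ?lattice_edge //; lia.
have [->|a0] := eqVneq b 0%N; first by rewrite maxn0 minn0 key.
have -> : a = 0%N by move/eqP: ab0; rewrite muln_eq0 (negbTE a0) orbF => /eqP.
rewrite max0n min0n chain_swap ?key //; first by lia.
by rewrite /ind bn (leq_ltn_trans (leq0n b) bn).
Qed.

(** Since 1/(q)_(r+s) = (1 - q^(r+s+1))/(q)_(r+s+1), and q^(r+s) turns a (0, 0) step into a (1, 1)
    step, the single sum for a = b = k is itself a difference covered by [lattice_interior]. *)
Lemma betae0E : betae 0 = fun r s => beta r s - q * (q ^+ (r + s) * beta r s).
Proof.
apply/funext => r; apply/funext => s.
rewrite /betae /beta addn0 -[ipoch (r + s)%N](congr1 ipoch (addrK 1 _)) ipoch_pred.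
have -> : Posz (r + s) + 1 = (r + s).+1 by lia.
rewrite -[q ^ _]/(q ^+ (r + s).+1) exprS; ring.
Qed.

Lemma chain_diag (n L : nat) : (0 < n)%N ->
  chain n (fun=> 0%N) (fun=> 0%N) L L = G00 (fun p => q ^ lattice_exp n n n p) L L.
Proof.
move=> n0; have nn : (n <= n)%N by [].
have := lattice_interior n0 nn nn; rewrite subnn /= => <-.
have -> : chain n (fun=> 0%N) (fun=> 0%N) = iter n (step 0 0) (betae 0).
  by rewrite -{1}[n]addn0 (@chain_split n 0 0 0).
case: n n0 nn => // n _ _; rewrite !iterSr /=.
have -> : step 0 0 (betae 0) = fun r s => step 0 0 beta r s - q * step 1 1 beta r s.
  apply/funext => r; apply/funext => s; rewrite betae0E stepB stepZ; congr (_ - _ * _).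
  apply: eq_bigr => i _; apply: eq_bigr => j _.
  rewrite [in LHS]mulrCA mulrA; congr (_ * _).
  by rewrite !mulrA -exprD; congr (q ^+ _ * _ * _); lia.
by rewrite iter_step_lin.
Qed.

(** * From nested sums to sums over boxes *)

Fixpoint term (n : nat) (ea eb : nat -> nat) (lam mu : nat -> nat) : F :=
  match n with
  | 0 => 0
  | 1 => q ^+ (lam 1 ^ 2 + ea 1 * lam 1) * ipoch (lam 1)
  | n'.+1 => q ^+ (lam 1 ^ 2 + mu 1 ^ 2 - lam 1 * mu 1 + ea 1 * lam 1 + eb 1 * mu 1)
      * (ipoch ((lam 1)%:Z - (lam 2)%:Z) * qbinF (lam 1 - lam 2 + mu 2 + (eb 2 - eb 1)) (mu 1))
      * term n' (fun i => ea i.+1) (fun i => eb i.+1) (fun i => lam i.+1) (fun i => mu i.+1)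
  end.

Lemma termS n ea eb lam mu : term n.+2 ea eb lam mu =
  q ^+ (lam 1 ^ 2 + mu 1 ^ 2 - lam 1 * mu 1 + ea 1 * lam 1 + eb 1 * mu 1)
      * (ipoch ((lam 1)%:Z - (lam 2)%:Z) * qbinF (lam 1 - lam 2 + mu 2 + (eb 2 - eb 1)) (mu 1))
      * term n.+1 (fun i => ea i.+1) (fun i => eb i.+1) (fun i => lam i.+1) (fun i => mu i.+1).
Proof. by []. Qed.

Lemma eq_term n ea eb lam mu lam' mu' :
  (forall i, lam i.+1 = lam' i.+1) -> (forall i, mu i.+1 = mu' i.+1) ->
  term n ea eb lam mu = term n ea eb lam' mu'.
Proof.
elim: n ea eb lam mu lam' mu' => // -[|n] IHn ea eb lam mu lam' mu' el em.
  by rewrite /= el.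
rewrite !termS !el !em; congr (_ * _).
by apply: IHn => i; rewrite ?el ?em.
Qed.

(** The nested sum treats mu_k as a variable restricted to the value 2 lambda_k, while the box sum
    substitutes it. The condition on [Phi] ensures that this value lies in the range. *)
Lemma weight_box n ea eb B (Phi : nat -> nat -> F) :
  (forall r m, Phi r m != 0 -> (2 * r <= B)%N) ->
  \sum_(r < B.+1) \sum_(m < B.+1) weight B n.+1 ea eb r m * Phi r m
  = \sum_(t : {ffun 'I_n.+1 -> 'I_B.+1}) \sum_(s : {ffun 'I_n -> 'I_B.+1})
     term n.+1 ea eb (lam_of t) (@mu_of n.+1 B (lam_of t) s)
       * Phi (lam_of t 1) (@mu_of n.+1 B (lam_of t) s 1).
Proof.
elim: n ea eb Phi => [|n IHn] ea eb Phi PhiB.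
  rewrite sum_fcons; apply: eq_bigr => x _.
  pose f0 : {ffun 'I_0 -> 'I_B.+1} := [ffun=> ord0].
  have e0 (f : {ffun 'I_0 -> 'I_B.+1}) : f = f0 by apply/ffunP => -[].
  have s0 (G : {ffun 'I_0 -> 'I_B.+1} -> F) : \sum_f G f = G f0.
    by rewrite (eq_bigl (fun f => f == f0)) ?big_pred1_eq // => f; rewrite (e0 f) eqxx.
  rewrite !s0 /= lam_of_cons1 /mu_of /= lam_of_cons1.
  have [PhiE|] := eqVneq (Phi x (2 * x)%N) 0.
    rewrite PhiE mulr0 big1 // => m _; case: eqP => [->|_]; last by rewrite mul0r.
    by rewrite PhiE mulr0.
  move=> /PhiB xB; have xB' : (2 * x < B.+1)%N by [].
  rewrite (bigD1 (Ordinal xB')) //= eqxx big1 ?addr0 // => m.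
  by rewrite -val_eqE /= => /negbTE ->; rewrite mul0r.
pose c (r m r' m' : nat) := q ^+ (r ^ 2 + m ^ 2 - r * m + ea 1 * r + eb 1 * m)
  * (ipoch (r%:Z - r'%:Z) * qbinF (r - r' + m' + (eb 2 - eb 1)) m).
pose Psi (r' m' : nat) := \sum_(r < B.+1) \sum_(m < B.+1) c r m r' m' * Phi r m.
have PsiB r' m' : Psi r' m' != 0 -> (2 * r' <= B)%N.
  apply: contraNT; rewrite -ltnNge => Br; apply/eqP; rewrite /Psi; apply: big1 => r _; apply: big1 => m _.
  have [->|/PhiB rB] := eqVneq (Phi r m) 0; first by rewrite mulr0.
  by rewrite /c [ipoch (_ - _)]ipoch_lt0 ?mul0r ?mulr0 ?mul0r //; lia.
have := IHn (fun i => ea i.+1) (fun i => eb i.+1) Psi PsiB.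
set w' := weight B n.+1 (fun i => ea i.+1) (fun i => eb i.+1).
move=> IH; transitivity (\sum_(r' < B.+1) \sum_(m' < B.+1) w' r' m' * Psi r' m').
  pose g (r m r' m' : nat) := c r m r' m' * w' r' m' * Phi r m.
  transitivity (\sum_(r < B.+1) \sum_(m < B.+1) \sum_(r' < B.+1) \sum_(m' < B.+1) g r m r' m').
    apply: eq_bigr => r _; apply: eq_bigr => m _.
    rewrite weightS mulr_sumr mulr_suml; apply: eq_bigr => r' _.
    rewrite mulr_sumr mulr_suml; apply: eq_bigr => m' _.
    by rewrite /g /c -!mulrA.
  have ex1 (r : 'I_B.+1) : \sum_(m < B.+1) \sum_(r' < B.+1) \sum_(m' < B.+1) g r m r' m'
     = \sum_(r' < B.+1) \sum_(m' < B.+1) \sum_(m < B.+1) g r m r' m'.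
    by rewrite exchange_big; apply: eq_bigr => r' _; exact: exchange_big.
  rewrite (eq_bigr _ (fun r _ => ex1 r)) exchange_big; apply: eq_bigr => r' _.
  rewrite exchange_big; apply: eq_bigr => m' _.
  rewrite mulr_sumr; apply: eq_bigr => r _; rewrite mulr_sumr; apply: eq_bigr => m _.
  by rewrite /g; ring.
rewrite IH [RHS]sum_fcons.
transitivity (\sum_(x < B.+1) \sum_(t : {ffun 'I_n.+1 -> 'I_B.+1}) \sum_(y < B.+1) \sum_(s : {ffun 'I_n -> 'I_B.+1})
   term n.+1 (fun i => ea i.+1) (fun i => eb i.+1) (lam_of t) (@mu_of n.+1 B (lam_of t) s)
    * (c x y (lam_of t 1) (@mu_of n.+1 B (lam_of t) s 1) * Phi x y)).
  rewrite [RHS]exchange_big; apply: eq_bigr => t _.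
  under [RHS]eq_bigr => x _ do rewrite exchange_big.
  rewrite [RHS]exchange_big; apply: eq_bigr => s _; rewrite mulr_sumr; apply: eq_bigr => x _.
  by rewrite mulr_sumr.
apply: eq_bigr => x _; apply: eq_bigr => t _; rewrite [RHS]sum_fcons.
apply: eq_bigr => y _; apply: eq_bigr => s _.
have muE i : @mu_of n.+2 B (lam_of (fcons x t)) (fcons y s) i.+2 = @mu_of n.+1 B (lam_of t) s i.+1.
  by rewrite mu_of_consS /mu_of; case: ifP => // _; case: ifP => // _; rewrite lam_of_consS.
rewrite termS lam_of_cons1 mu_of_cons1 lam_of_consS muE.
rewrite (@eq_term n.+1 _ _ (fun i => lam_of (fcons x t) i.+1)
    (fun i => @mu_of n.+2 B (lam_of (fcons x t)) (fcons y s) i.+1) (lam_of t) (@mu_of n.+1 B (lam_of t) s)).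
- by rewrite /c; ring.
- by move=> i; exact: lam_of_consS.
- by move=> i; exact: muE.
Qed.

(** 1/(q)_(lambda_1) times the q-binomials of consecutive lambda telescopes to the product of all
    1/(q)_(lambda_i - lambda_(i+1)), with 1/(q)_(lambda_(n+1)) at the end. *)
Lemma term_prod n ea eb lam mu :
  q ^+ ((\sum_(1 <= i < n.+1) (lam i ^ 2 + mu i ^ 2 - lam i * mu i + ea i * lam i + eb i * mu i))
         + (lam n.+1 ^ 2 + ea n.+1 * lam n.+1))%N
   * (ipoch (lam 1%N) * \prod_(i <- iota 1 n) (qbinF (lam i) (lam i.+1)
        * qbinF (lam i - lam i.+1 + mu i.+1 + (eb i.+1 - eb i)) (mu i)))
  = term n.+1 ea eb lam mu.
Proof.
elim: n ea eb lam mu => [|n IHn] ea eb lam mu.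
  by rewrite big_geq // add0n big_nil mulr1.
rewrite termS -IHn.
rewrite big_ltn // big_add1 /= -addnA exprD.
rewrite big_cons (iotaDl 1 1 n) big_map.
have -> : qbinF (lam 1%N) (lam 2) = poch (lam 1%N) * (poch (lam 2))^-1 * ipoch ((lam 1%N)%:Z - (lam 2)%:Z) by [].
have pi : poch (lam 1%N) * (poch (lam 1%N))^-1 = 1 by rewrite divff // poch_neq0.
set e1 := q ^+ (_ + _); set e2 := q ^+ (_ + (_ + _)); set P := \prod_(i <- _) _;
set b := qbinF _ _.
transitivity ((poch (lam 1%N) * (poch (lam 1%N))^-1) * (e1 * e2 * (poch (lam 2))^-1 * ipoch ((lam 1%N)%:Z - (lam 2)%:Z) * b * P)).
  by ring.
rewrite pi; ring.
Qed.

(** * A finite form of Jacobi's triple product *)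

Section Theta.
Variable x : F.
Hypothesis x0 : x != 0.

Definition theta_coef (m : int) : F := (- x) ^ m * q ^ binz m.
Definition theta_term (a b : nat) (m : int) : F :=
  theta_coef m * (ipoch (a%:Z - m) * ipoch (b%:Z + m)).

Lemma theta_coefS m : theta_coef (m + 1) = - x * q ^ m * theta_coef m.
Proof.
rewrite /theta_coef binzS qzD expfzDr ?oppr_eq0 // expr1z; ring.
Qed.

Lemma finsupp_theta a b : finsupp (theta_term a b).
Proof.
apply: (@finsupp_int _ _ (- b%:Z) a%:Z) => m.
rewrite /theta_term !mulf_eq0 !negb_or => /andP[_ /andP[/ipoch_ge0 h1 /ipoch_ge0 h2]]; lia.
Qed.

Lemma theta_termSl a b m : (1 - q ^ (a%:Z + b%:Z + 1)) * theta_term a.+1 b m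
  = theta_term a b m - x * q ^+ a * theta_term a b (m - 1).
Proof.
rewrite /theta_term.
have -> : theta_coef m = - x * q ^ (m - 1) * theta_coef (m - 1) by rewrite -theta_coefS subrK.
have -> : a.+1%:Z - m = a%:Z - m + 1 by lia.
have -> : a%:Z - (m - 1) = a%:Z - m + 1 by lia.
have -> : b%:Z + (m - 1) = b%:Z + m - 1 by lia.
have -> : ipoch (a%:Z - m) = ipoch (a%:Z - m + 1) * (1 - q ^ (a%:Z - m + 1)).
  by rewrite -ipoch_pred addrK.
rewrite ipoch_pred.
have -> : q ^ (a%:Z + b%:Z + 1) = q ^ (a%:Z - m + 1) * q ^ (b%:Z + m) by rewrite -qzD; congr (q ^ _); ring.
have -> : q ^+ a = q ^ (a%:Z - m + 1) * q ^ (m - 1).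
  by rewrite -qzD -[q ^+ a]/(q ^ a%:Z); congr (q ^ _); ring.
ring.
Qed.

Lemma theta_termSr a b m : (1 - q ^ (a%:Z + b%:Z + 1)) * theta_term a b.+1 m
  = theta_term a b m - q ^+ b.+1 / x * theta_term a b (m + 1).
Proof.
rewrite /theta_term theta_coefS.
have -> : b.+1%:Z + m = b%:Z + m + 1 by lia.
have -> : a%:Z - (m + 1) = a%:Z - m - 1 by lia.
have -> : b%:Z + (m + 1) = b%:Z + m + 1 by lia.
have -> : ipoch (b%:Z + m) = ipoch (b%:Z + m + 1) * (1 - q ^ (b%:Z + m + 1)).
  by rewrite -ipoch_pred addrK.
rewrite ipoch_pred.
have -> : q ^ (a%:Z + b%:Z + 1) = q ^ (a%:Z - m) * q ^ (b%:Z + m + 1) by rewrite -qzD; congr (q ^ _); ring.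
have -> : q ^+ b.+1 / x * (- x * q ^ m * theta_coef m * (ipoch (a%:Z - m) * (1 - q ^ (a%:Z - m)) * ipoch (b%:Z + m + 1)))
  = - (q ^+ b.+1 * q ^ m) * (theta_coef m * (ipoch (a%:Z - m) * (1 - q ^ (a%:Z - m)) * ipoch (b%:Z + m + 1))).
  by field.
have -> : q ^+ b.+1 * q ^ m = q ^ (b%:Z + m + 1) by rewrite -[q ^+ _]/(q ^ b.+1%:Z) -qzD; congr (q ^ _); lia.
ring.
Qed.

(** When a or b grows by one, the summand becomes itself minus a multiple of its translate in m. The
    translate has the same total, so each increment contributes one factor of the product. *)
Lemma finite_jacobi a b : poch (a + b) * fsum (theta_term a b)
  = \prod_(j < a) (1 - x * q ^+ j) * \prod_(j < b) (1 - q ^+ j.+1 / x).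
Proof.
have qz n : q ^ (a%:Z + n%:Z + 1) = q ^+ (a + n).+1 by rewrite -[RHS]/(q ^ (a + n).+1%:Z); congr (q ^ _); lia.
have shift a' b' c h h' : cancel h h' -> cancel h' h ->
    fsum (fun m => theta_term a' b' m - c * theta_term a' b' (h m)) = (1 - c) * fsum (theta_term a' b').
  move=> hK h'K; rewrite fsumB; last first.
  - by apply: finsuppW (finsupp_comp hK (finsupp_theta a' b')) => m ->; rewrite mulr0.
  - exact: finsupp_theta.
  by rewrite fsumZ -(reindex_fsum h h' _ hK h'K) mulrBl mul1r.
elim: b => [|b IHb].
  rewrite big_ord0 mulr1 addn0 {qz}; elim: a => [|a IHa].
    rewrite !big_ord0 (fsum_single 0) => [|m m0].
      rewrite -[theta_term 0 0 0]/((- x) ^ 0 * q ^ 0 * (ipoch 0 * ipoch 0)) !expr0z.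
      by rewrite -[ipoch 0]/((poch 0)^-1) /poch !big_ord0 !invr1 !mulr1.
    rewrite /theta_term; case: m m0 => [[|m]|m] // _; first by rewrite mul0r mulr0.
    by rewrite mulr0 mulr0.
  rewrite big_ord_recr /= -IHa /poch big_ord_recr /= -/(poch a) -mulrA.
  have -> : q ^+ a.+1 = q ^ (a%:Z + 0%:Z + 1) by rewrite -[LHS]/(q ^ a.+1%:Z); congr (q ^ _); lia.
  rewrite -fsumZ (eq_fsum (theta_termSl a 0)) (shift _ _ _ _ _ (subrK 1) (addrK 1)); ring.
rewrite big_ord_recr /= addnS /poch big_ord_recr /= -/(poch (a + b)) -qz -mulrA -fsumZ.
rewrite (eq_fsum (theta_termSr a b)) (shift _ _ _ _ _ (addrK 1) (subrK 1)).
by rewrite [RHS]mulrA -IHb; ring.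
Qed.
End Theta.

End GenericBase.

(** * Formal power series *)

Definition ps := fps.

HB.instance Definition _ := gen_eqMixin ps.
HB.instance Definition _ := gen_choiceMixin ps.

Lemma fps_addA : associative (fps_add : ps -> ps -> ps).
Proof. by move=> f g h; apply/funext => n; rewrite /fps_add addrA. Qed.
Lemma fps_addC : commutative (fps_add : ps -> ps -> ps).
Proof. by move=> f g; apply/funext => n; rewrite /fps_add addrC. Qed.
Lemma fps_add0 : left_id (fps0 : ps) fps_add.
Proof. by move=> f; apply/funext => n; rewrite /fps_add add0r. Qed.
Definition fps_opp (f : ps) : ps := fun n => - f n.
Lemma fps_addN : left_inverse (fps0 : ps) fps_opp fps_add.
Proof. by move=> f; apply/funext => n; rewrite /fps_add addNr. Qed.

HB.instance Definition _ := GRing.isZmodule.Build ps fps_addA fps_addC fps_add0 fps_addN.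

Definition fps_trunc (N : nat) (f : ps) : {poly int} := \poly_(i < N.+1) f i.

(** Low coefficients of a product are those of a polynomial product; the ring laws are thereby
    inherited from [{poly int}]. *)
Lemma fps_mul_trunc N (f g : ps) n : (n <= N)%N ->
  fps_mul f g n = (fps_trunc N f * fps_trunc N g)`_n.
Proof.
move=> nN; rewrite coefM; apply: eq_bigr => i _.
have iN : (i < N.+1)%N by apply: leq_trans (ltn_ord i) _.
have jN : (n - i < N.+1)%N by rewrite ltnS (leq_trans (leq_subr _ _)).
by rewrite !coef_poly iN jN.
Qed.

Lemma fps_mulC : commutative (fps_mul : ps -> ps -> ps).
Proof. by move=> f g; apply/funext => n; rewrite !(fps_mul_trunc _ _ (leqnn n)) mulrC. Qed.

Lemma fps_mulA : associative (fps_mul : ps -> ps -> ps).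
Proof.
have key (f g h : ps) n : fps_mul (fps_mul f g) h n
    = (fps_trunc n f * fps_trunc n g * fps_trunc n h)`_n.
  rewrite coefM; apply: eq_bigr => i _.
  have ni : (i <= n)%N by rewrite -ltnS.
  rewrite (fps_mul_trunc _ _ ni) coef_poly ltnS leq_subr.
  by congr (_ * _).
move=> f g h; apply/funext => n.
by rewrite [in LHS]fps_mulC key key mulrC mulrA.
Qed.

Lemma fps_mul1 : left_id (fps1 : ps) fps_mul.
Proof.
move=> f; apply/funext => n; rewrite /fps_mul big_ord_recl /fps1 /fps_monom /= mul1r subn0.
by rewrite big1 ?addr0 // => i _; rewrite mul0r.
Qed.

Lemma fps_mulDl : left_distributive (fps_mul : ps -> ps -> ps) fps_add.
Proof.
move=> f g h; apply/funext => n; rewrite /fps_add /fps_mul -big_split.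
by apply: eq_bigr => i _; rewrite mulrDl.
Qed.

Lemma fps1_neq0 : (fps1 : ps) != 0.
Proof. by apply/eqP => /(congr1 (fun f : ps => f 0%N)). Qed.

HB.instance Definition _ :=
  GRing.Zmodule_isComNzRing.Build ps fps_mulA fps_mulC fps_mul1 fps_mulDl fps1_neq0.

(** Inverses are chosen classically to fit the ring interface; [fps_invE] identifies them with the
    recursive [fps_inv] for constant term 1. *)
Definition ps_unit : pred ps := fun f => `[< exists g : ps, g * f = 1 >].
Definition ps_inv (f : ps) : ps :=
  if pselect (exists g : ps, g * f = 1) is left e then sval (cid e) else f.

Lemma ps_mulV : {in ps_unit, left_inverse 1 ps_inv *%R}.
Proof.
move=> f /asboolP e; rewrite /ps_inv; case: pselect => // e'.
by case: (cid e').
Qed.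

Lemma ps_unitP (f g : ps) : g * f = 1 -> ps_unit f.
Proof. by move=> e; apply/asboolP; exists g. Qed.

Lemma ps_inv_out : {in [predC ps_unit], ps_inv =1 id}.
Proof.
by move=> f /asboolP ne; rewrite /ps_inv; case: pselect.
Qed.

HB.instance Definition _ :=
  GRing.ComNzRing_hasMulInverse.Build ps ps_mulV ps_unitP ps_inv_out.

Lemma ps_neq0P (f : ps) : f != 0 -> exists2 n, f n != 0 & forall m, (m < n)%N -> f m = 0.
Proof.
move=> f0; have ex : exists n, f n != 0.
  apply: contrapT => ne; case/eqP: f0; apply/funext => n.
  by apply/eqP; apply: contraT => fn; case: ne; exists n.
exists (ex_minn ex); first by case: ex_minnP.
by case: ex_minnP => n _ nmin m mn; apply/eqP; apply: contraLR mn => /nmin; rewrite -leqNgt.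
Qed.

(** Lowest nonzero coefficients multiply without cancellation. This provides the fraction field in
    which the generic identities are specialized at q = [X]. *)
Lemma ps_integral (f g : ps) : f * g = 0 -> (f == 0) || (g == 0).
Proof.
move=> fg; apply: contraT; rewrite negb_or => /andP[/ps_neq0P[m fm fmin] /ps_neq0P[n gn gmin]].
have : (f * g) (m + n)%N = f m * g n.
  have mm : (m < (m + n).+1)%N by lia.
  rewrite -[LHS]/(\sum_(i < (m + n).+1) f i * g (m + n - i)%N).
  rewrite (bigD1 (Ordinal mm)) //= addKn big1 ?addr0 // => i im.
  have [/fmin ->|im'] := ltnP i m; first by rewrite mul0r.
  rewrite gmin ?mulr0 //; move: im; rewrite -val_eqE /= => im.
  have := ltn_ord i; lia.
rewrite fg => /esym/eqP; rewrite -[(0 : ps) _]/(0 : int) mulf_eq0.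
by rewrite (negbTE fm) (negbTE gn).
Qed.

HB.instance Definition _ := GRing.ComUnitRing_isIntegral.Build ps ps_integral.

Lemma inv_seq_size f n : size (inv_seq f n) = n.+1.
Proof. by elim: n => //= n IHn; rewrite size_rcons IHn. Qed.

Lemma inv_seq_nth f n i : (i <= n)%N -> nth 0 (inv_seq f n) i = fps_inv f i.
Proof.
elim: n => [|n IHn]; first by rewrite leqn0 => /eqP ->.
rewrite leq_eqVlt => /orP[/eqP -> //|]; rewrite ltnS => lin.
by rewrite /= nth_rcons inv_seq_size ltnS lin IHn.
Qed.

Lemma fps_mulV (f : ps) : f 0%N = 1 -> (fps_inv f : ps) * f = 1.
Proof.
move=> f0; rewrite mulrC; apply/funext => -[|n].
  by rewrite -[LHS]/(\sum_(i < 1) f i * fps_inv f (0 - i)%N) big_ord1 f0.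
rewrite -[LHS]/(\sum_(i < n.+2) f i * fps_inv f (n.+1 - i)%N) big_ord_recl f0 mul1r subn0.
rewrite {1}/fps_inv /= nth_rcons inv_seq_size ltnn eqxx.
apply/eqP; rewrite addrC subr_eq0; apply/eqP; apply: eq_bigr => i _.
rewrite /bump /= add1n subSS; congr (_ * _).
by rewrite inv_seq_nth // leq_subr.
Qed.

Lemma ps_unit_const1 (f : ps) : f 0%N = 1 -> f \is a GRing.unit.
Proof. by move=> f0; apply: (ps_unitP (fps_mulV f0)). Qed.

Lemma fps_invE (f : ps) : f 0%N = 1 -> (fps_inv f : ps) = f^-1.
Proof.
move=> f0; have fu := ps_unit_const1 f0.
by apply: (mulIr fu); rewrite fps_mulV // mulVr.
Qed.

Lemma psD (f g : ps) n : (f + g) n = f n + g n. Proof. by []. Qed.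
Lemma psN (f : ps) n : (- f) n = - f n. Proof. by []. Qed.
Lemma ps0 n : (0 : ps) n = 0. Proof. by []. Qed.
Lemma psM (f g : ps) n : (f * g) n = \sum_(i < n.+1) f i * g (n - i)%N. Proof. by []. Qed.

Lemma ps_sum (I : Type) (r : seq I) (P : pred I) (E : I -> ps) n :
  (\sum_(i <- r | P i) E i) n = \sum_(i <- r | P i) E i n.
Proof. by apply: (big_morph (fun f : ps => f n)). Qed.

Definition X : ps := fps_monom 1.

Lemma monomM e (f : ps) n : ((fps_monom e : ps) * f) n = if (e <= n)%N then f (n - e)%N else 0.
Proof.
rewrite psM; case: leqP => en.
  rewrite (bigD1 (Ordinal (en : (e < n.+1)%N))) //= big1 ?addr0 => [|i].
    by rewrite /fps_monom eqxx mul1r.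
  by rewrite -val_eqE /= /fps_monom => /negbTE ->; rewrite mul0r.
rewrite big1 // => i _; rewrite /fps_monom (_ : (i == e :> nat) = false) ?mul0r //.
by apply/negbTE; have := ltn_ord i; lia.
Qed.

Lemma monomE e : fps_monom e = X ^+ e :> ps.
Proof.
elim: e => [//|e IHe]; rewrite exprS -IHe; apply/funext => n.
rewrite monomM /fps_monom; case: n => [|n] /=; first by [].
by rewrite subn1 eqSS.
Qed.

Lemma XnM e (f : ps) n : (X ^+ e * f) n = if (e <= n)%N then f (n - e)%N else 0.
Proof. by rewrite -monomE monomM. Qed.

Lemma Xn_coef e n : (X ^+ e) n = (n == e)%:R.
Proof. by rewrite -monomE. Qed.

Lemma ps_natr k : (k%:R : ps) 0%N = k%:R.
Proof. by elim: k => // k IHk; rewrite !mulrS psD IHk. Qed.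

Notation Fr := {fraction ps}.
Local Notation "x %:F" := (@tofrac ps x).
Definition frq : Fr := X%:F.

Lemma X_neq0 : X != 0.
Proof. by apply/eqP => /(congr1 (fun f : ps => f 1%N)). Qed.

Lemma frq0 : frq != 0.
Proof. by rewrite tofrac_eq0 X_neq0. Qed.

Lemma frqn1 n : frq ^+ n.+1 != 1.
Proof.
rewrite -tofracXn -tofrac1 tofrac_eq -monomE.
by apply/eqP => /(congr1 (fun f : ps => f 0%N)).
Qed.

Lemma fr_nat_neq0 n : n.+1%:R != 0 :> Fr.
Proof.
rewrite -[n.+1%:R](rmorph_nat (@tofrac ps)) tofrac_eq0.
apply/eqP => /(congr1 (fun f : ps => f 0%N)); rewrite ps_natr ps0 => /eqP.
by rewrite pnatr_eq0.
Qed.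

(** Congruence modulo q^(N+1). To pass to the limit, two series are shown congruent for every N,
    with a finite size chosen in terms of N. *)
Definition eqN (N : nat) (f g : ps) := forall m, (m <= N)%N -> f m = g m.

Section EqN.
Variable N : nat.
Lemma eqN_sym f g : eqN N f g -> eqN N g f. Proof. by move=> fg m /fg. Qed.
Lemma eqN_trans f g h : eqN N f g -> eqN N g h -> eqN N f h.
Proof. by move=> fg gh m mN; rewrite fg ?gh. Qed.
Lemma eqND f g f' g' : eqN N f f' -> eqN N g g' -> eqN N (f + g) (f' + g').
Proof. by move=> ff third_norm m mN; rewrite !psD ff ?third_norm. Qed.
Lemma eqNM f g f' g' : eqN N f f' -> eqN N g g' -> eqN N (f * g) (f' * g').
Proof.
move=> ff third_norm m mN; rewrite !psM; apply: eq_bigr => i _.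
by rewrite ff ?third_norm //; have := ltn_ord i; lia.
Qed.
Lemma eqN_sum (I : Type) (r : seq I) (P : pred I) (E E' : I -> ps) :
  (forall i, P i -> eqN N (E i) (E' i)) ->
  eqN N (\sum_(i <- r | P i) E i) (\sum_(i <- r | P i) E' i).
Proof.
by move=> EE m mN; rewrite !ps_sum; apply: eq_bigr => i Pi; apply: EE.
Qed.
Lemma eqN_inv f g : f \is a GRing.unit -> g \is a GRing.unit -> eqN N f g -> eqN N f^-1 g^-1.
Proof.
move=> fu gu fg.
have -> : f^-1 = f^-1 * (g * g^-1) by rewrite mulrV ?mulr1.
rewrite -[X in eqN N _ X](mul1r g^-1) -[X in eqN N _ (X * _)](mulVr fu) mulrA.
by apply: eqNM => //; apply: eqNM => //; exact: eqN_sym.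
Qed.
Lemma eqN_Xn e f : (N < e)%N -> eqN N (X ^+ e * f) 0.
Proof. by move=> Ne m mN; rewrite XnM leqNgt (leq_ltn_trans mN Ne). Qed.
End EqN.

Lemma eqN_eq f g : (forall N, eqN N f g) -> f = g.
Proof. by move=> fg; apply/funext => n; apply: (fg n). Qed.

Definition ppoch (d n : nat) : ps := \prod_(j < n) (1 - X ^+ (d * j.+1)).

Lemma fps_prodE (s : seq ps) : fps_prod s = \prod_(f <- s) f.
Proof. by elim: s => [|f s IHs]; rewrite ?big_nil ?big_cons //= IHs. Qed.

Lemma qpochE n : qpoch n = ppoch 1 n.
Proof.
rewrite /qpoch fps_prodE big_map -[n in iota 0 n]subn0 -/(index_iota 0 n) big_mkord.
by apply: eq_bigr => j _; rewrite -monomE mul1n.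
Qed.

Lemma ps_const_prod (I : Type) (r : seq I) (E : I -> ps) :
  (forall i, E i 0%N = 1) -> (\prod_(i <- r) E i) 0%N = 1.
Proof.
move=> E1; elim: r => [|i r IHr]; first by rewrite big_nil.
by rewrite big_cons psM big_ord1 subnn E1 IHr.
Qed.

Lemma one_sub_Xn0 e : (0 < e)%N -> (1 - X ^+ e) 0%N = 1.
Proof. by case: e => // e _; rewrite psD psN Xn_coef. Qed.

Lemma ppoch0 d n : (0 < d)%N -> ppoch d n 0%N = 1.
Proof. by move=> d0; apply: ps_const_prod => j; apply: one_sub_Xn0; rewrite muln_gt0 d0. Qed.

Lemma ppoch_unit d n : (0 < d)%N -> ppoch d n \is a GRing.unit.
Proof. by move=> d0; exact: ps_unit_const1 (ppoch0 n d0). Qed.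

Lemma tofrac_ppoch d n : (ppoch d n)%:F = poch (frq ^+ d) n.
Proof.
rewrite /ppoch rmorph_prod; apply: eq_bigr => j _.
by rewrite rmorphB rmorph1 rmorphXn exprM.
Qed.

Lemma tofrac_inv (f : ps) : f \is a GRing.unit -> (f^-1)%:F = (f%:F)^-1.
Proof.
move=> fu; have f0 : f%:F != 0 by rewrite tofrac_eq0; apply: contraTneq fu => ->; rewrite unitr0.
by apply: (mulfI f0); rewrite divff // -rmorphM mulrV // rmorph1.
Qed.

Definition pinv (d : nat) (z : int) : ps := if z is Posz m then (ppoch d m)^-1 else 0.

Lemma tofrac_pinv d z : (0 < d)%N -> (pinv d z)%:F = ipoch (frq ^+ d) z.
Proof.
move=> d0; case: z => n /=; last exact: rmorph0.
by rewrite tofrac_inv ?ppoch_unit // tofrac_ppoch.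
Qed.

Definition pprod (e d n : nat) : ps := \prod_(j < n) (1 - X ^+ (e + d * j)).

Lemma pinf_eqN e d n N : (0 < e)%N -> (0 < d)%N -> (N < n)%N -> eqN N (pinf e d) (pprod e d n).
Proof.
move=> e0 d0 Nn m mN.
have -> : pinf e d m = (pprod e d m.+1) m.
  rewrite /pinf fps_prodE big_map -[X in iota 0 X]subn0 -/(index_iota 0 _) big_mkord.
  by congr ((_ : ps) m); apply: eq_bigr => j _; rewrite -monomE.
have mn : (m.+1 <= n)%N by lia.
rewrite -(subnKC mn); elim: (n - m.+1)%N => [|i IHi]; first by rewrite addn0.
rewrite addnS IHi /pprod [in RHS]big_ord_recr /= mulrBr mulr1 psD psN mulrC XnM.
by rewrite leqNgt (_ : (m < _)%N) ?subr0 //; nia.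
Qed.

Lemma pprod0 e d n : (0 < e)%N -> pprod e d n 0%N = 1.
Proof. by move=> e0; apply: ps_const_prod => j; apply: one_sub_Xn0; lia. Qed.

Lemma pinf0 e d : (0 < e)%N -> (0 < d)%N -> pinf e d 0%N = 1.
Proof. by move=> e0 d0; rewrite (pinf_eqN (n := 1) (N := 0)) ?pprod0. Qed.

Lemma pinf_unit e d : (0 < e)%N -> (0 < d)%N -> (pinf e d : ps) \is a GRing.unit.
Proof. by move=> e0 d0; apply: ps_unit_const1; exact: pinf0. Qed.

Lemma ppoch_eqN d n N : (0 < d)%N -> (N < n)%N -> eqN N (ppoch d n) (pinf d d).
Proof.
move=> d0 Nn; apply: eqN_sym => m mN; rewrite (pinf_eqN (n := n) (N := N)) //.
by congr ((_ : ps) m); apply: eq_bigr => j _; rewrite mulnS.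
Qed.

Lemma pinv_eqN d z N : (0 < d)%N -> N%:Z < z -> eqN N (pinv d z) (pinf d d : ps)^-1.
Proof.
move=> d0; case: z => // n Nn; apply: eqN_inv; rewrite ?ppoch_unit ?pinf_unit //.
exact: ppoch_eqN.
Qed.

Local Notation "x %:F" := (@tofrac ps x).
Local Notation pinfp e d := (pinf e d : ps).
Local Notation iq := ((pinfp 1 1)^-1).

(** * The limit of the finite identities *)

Lemma tofrac_qbin n m : (qbin n m : ps)%:F = qbinF frq n m.
Proof.
rewrite /qbin; case: ifP => mn; last first.
  by rewrite (qbinF_small frq0) ?ltnNge ?mn //; exact: tofrac0.
rewrite !qpochE !fps_invE ?ppoch0 // /qbinF.
have -> : n%:Z - m%:Z = (n - m)%N by lia.
by rewrite -!(@tofrac_pinv 1) // -(@tofrac_ppoch 1) -mulrA -!rmorphM.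
Qed.

Lemma tofrac_summand n c lin d ea eb lam mu :
  lin lam mu = (c + (\sum_(1 <= i < n.+1) (ea i * lam i + eb i * mu i) + ea n.+1 * lam n.+1))%N ->
  (forall i, d i.+1 = (eb i.+2 - eb i.+1)%N) ->
  (summand n.+1 lin d lam mu : ps)%:F = frq ^+ c * term frq n.+1 ea eb lam mu.
Proof.
move=> linE dE; rewrite -(term_prod frqn1).
rewrite /summand fps_invE ?qpochE ?ppoch0 // -[fps_mul _ _]/((fps_monom _ : ps) * ((ppoch 1 (lam 1%N))^-1 * _)).
rewrite monomE fps_prodE !rmorphM rmorphXn -/frq rmorph_prod big_map.
rewrite [RHS]mulrA -exprD; congr (_ ^+ _ * (_ * _)).
- rewrite linE [in RHS](eq_bigr (fun i => (lam i ^ 2 + mu i ^ 2 - lam i * mu i) + (ea i * lam i + eb i * mu i))%N).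
    by rewrite [in RHS]big_split /=; lia.
  by move=> i _; rewrite addnA.
- by rewrite -(@tofrac_pinv 1).
apply: eq_big_seq => i; rewrite mem_iota.
case: i => // i _; rewrite dE -[fps_mul _ _]/((qbin _ _ : ps) * (qbin _ _ : ps)) rmorphM /=.
by rewrite !tofrac_qbin.
Qed.

(** * Independence of the size of the box *)

Section Stability.
Variable V : zmodType.

Definition boxl k B (H : (nat -> nat) -> V) : V :=
  \sum_(t : {ffun 'I_k -> 'I_B.+1}) H (lam_of t).

Definition consf (x : nat) (l : nat -> nat) (i : nat) : nat :=
  if i is i'.+1 then if i' is _.+1 then l i' else x else 0%N.

Lemma boxlS k B H : boxl k.+1 B H = \sum_(x < B.+1) boxl k B (fun l => H (consf x l)).
Proof.
rewrite /boxl sum_fcons; apply: eq_bigr => x _; apply: eq_bigr => f _; congr H.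
apply/funext => -[|[|i]]; [by [] | exact: lam_of_cons1 | exact: lam_of_consS].
Qed.

Lemma boxl_stable k N B (H : (nat -> nat) -> V) : (N <= B)%N ->
  (forall l i, (0 < i <= k)%N -> (N < l i)%N -> H l = 0) -> boxl k B H = boxl k N H.
Proof.
move=> NB; elim: k H => [|k IHk] H H0.
  have s0 C (f0 f : {ffun 'I_0 -> 'I_C.+1}) : f = f0 by apply/ffunP => -[].
  pose g C : {ffun 'I_0 -> 'I_C.+1} := [ffun=> ord0].
  have e C : boxl 0 C H = H (lam_of (g C)).
    by rewrite /boxl (eq_bigl (fun f => f == g C)) ?big_pred1_eq // => f; rewrite (s0 C (g C) f) eqxx.
  by rewrite !e; congr H; apply/funext => i; rewrite /lam_of; case: i.
rewrite !boxlS.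
have stab (x : nat) : boxl k B (fun l => H (consf x l)) = boxl k N (fun l => H (consf x l)).
  by apply: IHk => l [|i] // ik Nl; exact: (H0 (consf x l) i.+2).
under [LHS]eq_bigr => x _ do rewrite stab.
rewrite [RHS](big_ord_widen B.+1 (fun x => boxl k N (fun l => H (consf x l)))) ?ltnS //.
rewrite [RHS]big_mkcond; apply: eq_bigr => x _; case: ifP => // /negbT xN.
by apply: big1 => t _; apply: (H0 _ 1%N) => //=; lia.
Qed.

Definition muext k (lam m : nat -> nat) (i : nat) : nat :=
  if (0 < i <= k.-1)%N then m i else if i == k then (2 * lam k)%N else 0%N.

Lemma mu_of_muext k B (lam : nat -> nat) (s : {ffun 'I_k.-1 -> 'I_B.+1}) :
  mu_of lam s = muext k lam (lam_of s).
Proof.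
apply/funext => i; rewrite /mu_of /muext /lam_of; by case: ifP.
Qed.
End Stability.

Lemma box_sumE k B F n : box_sum k B F n
  = boxl k B (fun lam => boxl k.-1 B (fun m => F lam (muext k lam m) n)).
Proof.
apply: eq_bigr => t _; apply: eq_bigr => s _; by rewrite mu_of_muext.
Qed.

Lemma summand_expn k lin d lam mu : summand k lin d lam mu
  = X ^+ (lin lam mu + lam k ^ 2 + \sum_(1 <= i < k) (lam i ^ 2 + mu i ^ 2 - lam i * mu i))%N
    * (fps_mul (fps_inv (qpoch (lam 1%N)))
      (fps_prod [seq fps_mul (qbin (lam i) (lam i.+1))
                             (qbin (lam i - lam i.+1 + mu i.+1 + d i)%N (mu i))
                | i <- iota 1 k.-1]) : ps) :> ps.
Proof. by rewrite -monomE. Qed.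

Lemma quad_ge (x y : nat) : (x <= x ^ 2 + y ^ 2 - x * y)%N /\ (y <= x ^ 2 + y ^ 2 - x * y)%N.
Proof.
by split; case: (leqP x y) => xy; nia.
Qed.

(** Over the naturals x^2 + y^2 - x y dominates both x and y, and lambda_k^2 dominates lambda_k; so
    a large entry already pushes the monomial prefactor beyond degree N. *)
Lemma summand_small k lin d lam mu N :
  (exists2 i, (0 < i <= k)%N & (N < lam i)%N) \/ (exists2 i, (0 < i <= k.-1)%N & (N < mu i)%N) ->
  eqN N (summand k lin d lam mu) 0.
Proof.
move=> big; rewrite summand_expn; apply: eqN_Xn.
have sumge i : (0 < i <= k.-1)%N ->
    (lam i ^ 2 + mu i ^ 2 - lam i * mu i <= \sum_(1 <= j < k) (lam j ^ 2 + mu j ^ 2 - lam j * mu j))%N.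
  move=> ik; rewrite (big_rem i) ?leq_addr // mem_index_iota; lia.
case: big => [[i ik Nl]|[i ik Nm]].
  have [ie|ine] := eqVneq i k.
    have : (lam i <= lam k ^ 2)%N by rewrite ie; nia.
    by lia.
  have ik' : (0 < i <= k.-1)%N by lia.
  by have := sumge i ik'; have := (quad_ge (lam i) (mu i)).1; lia.
by have := sumge i ik; have := (quad_ge (lam i) (mu i)).2; lia.
Qed.

Lemma box_sum_stable k lin d N B m : (m <= N)%N -> (N <= B)%N ->
  box_sum k B (summand k lin d) m = box_sum k N (summand k lin d) m.
Proof.
move=> mN NB; rewrite !box_sumE.
rewrite (@boxl_stable _ k N B _ NB) => [|l i ik Nl].
  apply: eq_bigr => t _; apply: boxl_stable => // mm i ik Nm.
  rewrite (@summand_small _ _ _ _ _ N) //; right; exists i => //.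
  by rewrite /muext ik.
by apply: big1 => s _; rewrite (@summand_small _ _ _ _ _ N) //; left; exists i.
Qed.

Definition bsumps k B lin d : ps :=
  \sum_(t : {ffun 'I_k -> 'I_B.+1}) \sum_(s : {ffun 'I_k.-1 -> 'I_B.+1})
     (summand k lin d (lam_of t) (mu_of (lam_of t) s) : ps).

Lemma bsumpsE k B lin d n : bsumps k B lin d n = box_sum k B (summand k lin d) n.
Proof. by rewrite /bsumps ps_sum; apply: eq_bigr => t _; rewrite ps_sum. Qed.

(** * Locally finite sums of power series *)

Section SummableFamilies.

Lemma fsum_additive (I : choiceType) (V W : zmodType) (phi : {additive V -> W}) (f : I -> V) :
  finsupp f -> fsum (fun i => phi (f i)) = phi (fsum f).
Proof.
move=> /finsupp_uniq[r ur supp]; rewrite (fsumE r f) // (fsumE r) ?raddf_sum // => i.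
by apply: contra_neqT => /(contraNN (supp i)); rewrite negbK => /eqP ->; rewrite raddf0.
Qed.

(** Summed coefficient by coefficient, since an infinite family of series has sum 0 under [fsum]
    itself. *)
Definition psum (I : choiceType) (f : I -> ps) : ps := fun m => fsum (fun i => f i m).
Definition summable (I : choiceType) (f : I -> ps) := forall m, finsupp (fun i => f i m).

Lemma eqN_psum (I : choiceType) N (f g : I -> ps) :
  (forall i, eqN N (f i) (g i)) -> eqN N (psum f) (psum g).
Proof. by move=> fg m mN; apply: eq_fsum => i; apply: fg. Qed.

Lemma eq_psum (I : choiceType) (f g : I -> ps) : f =1 g -> psum f = psum g.
Proof. by move=> /funext ->. Qed.

Lemma reindex_psum (I J : choiceType) (h : J -> I) h' (f : I -> ps) :
  cancel h h' -> cancel h' h -> psum f = psum (fun j => f (h j)).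
Proof. by move=> hK h'K; apply/funext => m; apply: (reindex_fsum h h'). Qed.

Lemma summable_comp (I J : choiceType) (h : J -> I) h' (f : I -> ps) :
  cancel h h' -> summable f -> summable (fun j => f (h j)).
Proof. by move=> hK sf m; apply: (finsupp_comp hK (sf m)). Qed.

Lemma psumN (I : choiceType) (f : I -> ps) : summable f -> psum (fun i => - f i) = - psum f.
Proof. by move=> sf; apply/funext => m; apply: fsumN. Qed.

Lemma psumZ (I : choiceType) (c : ps) (f : I -> ps) : summable f ->
  summable (fun i => c * f i) /\ psum (fun i => c * f i) = c * psum f.
Proof.
move=> sf.
have key m : finsupp (fun i => (c * f i) m) /\ fsum (fun i => (c * f i) m) = (c * psum f) m.
  have fin (j : 'I_m.+1) : finsupp (fun i => c j * f i (m - j)%N).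
    by apply: finsuppW (sf (m - j)%N) => i ->; rewrite mulr0.
  have [fs es] := fsum_sum (index_enum 'I_m.+1) fin.
  split; first exact: fs.
  rewrite [LHS]es psM; apply: eq_bigr => j _.
  by rewrite /psum /fsum mulr_fsumr.
split; first by move=> m; case: (key m).
by apply/funext => m; case: (key m).
Qed.

Lemma pair_psum (I J : choiceType) (f : I * J -> ps) : summable f ->
  psum f = psum (fun i => psum (fun j => f (i, j))).
Proof. by move=> sf; apply/funext => m; apply: pair_fsum. Qed.

Lemma psumM (I J : choiceType) (f : I -> ps) (g : J -> ps) : summable f -> summable g ->
  summable (fun p : I * J => f p.1 * g p.2)
  /\ psum (fun p : I * J => f p.1 * g p.2) = psum f * psum g.
Proof.
move=> sf sg.
have sfg : summable (fun p : I * J => f p.1 * g p.2).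
  move=> m; have fin (j : 'I_m.+1) : finsupp (fun p : I * J => f p.1 j * g p.2 (m - j)%N).
    have [r fr] := sf j; have [s gs] := sg (m - j)%N.
    exists [seq (x, y) | x <- r, y <- s] => -[x y] /=; rewrite mulf_eq0 negb_or => /andP[fx gy].
    by apply: allpairs_f; [apply: fr | apply: gs].
  by have [fs _] := fsum_sum (index_enum 'I_m.+1) fin; exact: fs.
split=> //; rewrite pair_psum // mulrC -(psumZ (psum g) sf).2; apply: eq_psum => i /=.
by rewrite mulrC (psumZ (f i) sg).2.
Qed.

Lemma fsum_psum (I : choiceType) (f : I -> ps) : finsupp f -> fsum f = psum f.
Proof.
move=> ff; apply/funext => m.
pose ev (h : ps) : int := h m.
have evB : zmod_morphism ev by move=> x y; rewrite /ev.
pose eva := GRing.isZmodMorphism.Build _ _ ev evB.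
pose evm : {additive ps -> int} := HB.pack ev eva.
exact: (esym (fsum_additive evm ff)).
Qed.

Lemma summable_monom (I : choiceType) (c : I -> ps) (e : I -> nat) :
  (forall m, exists r : seq I, forall i, c i != 0 -> (e i <= m)%N -> i \in r) ->
  summable (fun i => c i * X ^+ e i).
Proof.
move=> fin m; have [r rP] := fin m; exists r => i; rewrite mulrC XnM.
case: leqP => [em|_ /eqP //] ci; apply: rP => //.
by apply: contra_neq ci => ->.
Qed.
End SummableFamilies.

(** * The signed theta series of A_2 and its finite approximations *)

Definition chiz (d : int) : int :=
  if (d %% 3)%Z == 1 then 1 else if (d %% 3)%Z == 2 then -1 else 0.

Lemma chi3_chiz (F : fieldType) d : chi3 F d = (chiz d)%:~R.
Proof. by rewrite /chi3 /chiz; case: eqP => // _; case: eqP => // _; rewrite rmorphN. Qed.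

Lemma chiz_chi3 d : chiz d != 0 -> chi3 Fr d != 0.
Proof.
rewrite chi3_chiz /chiz; case: ifP => _ c0; first by rewrite rmorph1 oner_eq0.
by case: ifP c0 => // _ _; rewrite rmorphN rmorph1 oppr_eq0 oner_eq0.
Qed.

(** With x = -l, y = k, al = a + 1, be = b + 1 and K = 3 n + 2, e is three times [lattice_exp].
    Where 1 + x is nonnegative, al is replaced by its least value 1; where it is negative, 3 al is
    replaced by its bound K + 1; likewise for be. The remaining multiple of K is that of a
    nonnegative integer and is bounded below by K >= 5. *)
Lemma lattice_form_bound (K al be x y : int) : 5 <= K -> 1 <= al -> 1 <= be ->
  3 * al <= K + 1 -> 3 * be <= K + 1 ->
  let e := K * (x * x + y * y - x * y - 1) + 3 * al * (1 + x) + 3 * be * (1 + y) in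
  x * x + y * y - x * y != 0 ->
  [/\ 0 <= e, `|x| <= e + 5 & `|y| <= e + 5].
Proof.
move=> K5 al1 be1 alK beK e Q0.
have Q1 : 1 <= x * x + y * y - x * y by nia.
have sq (z : int) : 0 <= z * z /\ z <= z * z by nia.
have [d0 _] := sq (x - y); have [_ x0] := sq x; have [_ y0] := sq y.
have [_ x1] := sq (- x); have [_ y1] := sq (- y).
have [u0 u1] := sq (1 + x); have [v0 v1] := sq (1 + y).
have [_ u2] := sq (- (1 + x)); have [_ v2] := sq (- (1 + y)).
pose P := x * x + y * y - x * y.
have eP : x * x + y * y <= 2 * P by rewrite /P; lia.
have mono (w : int) : 0 <= w -> 5 * w <= K * w by move=> w0; rewrite ler_wpM2r.
have half (s t : int) : - 1 <= s -> 0 <= s * s + t * t - s * t + t.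
  move=> s1; have [->|s2] := eqVneq s (- 1); first by have := (sq (1 + t)).1; lia.
  have [->|s3] := eqVneq s 0; first by have := (sq (- t)).2; lia.
  by have := (sq (2 * t - s + 1)).1; have := (sq s).2; lia.
suff : 0 <= e /\ `|x| <= e + 5 /\ `|y| <= e + 5 by case=> ? [].
have eE : e = K * (P - 1) + 3 * al * (1 + x) + 3 * be * (1 + y) by [].
have small (z : int) w : 0 <= z -> 1 <= w -> 3 * z <= 3 * w * z.
  by move=> z0 w1; rewrite ler_wpM2r //; lia.
have large (z : int) w : z <= 0 -> 3 * w <= K + 1 -> (K + 1) * z <= 3 * w * z.
  by move=> z0 w1; rewrite ler_wnM2r.
case: (lerP 0 (1 + x)) => ax; case: (lerP 0 (1 + y)) => ay.
- have p0 : 0 <= P - 1 by lia.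
  have := mono _ p0; have := small _ _ ax al1; have := small _ _ ay be1; rewrite /P in eE eP *; lia.
- have p0 : 0 <= P - 1 + (1 + y) by have := half x y; rewrite /P; lia.
  have : (1 + x) * (1 + y) <= 0 by rewrite mulr_ge0_le0 // ltW.
  have := mono _ p0; have := small _ _ ax al1; have := large _ _ (ltW ay) beK; rewrite /P in eE eP *; lia.
- have p0 : 0 <= P - 1 + (1 + x) by have := half y x; rewrite /P; lia.
  have : (1 + x) * (1 + y) <= 0 by rewrite mulr_le0_ge0 // ltW.
  have := mono _ p0; have := small _ _ ay be1; have := large _ _ (ltW ax) alK; rewrite /P in eE eP *; lia.
have p0 : 0 <= P - 1 + (1 + y) + (1 + x) by rewrite /P; lia.
have := mono _ p0; have := large _ _ (ltW ax) alK; have := large _ _ (ltW ay) beK; rewrite /P in eE eP *; lia.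
Qed.

Lemma lattice_exp_bound (n a b : nat) p : (0 < n)%N -> (a <= n)%N -> (b <= n)%N ->
  chiz (p.1 - p.2) != 0 ->
  [/\ 0 <= lattice_exp n a b p, `|p.1| <= 3 * lattice_exp n a b p + 5
    & `|p.2| <= 3 * lattice_exp n a b p + 5].
Proof.
move=> n0 an bn chi0.
have hg := chi3_third_norm frq0 (chiz_chi3 chi0).
have /= := @lattice_form_bound (3 * n%:Z + 2) (a%:Z + 1) (b%:Z + 1) (- p.2) p.1.
have -> : - p.2 * - p.2 + p.1 * p.1 - - p.2 * p.1 = half_norm p by rewrite /half_norm; ring.
rewrite hg.
have -> : (3 * n%:Z + 2) * (3 * third_norm p) + 3 * (a%:Z + 1) * (1 - p.2) + 3 * (b%:Z + 1) * (1 + p.1)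
   = 3 * lattice_exp n a b p by rewrite /lattice_exp; ring.
case; [lia|lia|lia|lia|lia| |by move=> *; split; lia].
by apply/eqP => h0; move: hg; rewrite h0; lia.
Qed.

Definition lattice_term n a b p : ps :=
  (chiz (p.1 - p.2))%:~R * X ^+ `|lattice_exp n a b p|%N.
Definition lattice_series n a b : ps := psum (lattice_term n a b).

Lemma chiz_neq0 d : ((chiz d)%:~R : ps) != 0 -> chiz d != 0.
Proof. by apply: contra_neq => ->. Qed.

Lemma summable_lattice n a b : (0 < n)%N -> (a <= n)%N -> (b <= n)%N ->
  summable (lattice_term n a b).
Proof.
move=> n0 an bn; apply: summable_monom => m.
pose s := [seq Posz i - Posz (3 * m + 5) | i <- iota 0 (6 * m + 11)].
exists [seq (x, y) | x <- s, y <- s] => -[k l] /chiz_neq0 c0 em.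
have [E0 kE lE] := lattice_exp_bound n0 an bn c0.
have mems (x : int) : `|x| <= 3 * lattice_exp n a b (k, l) + 5 -> x \in s.
  move=> xE; apply/mapP; exists (absz (x + Posz (3 * m + 5))); last lia.
  by rewrite mem_iota; lia.
by apply: allpairs_f; exact: mems.
Qed.

Lemma tofrac_lattice n a b p : (0 < n)%N -> (a <= n)%N -> (b <= n)%N ->
  (lattice_term n a b p)%:F = chi3 Fr (p.1 - p.2) * frq ^ lattice_exp n a b p.
Proof.
move=> n0 an bn; rewrite rmorphM rmorph_int rmorphXn chi3_chiz -/frq.
have [->|/(lattice_exp_bound n0 an bn)[E0 _ _]] := eqVneq (chiz (p.1 - p.2)) 0; first by rewrite !mul0r.
by rewrite -[in RHS](gez0_abs E0).
Qed.

Definition zps (z : int) : ps := if z is Posz m then ppoch 1 m else 0.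
Definition kps (a1 a2 a3 A B : int) : ps :=
  zps (A + B) * (pinv 1 (A - a1) * pinv 1 (A - a2) * pinv 1 (A - a3))
    * (pinv 1 (B + a1) * pinv 1 (B + a2) * pinv 1 (B + a3)).

Lemma tofrac_kps a1 a2 a3 A B : (kps a1 a2 a3 A B)%:F = kern frq a1 a2 a3 A B.
Proof.
rewrite /kps !rmorphM /= !tofrac_pinv // expr1; congr (_ * _ * _).
by rewrite /zps /zpoch; case: (A + B) => m; rewrite ?tofrac_ppoch ?expr1 ?rmorph0.
Qed.

(** One factor (q)_(A+B) stands against six reciprocals, so the kernel tends to (q)_oo^(-5). *)
Lemma kps_eqN N (a1 a2 a3 A B : int) : 2 * N%:Z + `|a1| < A -> 2 * N%:Z + `|a2| < A -> 2 * N%:Z + `|a3| < A ->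
  2 * N%:Z + `|a1| < B -> 2 * N%:Z + `|a2| < B -> 2 * N%:Z + `|a3| < B ->
  eqN N (kps a1 a2 a3 A B) (iq ^+ 5).
Proof.
move=> A1 A2 A3 B1 B2 B3.
have -> : iq ^+ 5 = (pinf 1 1 : ps) * (iq * iq * iq) * (iq * iq * iq).
  by rewrite -!mulrA mulVKr ?pinf_unit // !exprS expr0 mulr1.
have h (z : int) : N%:Z < z -> eqN N (pinv 1 z) iq by exact: pinv_eqN.
apply: eqNM; last by do !apply: eqNM; apply: h; lia.
apply: eqNM; last by do !apply: eqNM; apply: h; lia.
case e : (A + B) => [m|m]; last lia.
by apply: ppoch_eqN => //; lia.
Qed.

(** Terms of exponent at most N have |k|, |l| <= 3 N + 5, hence vector entries at most 6 N + 11 in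
    absolute value; [kps_eqN] asks for a margin of 2 N beyond these, which gives 8 N + 12. *)
Lemma lattice_limit n a b (h1 h2 h3 : int * int -> int) (A B : int) N :
  (0 < n)%N -> (a <= n)%N -> (b <= n)%N ->
  (forall p, [/\ `|h1 p| <= `|p.1| + `|p.2| + 1, `|h2 p| <= `|p.1| + `|p.2| + 1
              & `|h3 p| <= `|p.1| + `|p.2| + 1]) ->
  8 * N%:Z + 12 <= A -> 8 * N%:Z + 12 <= B ->
  finsupp (fun p => chi3 Fr (p.1 - p.2) * frq ^ lattice_exp n a b p
                    * kern frq (h1 p) (h2 p) (h3 p) A B) ->
  exists2 f : ps, f%:F = fsum (fun p => chi3 Fr (p.1 - p.2) * frq ^ lattice_exp n a b p
                    * kern frq (h1 p) (h2 p) (h3 p) A B)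
    & eqN N f (lattice_series n a b * iq ^+ 5).
Proof.
move=> n0 an bn hb AN BN.
pose f p := lattice_term n a b p * kps (h1 p) (h2 p) (h3 p) A B.
have e : (fun p => chi3 Fr (p.1 - p.2) * frq ^ lattice_exp n a b p * kern frq (h1 p) (h2 p) (h3 p) A B)
     = (fun p => (f p)%:F).
  by apply/funext => p; rewrite -tofrac_lattice // -tofrac_kps -rmorphM.
rewrite e => -[r rP]; have ff : finsupp f.
  by exists r => p fp; apply: rP; rewrite tofrac_eq0.
exists (fsum f); first by rewrite (fsum_additive (@tofrac ps)).
rewrite fsum_psum // mulrC -(psumZ _ (summable_lattice n0 an bn)).2.
apply: eqN_psum => p; rewrite [X in eqN _ _ X]mulrC /f /lattice_term.
have [->|/(lattice_exp_bound n0 an bn)[E0 pE1 pE2]] := eqVneq (chiz (p.1 - p.2)) 0.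
  by rewrite mulr0z !mul0r.
rewrite [_%:~R * _]mulrC; have [EN|EN] := leP (lattice_exp n a b p) N%:Z; last first.
  have {}EN : (N < `|lattice_exp n a b p|)%N by lia.
  rewrite -!mulrA.
  by apply: eqN_trans (eqN_Xn _ EN) (eqN_sym (eqN_Xn _ EN)).
have [H1 H2 H3] := hb p.
apply: eqNM; first by [].
move: (lattice_exp n a b p) (h1 p) (h2 p) (h3 p) (p.1 : int) (p.2 : int) EN pE1 pE2 H1 H2 H3.
by move=> *; apply: kps_eqN; lia.
Qed.

Definition box_limit k lin d : ps := fun m => box_sum k m (summand k lin d) m.

Lemma box_limit_sums k lin d : fps_sums_to k (summand k lin d) (box_limit k lin d).
Proof. by move=> m; exists m => B mB; apply: box_sum_stable. Qed.

Lemma bsumps_eqN k lin d N B : (N <= B)%N -> eqN N (bsumps k B lin d) (box_limit k lin d).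
Proof.
move=> NB m mN; rewrite bsumpsE /box_limit (@box_sum_stable _ _ _ m) //.
exact: leq_trans NB.
Qed.

Definition lin_form n c (ea eb lam mu : nat -> nat) : nat :=
  c + (\sum_(1 <= i < n.+1) (ea i * lam i + eb i * mu i) + ea n.+1 * lam n.+1).

Lemma chain_series n c lin d ea eb N L :
  (forall lam mu, lin lam mu = lin_form n c ea eb lam mu) ->
  (forall i, d i.+1 = (eb i.+2 - eb i.+1)%N) ->
  (forall i, (eb i <= 1)%N) -> (forall i, (eb i <= eb i.+1)%N) -> (2 * N + 1 <= L)%N ->
  exists2 f : ps, f%:F = frq ^+ c * chain frq n.+1 ea eb L L
    & eqN N f (box_limit n.+1 lin d * iq ^+ 3).
Proof.
move=> linE dE eb1 ebm NL; pose B := (3 * L + n.+2)%N.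
pose Phi (r m : nat) : ps := pinv 1 (L%:Z - r%:Z) * (pinv 1 L%:Z * pinv 1 (L%:Z + (m%:Z - r%:Z + (eb 1%N)%:Z))).
pose S (t : {ffun 'I_n.+1 -> 'I_B.+1}) (s : {ffun 'I_n -> 'I_B.+1}) : ps :=
  summand n.+1 lin d (lam_of t) (@mu_of n.+1 B (lam_of t) s).
exists (\sum_t \sum_s S t s * Phi (lam_of t 1) (@mu_of n.+1 B (lam_of t) s 1)).
  have PhiE r m : (Phi r m)%:F = ipoch frq (L%:Z - r%:Z) * ukern frq (m%:Z - r%:Z + (eb 1%N)%:Z) L.
    by rewrite /Phi /ukern -[frq]expr1 -!tofrac_pinv // -!rmorphM.
  rewrite (chain_weight frq0 frqn1 ea L (B := B)) //.
  have -> : \sum_(r < L.+1) \sum_(m < B.+1) ipoch frq (L%:Z - r%:Z) * weight frq B n.+1 ea eb r m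
        * ukern frq (m%:Z - r%:Z + (eb 1%N)%:Z) L
      = \sum_(r < B.+1) \sum_(m < B.+1) weight frq B n.+1 ea eb r m * (Phi r m)%:F.
    have LB : (L.+1 <= B.+1)%N by rewrite /B; lia.
    rewrite (big_ord_widen _ (fun r => \sum_(m < B.+1) ipoch frq (L%:Z - r%:Z) * weight frq B n.+1 ea eb r m
        * ukern frq (m%:Z - r%:Z + (eb 1%N)%:Z) L) LB) big_mkcond.
    apply: eq_bigr => r _; rewrite ltnS; case: leqP => rL.
      by apply: eq_bigr => m _; rewrite PhiE mulrA [_ * weight _ _ _ _ _ _ _]mulrC.
    rewrite big1 // => m _; rewrite PhiE; have : L%:Z - r%:Z < 0 by lia.
    by case: (L%:Z - r%:Z) => // z _; rewrite mul0r mulr0.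
  rewrite (@weight_box _ _ frq0 _ _ _ _ (fun r m => (Phi r m)%:F)) => [|r m]; last first.
    rewrite PhiE mulf_eq0 negb_or => /andP[]; case e : (L%:Z - r%:Z) => [z|z]; rewrite ?eqxx // => _ _.
    by rewrite /B; lia.
  rewrite rmorph_sum mulr_sumr; apply: eq_bigr => t _.
  rewrite rmorph_sum mulr_sumr; apply: eq_bigr => s _.
  rewrite rmorphM mulrA; congr (_ * _).
  by rewrite [LHS](tofrac_summand (linE _ _) dE).
have NB : (N <= B)%N by rewrite /B; lia.
apply: (@eqN_trans N _ (bsumps n.+1 B lin d * iq ^+ 3)); last by apply: eqNM => //; exact: bsumps_eqN.
rewrite /bsumps mulr_suml; apply: eqN_sum => t _; rewrite mulr_suml; apply: eqN_sum => s _.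
have [lamN|lamN] := leqP (lam_of t 1) N; last first.
  have S0 : eqN N (S t s) 0.
    by apply: summand_small; left; exists 1%N.
  apply: (@eqN_trans N _ 0); last apply: eqN_sym; rewrite -[0](mul0r (iq ^+ 3)).
    by rewrite mul0r -(mul0r (Phi (lam_of t 1) (@mu_of n.+1 B (lam_of t) s 1))); apply: eqNM.
  by apply: eqNM.
apply: eqNM => //; rewrite !exprS expr0 mulr1.
have h (z : int) : N%:Z < z -> eqN N (pinv 1 z) iq by exact: pinv_eqN.
by apply: eqNM; [|apply: eqNM]; apply: h; lia.
Qed.

(** The chain contributes (q)_oo^(-3) and the kernel (q)_oo^(-5); the quotient is the denominator
    (q;q)_oo^2 of tilde chi. *)
Lemma limit_eq (S T : ps) :
  (forall N, exists2 f, eqN N f (S * iq ^+ 3) & eqN N f (T * iq ^+ 5)) -> S = T * iq ^+ 2.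
Proof.
move=> ST; have iqu : iq ^+ 3 \is a GRing.unit by rewrite unitrX ?unitrV ?pinf_unit.
apply: (mulIr iqu); rewrite -mulrA -exprD; apply: eqN_eq => N.
by have [f fS fT] := ST N; exact: eqN_trans (eqN_sym fS) fT.
Qed.

Lemma sum_ind a m (f : nat -> nat) :
  (\sum_(1 <= i < m) ind a i * f i = \sum_(a.+1 <= i < m) f i)%N.
Proof.
have [am|ma] := leqP a.+1 m; last first.
  rewrite [RHS]big_geq; last lia.
  apply: big1_seq => i /andP[_]; rewrite mem_index_iota /ind => im; rewrite (_ : (a < i)%N = false) //; lia.
rewrite (big_cat_nat (n := a.+1)) //= big1_seq ?add0n => [|i /andP[_]]; last first.
  by rewrite mem_index_iota /ind => im; rewrite (_ : (a < i)%N = false) //; lia.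
by apply: eq_big_seq => i; rewrite mem_index_iota /ind => /andP[-> _]; rewrite mul1n.
Qed.

Lemma lin_form_ind n c a b lam mu : lin_form n c (ind a) (ind b) lam mu
  = (c + \sum_(a.+1 <= i < n.+2) lam i + \sum_(b.+1 <= i < n.+1) mu i)%N.
Proof.
rewrite /lin_form big_split /= -(sum_ind a) -(sum_ind b) [in RHS](big_nat_recr n.+1) //=; ring.
Qed.

Lemma ind_le1 a i : (ind a i <= 1)%N. Proof. exact: leq_b1. Qed.
Lemma ind_mono a i : (ind a i <= ind a i.+1)%N.
Proof. by rewrite /ind; case: (ltnP a i) => // h; rewrite (ltn_trans h). Qed.
Lemma ind_step b i : nat_of_bool (b == i.+1) = (ind b i.+2 - ind b i.+1)%N.
Proof. rewrite /ind; lia. Qed.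

Lemma G00_limit n a b N L : (0 < n)%N -> (a <= n)%N -> (b <= n)%N -> (8 * N + 12 <= L)%N ->
  exists2 f : ps, f%:F = G00 frq (fun p => frq ^ lattice_exp n a b p) L L
    & eqN N f (lattice_series n a b * iq ^+ 5).
Proof.
move=> n0 an bn NL.
apply: (@lattice_limit n a b (fun p => p.1 + 1) (fun p => - p.1 - p.2) (fun p => p.2 - 1)
  (L%:Z + 0) (L%:Z + 0) N n0 an bn) => [[k l] /=|||].
- by move: (k : int) (l : int) => x y; split; lia.
- lia.
- lia.
exact: (finsupp_K00 frq0 (fun p => chi3 Fr (p.1 - p.2) * frq ^ lattice_exp n a b p)).
Qed.

Lemma G01_limit n a b N L : (0 < n)%N -> (a <= n)%N -> (b <= n)%N -> (8 * N + 12 <= L)%N ->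
  exists2 f : ps, f%:F = G01 frq (fun p => frq ^ lattice_exp n a b p) L L
    & eqN N f (lattice_series n a b * iq ^+ 5).
Proof.
move=> n0 an bn NL.
apply: (@lattice_limit n a b (fun p => p.1) (fun p => - p.1 - p.2) (fun p => p.2 - 1)
  (L%:Z + 0) (L%:Z + 1) N n0 an bn) => [[k l] /=|||].
- by move: (k : int) (l : int) => x y; split; lia.
- lia.
- lia.
exact: (finsupp_K01 frq0 (fun p => chi3 Fr (p.1 - p.2) * frq ^ lattice_exp n a b p)).
Qed.

Definition lin1 k a b (lam mu : nat -> nat) : nat :=
  \sum_(a.+1 <= i < k.+1) lam i + \sum_(b.+1 <= i < k) mu i.
Definition lin2 k a b (lam mu : nat -> nat) : nat :=
  1 + \sum_(a <= i < k.+1) lam i + \sum_(b <= i < k) mu i.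

Lemma chain_series1 n a b N L : (2 * N + 1 <= L)%N ->
  exists2 f : ps, f%:F = chain frq n.+1 (ind a) (ind b) L L
    & eqN N f (box_limit n.+1 (lin1 n.+1 a b) (fun i => nat_of_bool (b == i)) * iq ^+ 3).
Proof.
move=> NL; rewrite -[chain _ _ _ _ _ _]mul1r -[1]/(frq ^+ 0).
apply: chain_series => //; [|exact: ind_step|exact: ind_le1|exact: ind_mono].
by move=> lam mu; rewrite lin_form_ind.
Qed.

Lemma chain_series2 n a b N L : (0 < a)%N -> (0 < b)%N -> (2 * N + 1 <= L)%N ->
  exists2 f : ps, f%:F = frq * chain frq n.+1 (ind a.-1) (ind b.-1) L L
    & eqN N f (box_limit n.+1 (lin2 n.+1 a b) (fun i => nat_of_bool (b == i.+1)) * iq ^+ 3).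
Proof.
case: a b => // a [|b] // _ _ NL; rewrite -[X in X * _]expr1.
apply: chain_series => //; [|exact: ind_step|exact: ind_le1|exact: ind_mono].
by move=> lam mu; rewrite lin_form_ind.
Qed.

Lemma series_interior n a b : (0 < a)%N -> (0 < b)%N -> (a <= n.+1)%N -> (b < n.+1)%N ->
  (box_limit n.+1 (lin1 n.+1 a b) (fun i => nat_of_bool (b == i))
   - box_limit n.+1 (lin2 n.+1 a b) (fun i => nat_of_bool (b == i.+1)) : ps)
  = lattice_series n.+1 (maxn a b) (minn a b) * iq ^+ 2.
Proof.
move=> a0 b0 an bn; apply: limit_eq => N; pose L := (8 * N + 12)%N.
have [|f1 e1 N1] := @chain_series1 n a b N L; first by rewrite /L; lia.
have [|f2 e2 N2] := @chain_series2 n a b N L a0 b0; first by rewrite /L; lia.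
have [|||f e Nf] := @G00_limit n.+1 (maxn a b) (minn a b) N L isT; [lia|lia|by []|].
exists f => //; have -> : f = f1 - f2.
  apply/eqP; rewrite -tofrac_eq rmorphB /= e1 e2 e; apply/eqP.
  exact: (esym (chain_interior frq0 frqn1 fr_nat_neq0 _ _ _ _ _)).
by rewrite mulrBl; apply: eqND => // m mN; rewrite !psN N2.
Qed.

Lemma series_edge n a b : (a * b = 0)%N -> (a <= n.+1)%N -> (b < n.+1)%N ->
  box_limit n.+1 (lin1 n.+1 a b) (fun i => nat_of_bool (b == i))
  = lattice_series n.+1 (maxn a b) (minn a b) * iq ^+ 2.
Proof.
move=> ab0 an bn; apply: limit_eq => N; pose L := (8 * N + 12)%N.
have [|f1 e1 N1] := @chain_series1 n a b N L; first by rewrite /L; lia.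
have [|||f e Nf] := @G01_limit n.+1 (maxn a b) (minn a b) N L isT; [lia|lia|by []|].
exists f => //; have -> // : f = f1.
by apply/eqP; rewrite -tofrac_eq e e1 -(chain_edge frq0 frqn1 fr_nat_neq0).
Qed.

Lemma series_diag n : box_limit n.+1 (fun _ _ => 0%N) (fun _ => 0%N)
  = lattice_series n.+1 n.+1 n.+1 * iq ^+ 2.
Proof.
apply: limit_eq => N; pose L := (8 * N + 12)%N.
have [|||||f1 e1 N1] := @chain_series n 0 (fun _ _ => 0%N) (fun _ => 0%N) (fun _ => 0%N) (fun _ => 0%N) N L => //.
- by move=> lam mu; rewrite /lin_form big1.
- by rewrite /L; lia.
have [|||f e Nf] := @G00_limit n.+1 n.+1 n.+1 N L isT => //.
exists f => //; have -> // : f = f1.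
by apply/eqP; rewrite -tofrac_eq e e1 mul1r -(chain_diag frq0 frqn1 fr_nat_neq0).
Qed.

(** * Theta series *)

Lemma sign_parity (u v : nat) : odd u = odd v -> (-1) ^+ u = (-1) ^+ v :> ps.
Proof. by move=> e; rewrite -[LHS]signr_odd e signr_odd. Qed.

Definition theta_exp (K al : nat) (m : int) : int := K%:Z * binz m + al%:Z * m.
Definition theta_mono (K al : nat) (m : int) : ps := (-1) ^+ `|m|%N * X ^+ `|theta_exp K al m|%N.
Definition theta_series (K al : nat) : ps := psum (theta_mono K al).

Lemma theta_exp_ge K al m : (0 < al < K)%N -> `|m| <= theta_exp K al m.
Proof.
case/andP=> al0 alK; rewrite /theta_exp; have := binzE m.
case: (lerP 0 m) => m0 e.
  have b0 : 0 <= binz m by nia.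
  have : m <= al%:Z * m by rewrite ler_peMl.
  have : 0 <= K%:Z * binz m by rewrite mulr_ge0.
  lia.
have b0 : 0 <= binz m + m by nia.
have : 0 <= K%:Z * (binz m + m) by rewrite mulr_ge0.
have : 0 <= (K%:Z - al%:Z - 1) * - m by rewrite mulr_ge0; lia.
lia.
Qed.

Lemma summable_theta K al : (0 < al < K)%N -> summable (theta_mono K al).
Proof.
move=> alK; apply: summable_monom => m.
exists [seq Posz i - Posz m | i <- iota 0 (2 * m).+1] => i _ ei.
have := theta_exp_ge i alK => ge.
apply/mapP; exists (absz (i + m%:Z)); last lia.
by rewrite mem_iota; lia.
Qed.

Lemma tofrac_theta K al m : (0 < al < K)%N ->
  (theta_mono K al m)%:F = theta_coef (frq ^+ K) (frq ^+ al) m.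
Proof.
move=> alK; have E0 : 0 <= theta_exp K al m := le_trans (normr_ge0 _) (theta_exp_ge m alK).
rewrite /theta_mono rmorphM /= !rmorphXn /= rmorphN rmorph1 -/frq /theta_coef.
rewrite -[frq ^+ `|_|]/(frq ^ (absz (theta_exp K al m))%:Z) gez0_abs // /theta_exp.
rewrite expfzDr ?frq0 // -!exprz_exp -[- (frq ^+ al)]mulN1r expfzMl.
have -> : (-1) ^+ `|m|%N = (-1) ^ m :> Fr.
  by case: (m) => // l; rewrite -[RHS]/(((-1) ^+ l.+1)^-1) -exprVn invrN1.
by rewrite mulrA mulrAC.
Qed.

Lemma tofrac_pprod e d n : (pprod e d n)%:F = \prod_(j < n) (1 - frq ^+ e * (frq ^+ d) ^+ j).
Proof.
rewrite /pprod rmorph_prod; apply: eq_bigr => j _.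
by rewrite rmorphB rmorph1 rmorphXn /= -/frq exprD exprM.
Qed.

Lemma finite_jacobi_ps K al n : (0 < al < K)%N ->
  let f m : ps := ppoch K (n + n) * (theta_mono K al m * (pinv K (n%:Z - m) * pinv K (n%:Z + m))) in
  finsupp f /\ fsum f = pprod al K n * pprod (K - al) K n.
Proof.
move=> alK f; have K0 : (0 < K)%N by lia.
have QK0 : frq ^+ K != 0 by rewrite expf_neq0 ?frq0.
have x0 : frq ^+ al != 0 by rewrite expf_neq0 ?frq0.
have QKn i : (frq ^+ K) ^+ i.+1 != 1 by rewrite -exprM -(@prednK (K * i.+1)) ?muln_gt0 ?K0 ?frqn1.
have fE m : (f m)%:F = poch (frq ^+ K) (n + n) * theta_term (frq ^+ K) (frq ^+ al) n n m.
  by rewrite /theta_term -tofrac_theta // -!tofrac_pinv // -tofrac_ppoch -!rmorphM.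
have ff : finsupp f.
  have [r rP] := finsupp_theta QK0 x0 n n.
  exists r => m; rewrite -tofrac_eq0 fE mulf_eq0 negb_or => /andP[_]; exact: rP.
split=> //; apply/eqP; rewrite -tofrac_eq -(fsum_additive (@tofrac ps)) // (eq_fsum fE).
rewrite /fsum -mulr_fsumr (finite_jacobi QK0 QKn x0) rmorphM /= !tofrac_pprod; apply/eqP.
congr (_ * _); apply: eq_bigr => j _; congr (1 - _).
apply: (mulIf x0); rewrite mulfVK // -exprM exprS mulrAC -exprD subnK; last lia.
by rewrite -exprM -exprD -mulnS.
Qed.

Lemma jacobi_triple K al : (0 < al < K)%N ->
  theta_series K al = pinfp K K * (pinfp al K * pinfp (K - al) K).
Proof.
move=> alK; have K0 : (0 < K)%N by lia.
set iK := (pinfp K K)^-1.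
suff -> : pinfp al K * pinfp (K - al) K = iK * theta_series K al by rewrite mulVKr // pinf_unit.
(* Terms of exponent at most N have |m| <= N, so this n makes both n - m and n + m exceed N. *)
apply: eqN_eq => N; pose n := (2 * N + 1)%N.
have [ff fE] := finite_jacobi_ps n alK.
apply: (@eqN_trans N _ (pprod al K n * pprod (K - al) K n)).
  by apply: eqNM; apply: pinf_eqN; rewrite /n; lia.
rewrite -fE fsum_psum // -(psumZ iK (summable_theta alK)).2.
apply: eqN_psum => m.
have [mN|mN] := lerP (theta_exp K al m) N%:Z; last first.
  have {}mN : (N < `|theta_exp K al m|)%N by lia.
  rewrite /theta_mono [(-1) ^+ _ * _]mulrC -!mulrA [ppoch _ _ * _]mulrC [iK * _]mulrC -!mulrA.
  by apply: eqN_trans (eqN_Xn _ mN) (eqN_sym (eqN_Xn _ mN)).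
have me := theta_exp_ge m alK.
rewrite mulrCA [iK * _]mulrC; apply: eqNM => //.
(* Matches the shape of (Q)_(2n) / ((Q)_(n-m) (Q)_(n+m)) with Q = q^K: one numerator, two
   denominators. *)
have -> : iK = pinfp K K * (iK * iK) by rewrite mulVKr // pinf_unit.
apply: eqNM; first by apply: ppoch_eqN => //; rewrite /n; lia.
by apply: eqNM; apply: pinv_eqN => //; rewrite /n; lia.
Qed.

Lemma pprod_split K n : pprod K K (3 * n)
  = pprod (3 * K) (3 * K) n * (pprod (2 * K) (3 * K) n * pprod K (3 * K) n).
Proof.
elim: n => [|n IHn]; first by rewrite /pprod !big_ord0 !mulr1.
rewrite (_ : (3 * n.+1 = (3 * n).+3)%N); last lia.
move: IHn; rewrite /pprod !big_ord_recr /= => ->.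
have -> : (K + K * (3 * n) = K + 3 * K * n)%N by lia.
have -> : (K + K * (3 * n).+1 = 2 * K + 3 * K * n)%N by lia.
have -> : (K + K * (3 * n).+2 = 3 * K + 3 * K * n)%N by lia.
ring.
Qed.

(** The triple product of modulus 3 K at 2 K has its factors in the classes K, 2 K and 3 K mod 3 K,
    which together are all multiples of K. *)
Lemma pentagonal K : (0 < K)%N -> theta_series (3 * K) (2 * K) = pinfp K K.
Proof.
move=> K0; rewrite jacobi_triple; last lia.
have -> : (3 * K - 2 * K = K)%N by lia.
apply: eqN_eq => N.
apply: (@eqN_trans N _ (pprod K K (3 * N.+1))); last by apply: eqN_sym; apply: pinf_eqN => //; lia.
by rewrite pprod_split; apply: eqNM; [|apply: eqNM]; apply: pinf_eqN; lia.
Qed.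

Lemma ps_double0 (f : ps) : f = - f -> f = 0.
Proof.
move=> e; apply/funext => m; have := congr1 (fun g : ps => g m) e; rewrite psN ps0.
by move: (f m) => z; lia.
Qed.

(** * The product formula for the lattice series *)

Section Macdonald.
Variables (n a b : nat).
Hypotheses (n0 : (0 < n)%N) (an : (a <= n)%N) (bn : (b <= n)%N).
Local Notation K := (3 * n + 2)%N.

Definition triple_exp (A B l : int) : int :=
  theta_exp K a.+1 (A - l) + theta_exp K b.+1 (B - l) + theta_exp K (a + b + 2) l.

(** The third theta parameter is the sum of the other two, so the linear terms in l cancel and only
    the quadratic part depends on l. *)
Lemma triple_expE A B l : triple_exp A B l = a.+1%:Z * A + b.+1%:Z * B
   + K%:Z * (binz (A - l) + binz (B - l) + binz l).
Proof. rewrite /triple_exp /theta_exp; lia. Qed.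

Lemma triple_exp_sym (A B l t : int) : A + B = 3 * t + 2 -> triple_exp A B (2 * t + 1 - l) = triple_exp A B l.
Proof.
move=> s3; rewrite !triple_expE; congr (_ + _ * _).
have := binzE (A - (2 * t + 1 - l)); have := binzE (B - (2 * t + 1 - l)); have := binzE (2 * t + 1 - l).
have := binzE (A - l); have := binzE (B - l); have := binzE l.
have -> : B = 3 * t + 2 - A by [lia].
lia.
Qed.

Definition triple_mono (A B l : int) : ps :=
  theta_mono K a.+1 (A - l) * theta_mono K b.+1 (B - l) * theta_mono K (a + b + 2) l.

Lemma triple_monoE A B (l : int) : `|l| <= triple_exp A B l
   /\ triple_mono A B l = (-1) ^+ (`|A - l| + `|B - l| + `|l|)%N * X ^+ `|triple_exp A B l|%N.
Proof.
have ga : (0 < a.+1 < K)%N by lia.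
have gb : (0 < b.+1 < K)%N by lia.
have gc : (0 < a + b + 2 < K)%N by lia.
have ea := theta_exp_ge (A - l) ga; have eb := theta_exp_ge (B - l) gb.
have ec := theta_exp_ge l gc.
rewrite /triple_mono /triple_exp /theta_mono.
move: (theta_exp K a.+1 _) ea (theta_exp K b.+1 _) eb (theta_exp K _ _) ec => x hx y hy z hz.
split; first lia.
have -> : absz (x + y + z) = (absz x + absz y + absz z)%N by lia.
rewrite !exprD; move: ((-1) ^+ `|A - l|) ((-1) ^+ `|B - l|) ((-1) ^+ `|l|) => u v w.
ring.
Qed.

Lemma summable_triple A B : summable (triple_mono A B).
Proof.
have -> : triple_mono A B = fun l => (-1) ^+ (`|A - l| + `|B - l| + `|l|)%N * X ^+ `|triple_exp A B l|%N.
  by apply/funext => l; exact: (triple_monoE A B l).2.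
apply: summable_monom => m.
exists [seq Posz i - Posz m | i <- iota 0 (2 * m).+1] => i _ ei.
have [ge _] := triple_monoE A B i.
apply/mapP; exists (absz (i + m%:Z)); last lia.
by rewrite mem_iota; lia.
Qed.

(* Put s = A + B.  For s = 3 t the substitution l = t + m, and for s = 3 t + 1 the substitution
   l = t - m, gives Euler's pentagonal series; for s = 3 t + 2 the reflection l -> 2 t + 1 - l
   reverses signs. *)
Lemma inner_sum A B : psum (triple_mono A B) = pinfp K K * lattice_term n a b (B - 1, 1 - A).
Proof.
have K0 : (0 < K)%N by lia.
have K2 : (0 < 2 * K < 3 * K)%N by lia.
have sumP (e : int) (sg : nat) : 0 <= e ->
  psum (fun m => (-1) ^+ (sg + `|m|) * X ^+ absz (e + theta_exp (3 * K) (2 * K) m))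
    = pinfp K K * ((-1) ^+ sg * X ^+ `|e|%N).
  move=> e0; rewrite mulrC -pentagonal // -(psumZ _ (summable_theta K2)).2.
  apply: eq_psum => m; have := theta_exp_ge m K2.
  rewrite /theta_mono; move: (theta_exp _ _ _) => x hx.
  have -> : absz (e + x) = (absz e + absz x)%N by lia.
   rewrite !exprD; ring.
(* At this lattice point k - l = A + B - 2, so the character sees exactly the residue of A + B mod
   3. *)
pose p : int * int := (B - 1, 1 - A).
have hgg : chiz (p.1 - p.2) != 0 -> A * A + B * B - A * B - A - B = 3 * third_norm p
    /\ lattice_exp n a b p = a.+1%:Z * A + b.+1%:Z * B + K%:Z * third_norm p /\ 0 <= lattice_exp n a b p.
  move=> c0; have [E0 _ _] := lattice_exp_bound n0 an bn c0.
  have := chi3_third_norm frq0 (chiz_chi3 c0).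
  rewrite /lattice_exp /half_norm /= => h; split; last split=> //; lia.
have [t s3] : exists t : int, [\/ A + B = 3 * t, A + B = 3 * t + 1 | A + B = 3 * t + 2].
  exists ((A + B) %/ 3)%Z; case: (eqVneq ((A + B) %% 3)%Z 0) => e; first by constructor 1; lia.
  by case: (eqVneq ((A + B) %% 3)%Z 1) => e'; [constructor 2|constructor 3]; lia.
rewrite /lattice_term -/p; case: s3 => s3.
- have chi1 : chiz (p.1 - p.2) = 1.
    by rewrite /chiz /= ifT //; lia.
  have [|hg [hE E0]] := hgg; first by rewrite chi1.
  rewrite chi1 mulr1z -[X in _ = _ * (X * _)](expr0 (- 1)) -sumP //.
  rewrite (@reindex_psum _ _ (fun m => t + m) (fun l => l - t)); last first.
  + by move=> m; lia.
  + by move=> m; lia.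
  apply: eq_psum => m; rewrite (triple_monoE A B (t + m)).2 add0n.
  have -> : triple_exp A B (t + m) = lattice_exp n a b p + theta_exp (3 * K) (2 * K) m.
    rewrite triple_expE hE /theta_exp.
    have e : binz (A - (t + m)) + binz (B - (t + m)) + binz (t + m) = third_norm p + 3 * binz m + 2 * m.
      have := binzE (A - (t + m)); have := binzE (B - (t + m)); have := binzE (t + m); have := binzE m.
      have e : B = 3 * t - A by lia.
      move: hg; rewrite e; lia.
    rewrite e; lia.
  congr (_ * _); apply: sign_parity; lia.
- have chi2 : chiz (p.1 - p.2) = - 1.
    by rewrite /chiz /= ifF ?ifT //; lia.
  have [|hg [hE E0]] := hgg; first by rewrite chi2.
  rewrite chi2 -[_%:~R](expr1 (- 1)) -sumP //.
  rewrite (@reindex_psum _ _ (fun m => t - m) (fun l => t - l)); last first.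
  + by move=> m; lia.
  + by move=> m; lia.
  apply: eq_psum => m; rewrite (triple_monoE A B (t - m)).2.
  have -> : triple_exp A B (t - m) = lattice_exp n a b p + theta_exp (3 * K) (2 * K) m.
    rewrite triple_expE hE /theta_exp.
    have e : binz (A - (t - m)) + binz (B - (t - m)) + binz (t - m) = third_norm p + 3 * binz m + 2 * m.
      have := binzE (A - (t - m)); have := binzE (B - (t - m)); have := binzE (t - m); have := binzE m.
      have e : B = 3 * t + 1 - A by lia.
      move: hg; rewrite e; lia.
    rewrite e; lia.
  congr (_ * _); apply: sign_parity; lia.
have chi0 : chiz (p.1 - p.2) = 0.
  by rewrite /chiz /= !ifF //; lia.
rewrite chi0 mul0r mulr0; apply: ps_double0.
rewrite -psumN; last exact: summable_triple.
rewrite [LHS](@reindex_psum _ _ (fun m => 2 * t + 1 - m) (fun l => 2 * t + 1 - l)); last first.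
- by move=> m; lia.
- by move=> m; lia.
apply: eq_psum => m; rewrite (triple_monoE A B (_ - m)).2 (triple_monoE A B m).2.
have -> : triple_exp A B (2 * t + 1 - m) = triple_exp A B m.
  exact: triple_exp_sym.
rewrite -mulNr; congr (_ * _); rewrite -[RHS]mulN1r -exprS.
by apply: sign_parity; lia.
Qed.

Local Notation theta s := (pinfp s K * pinfp (K - s) K).

(** Three Jacobi products yield (q^K;q^K)_oo^3, while each sum over l returns one such factor;
    cancelling this unit leaves the square. *)
Lemma lattice_seriesE : lattice_series n a b
  = pinfp K K * pinfp K K * (theta a.+1 * (theta b.+1 * theta (a + b + 2))).
Proof.
have K0 : (0 < K)%N by lia.
have ga : (0 < a.+1 < K)%N by lia.
have gb : (0 < b.+1 < K)%N by lia.
have gc : (0 < a + b + 2 < K)%N by lia.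
have [sab eab] := psumM (summable_theta ga) (summable_theta gb).
have [sabc eabc] := psumM sab (summable_theta gc).
pose h (p : (int * int) * int) : (int * int) * int := ((p.1.1 - p.2, p.1.2 - p.2), p.2).
pose h' (p : (int * int) * int) : (int * int) * int := ((p.1.1 + p.2, p.1.2 + p.2), p.2).
have hK : cancel h h' by case=> [[A B] l]; rewrite /h /h' /= !subrK.
have h'K : cancel h' h by case=> [[A B] l]; rewrite /h /h' /= !addrK.
pose g (p : int * int) : int * int := (p.2 - 1, 1 - p.1).
pose g' (p : int * int) : int * int := (1 - p.2, p.1 + 1).
have gK : cancel g g' by case=> A B; rewrite /g /g' /= subrK opprB addrC subrK.
have g'K : cancel g' g by case=> A B; rewrite /g /g' /= addrK opprB addrC subrK.
have e : theta_series K a.+1 * theta_series K b.+1 * theta_series K (a + b + 2)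
    = pinfp K K * lattice_series n a b.
  rewrite -eab -eabc (reindex_psum _ hK h'K) pair_psum; last exact: summable_comp hK sabc.
  rewrite /lattice_series [psum (lattice_term n a b)](reindex_psum _ gK g'K).
  rewrite -(psumZ _ (summable_comp gK (summable_lattice n0 an bn))).2.
  by apply: eq_psum => -[A B]; exact: inner_sum.
apply: (mulrI (pinf_unit K0 K0)); rewrite -e !jacobi_triple //; ring.
Qed.
End Macdonald.

Lemma tchiE n a b : (0 < n)%N -> (a <= n)%N -> (b <= n)%N ->
  tchi (3 * n + 2) a b = lattice_series n (maxn a b) (minn a b) * iq ^+ 2 :> ps.
Proof.
move=> n0 an bn; rewrite lattice_seriesE //; [|lia|lia].
rewrite /tchi /theta_pow -/(_ * _ : ps) fps_invE; last by rewrite /fps_mul big_ord1 subn0 pinf0.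
rewrite -[LHS]/(pinfp (3 * n + 2) (3 * n + 2) * pinfp (3 * n + 2) (3 * n + 2) * ((pinfp 1 1 * pinfp 1 1)^-1
   * ((pinfp a.+1 (3 * n + 2) * pinfp (3 * n + 2 - a.+1) (3 * n + 2))
   * ((pinfp b.+1 (3 * n + 2) * pinfp (3 * n + 2 - b.+1) (3 * n + 2))
   * (pinfp (a + b + 2) (3 * n + 2) * pinfp (3 * n + 2 - (a + b + 2)) (3 * n + 2)))))).
rewrite invrM ?pinf_unit //.
case: (leqP a b) => _; rewrite ?[(b + a)%N]addnC; ring.
Qed.

Local Close Scope ring_scope.

Theorem theorem7p3 (k : nat) : (1 <= k)%N ->
  (forall a b : nat, (a <= k)%N -> (b < k)%N ->
    exists S1 S2 : fps,
      fps_sums_to k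
        (summand k (fun lam mu => \sum_(a.+1 <= i < k.+1) lam i
                                  + \sum_(b.+1 <= i < k) mu i)%N
                   (fun i => nat_of_bool (b == i))) S1 /\
      fps_sums_to k
        (summand k (fun lam mu => 1 + \sum_(a <= i < k.+1) lam i
                                  + \sum_(b <= i < k) mu i)%N
                   (fun i => nat_of_bool (b == i.+1))) S2 /\
      tchi (3 * k + 2) a b =1
        fps_sub S1 (fun n => if (0 < a * b)%N then S2 n else 0%R))
  /\ fps_sums_to k (summand k (fun _ _ => 0%N) (fun _ => 0%N)) (tchi (3 * k + 2) k k).
Proof.
case: k => // n _; split; last first.
  by rewrite tchiE // maxnn minnn -series_diag; exact: box_limit_sums.
move=> a b an bn.
exists (box_limit n.+1 (lin1 n.+1 a b) (fun i => nat_of_bool (b == i))).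
exists (box_limit n.+1 (lin2 n.+1 a b) (fun i => nat_of_bool (b == i.+1))).
split; first exact: box_limit_sums.
split; first exact: box_limit_sums.
rewrite tchiE //; last exact: ltnW.
move=> m; case: posnP => [ab0|].
  by rewrite -series_edge // /fps_sub subr0.
by rewrite muln_gt0 => /andP[a0 b0]; rewrite -series_interior.
Qed.
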